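(* Suppose that there are $R_0>0$ and $0<c_0\le C_0<\infty$ such that $E_\theta^{(1)}[\|\beta_{X_1}\|_{\Theta^*}]<\infty$ for all $\theta\in B^\Theta_{R_0}(\theta_0)$, $I(\theta_0)[h]\le C_0\|h\|_{H_0}^2$ for all $h\in\Theta$, and $I(\theta)[h]\ge c_0\|h\|_{H_0}^2$ for all $h\in\Theta$ and $\theta\in B^\Theta_{R_0}(\theta_0)$. Suppose also that $M$ is twice continuously Fréchet differentiable on $\Theta$. Then, for every $q\in[0,\alpha+d/2]$, $n\in\mathbb N$, $\tau\in\Theta^*$ and every regular cylindrical function $F:\Theta\to\mathbb R$, $$\mathrm{Var}_{\tilde\nu_\tau}[F(\theta)]\le\int_{\mathcal B}\big\langle\mathcal A_{n,q}\nabla^{H_q}F(\theta),\nabla^{H_q}F(\theta)\big\rangle_{H_q}d\tilde\nu_\tau(\theta)\le\kappa_{n,q}\int_{\mathcal B}\|\nabla^{H_q}F(\theta)\|_{H_q}^2\,d\tilde\nu_\tau(\theta).$$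
   Context: Hilbert scale. $H_0$ is a separable real Hilbert space with orthonormal basis $(e_k)_{k\ge1}$; $d\in\mathbb N$; $0<\lambda_1\le\lambda_2\le\cdots$ satisfies $\lambda_k\asymp k^{1/d}$. For $s\ge0$, $H_s=\{h=\sum_kh_ke_k:\|h\|_{H_s}^2=\sum_k\lambda_k^{2s}h_k^2<\infty\}$ with the corresponding inner product; for $s<0$, $H_s$ is the completion of $H_0$ under the same formula, identified with the dual of $H_{-s}$ via the $\langle\cdot,\cdot\rangle_{H_0}$-pairing. Exponential family. $p\ge0$, $\Theta=H_p$, $\Theta^*=H_{-p}$, $B^\Theta_r(\theta_0)=\{\theta\in\Theta:\|\theta-\theta_0\|_{H_p}\le r\}$. $(\mathbb X,\mathcal X,\lambda)$ is a $\sigma$-finite measure space, $x\mapsto\beta_x$ a measurable map $\mathbb X\to\Theta^*$ (unrelated to the smoothness index $\beta$), $M(\theta)=\log\int e^{\beta_x(\theta)}d\lambda(x)$ is finite for all $\theta\in\Theta$, $f_\theta(x)=\exp\{\beta_x(\theta)-M(\theta)\}$. $E_\theta^{(1)},\mathrm{Var}_\theta^{(1)}$ refer to $X_1$ with $\lambda$-density $f_\theta$. $I(\theta)[h]=\mathrm{Var}_\theta^{(1)}(\beta_{X_1}(h))$. $\theta_0\in H_\beta$ with $\beta>p$. Prior and kernels. $\Pi$ is the law of $\sum_{k\ge1}\lambda_k^{-\alpha-d/2}t_ke_k$, $t_k$ i.i.d. $N(0,1)$, with $\alpha>p$. For $\tau\in\Theta^*$ (and $n\in\mathbb N$), $\nu_\tau$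 is the probability measure with $d\nu_\tau(\theta)\propto e^{n[\tau(\theta)-M(\theta)]}d\Pi(\theta)$, the normalising constant being assumed finite for all $n,\tau$. Fix $0<R<R_0$, $\mathcal B=B^\Theta_R(\theta_0)$, and $\tilde\nu_\tau=\nu_\tau(\cdot\cap\mathcal B)/\nu_\tau(\mathcal B)$. Cylindrical functions. $F:\Theta\to\mathbb R$ is regular cylindrical if $F(\theta)=f(\theta_1,\dots,\theta_K)$, $\theta_k=\langle\theta,e_k\rangle_{H_0}$, for some $K\in\mathbb N$ and some bounded smooth $f:\mathbb R^K\to\mathbb R$ with bounded derivatives of all orders; its gradient in the $H_q$-geometry is $\nabla^{H_q}F(\theta)=\sum_{k=1}^K\lambda_k^{-2q}\partial_kf(\theta_1,\dots,\theta_K)e_k$. Operators. $\mathcal A_{n,q}:H_q\to H_q$ is the diagonal linear operator $\mathcal A_{n,q}e_k=\frac{\lambda_k^{2q}}{nc_0+\lambda_k^{2\alpha+d}}e_k$, and $\kappa_{n,q}=\|\mathcal A_{n,q}\|_{\mathcal L(H_q)}=\sup_k\frac{\lambda_k^{2q}}{nc_0+\lambda_k^{2\alpha+d}}$. *)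

(* Defs.v *)
From HB Require Import structures.
From mathcomp Require Import all_boot all_order all_algebra.
From mathcomp Require Import ring lra.
From mathcomp Require Import all_classical all_reals all_analysis.

Set Implicit Arguments.
Unset Strict Implicit.
Unset Printing Implicit Defensive.

Import Order.TTheory GRing.Theory Num.Theory.
Import numFieldNormedType.Exports.

Local Open Scope classical_set_scope.
Local Open Scope ring_scope.

(* Sequences indexed by k >= 1 in the text are indexed from 0 here: [eigval S k]
   is lambda_{k+1}, [hbasis k] below is e_{k+1}, and so on. *)
Record spectrum (R : realType) := Spectrum {
  sdim : nat ;
  eigval :> nat -> R ;
  sdim_gt0 : (0 < sdim)%N ;
  eigval_gt0 : forall k, 0 < eigval k ;
  eigval_nd : forall j k, (j <= k)%N -> eigval j <= eigval k ;
  eigval_asymp : exists c C : R, [/\ 0 < c, 0 < C & forall k,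
    c * k.+1%:R `^ (sdim%:R)^-1 <= eigval k <= C * k.+1%:R `^ (sdim%:R)^-1] }.

(* An element h = sum_k h_k e_k of H_s is its coefficient sequence (h_k), for all
   real s, including the completions H_s, s < 0. The maps [hdot] and [hnorm] are
   defined on raw sequences, so that the H_0 norm of an element h of H_p, p >= 0,
   is [hnorm S 0 h]. *)
Section coefficient_sequences.
Context {R : realType} (S : spectrum R).
Implicit Types (s a : R) (g h : nat -> R).

Definition hweight s (k : nat) : R := S k `^ (2 * s).

Definition hdot s g h : R :=
  limn (series (fun k => hweight s k * (g k * h k))).

Definition hnorm s h : R := Num.sqrt (hdot s h h).

Definition in_hs s : {pred nat -> R} := fun h =>
  `[< cvgn (series (fun k => hweight s k * (h k * h k))) >].

Lemma hweight_gt0 s k : 0 < hweight s k.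
Proof. exact/powR_gt0/eigval_gt0. Qed.

Lemma hdot_cvg s g h : g \in in_hs s -> h \in in_hs s ->
  cvgn (series (fun k => hweight s k * (g k * h k))).
Proof.
move=> /asboolP cg /asboolP ch; apply: normed_cvg.
apply: (@series_le_cvg _ _ (fun k => hweight s k * (g k * g k) +
                                     hweight s k * (h k * h k))) => [k|k|k|].
- exact: normr_ge0.
- by rewrite addr_ge0// mulr_ge0 ?(ltW (hweight_gt0 _ _))// -expr2 sqr_ge0.
- rewrite /= normrM gtr0_norm ?hweight_gt0// -mulrDr.
  rewrite ler_wpM2l ?(ltW (hweight_gt0 _ _))//.
  have := sqr_ge0 (g k + h k); have := sqr_ge0 (g k - h k).
  have := sqr_ge0 (g k); have := sqr_ge0 (h k).
  by rewrite ler_norml !expr2; nra.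
- exact: (is_cvg_seriesD cg ch).
Qed.

Lemma hdotC s g h : hdot s g h = hdot s h g.
Proof.
by congr (limn (series _)); apply/funext => k; rewrite (mulrC (g k)).
Qed.

Lemma in_hsP s a g h : g \in in_hs s -> h \in in_hs s ->
  (a *: g + h) \in in_hs s.
Proof.
move=> gs hs; apply/asboolP; have cgh := hdot_cvg gs hs.
move: gs hs => /asboolP cg /asboolP ch.
rewrite (_ : (fun k => _) = (a ^+ 2 *: (fun k => hweight s k * (g k * g k)) +
    (a *+ 2) *: (fun k => hweight s k * (g k * h k))) +
    (fun k => hweight s k * (h k * h k))); last first.
  apply/funext => k; rewrite !fctE /GRing.scale/=; ring.
apply: is_cvg_seriesD => //.
by apply: is_cvg_seriesD; [exact: (is_cvg_seriesZ cg)|exact: (is_cvg_seriesZ cgh)].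
Qed.

Lemma hdotDl s a g1 g2 h :
  g1 \in in_hs s -> g2 \in in_hs s -> h \in in_hs s ->
  hdot s (a *: g1 + g2) h = a * hdot s g1 h + hdot s g2 h.
Proof.
move=> g1s g2s hs.
have c1 := hdot_cvg g1s hs; have c2 := hdot_cvg g2s hs.
rewrite {1}/hdot (_ : (fun k => _) =
  a *: (fun k => hweight s k * (g1 k * h k)) +
  (fun k => hweight s k * (g2 k * h k))); last first.
  apply/funext => k; rewrite !fctE /GRing.scale/=; ring.
have c1' := is_cvg_seriesZ (k := a) c1.
by rewrite lim_seriesD// lim_seriesZ.
Qed.

Lemma in_hs_submod s : GRing.submod_closed (in_hs s).
Proof.
split; last by move=> a g h; exact: in_hsP.
apply/asboolP; rewrite (_ : series _ = cst 0); first exact: is_cvg_cst.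
by apply/funext => n; rewrite /series/= big1// => k _; rewrite !mulr0.
Qed.

HB.instance Definition _ s := GRing.isSubmodClosed.Build R (nat -> R) (in_hs s)
  (in_hs_submod s).

Record hscale s := HScale { hcoef :> nat -> R ; _ : hcoef \in in_hs s }.
HB.instance Definition _ s := [isSub for @hcoef s].
HB.instance Definition _ s := [Choice of hscale s by <:].
HB.instance Definition _ s := [SubChoice_isSubLmodule of hscale s by <:].

Lemma hdot_ge0 s h : h \in in_hs s -> 0 <= hdot s h h.
Proof.
move=> hs; apply: limr_ge; first exact: hdot_cvg.
apply: nearW => n; apply: sumr_ge0 => k _.
by rewrite mulr_ge0 ?(ltW (hweight_gt0 _ _))// -expr2 sqr_ge0.
Qed.

Lemma hdot_eq0 s h : h \in in_hs s -> hdot s h h = 0 -> h = 0.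
Proof.
move=> hs h0; apply/funext => k; apply/eqP; change (h k == 0); rewrite -sqrf_eq0.
have ge0 j : 0 <= hweight s j * (h j * h j).
  by rewrite mulr_ge0 ?(ltW (hweight_gt0 _ _))// -expr2 sqr_ge0.
have : series (fun k => hweight s k * (h k * h k)) k.+1 <= hdot s h h.
  apply: nondecreasing_cvgn_le; last exact: hdot_cvg.
  by apply/nondecreasing_seqP => n; rewrite /series/= big_nat_recr//= lerDl.
rewrite h0 /series/= big_nat_recr//= => le0.
have : hweight s k * (h k * h k) <= 0.
  by apply: le_trans le0; rewrite lerDr sumr_ge0.
rewrite pmulr_rle0 ?hweight_gt0// -expr2 => ?.
by apply/eqP/le_anti; rewrite sqr_ge0 andbT.
Qed.

Lemma hcoefP s (h : hscale s) : (h : nat -> R) \in in_hs s.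
Proof. by case: h. Qed.

Lemma hdot_CS s (g h : hscale s) :
  hdot s g h ^+ 2 <= hdot s g g * hdot s h h.
Proof.
have [h0|hn0] := eqVneq (hdot s h h) 0.
  rewrite h0 mulr0 (hdot_eq0 (hcoefP h) h0).
  rewrite [hdot _ _ _](_ : _ = 0) ?expr0n//.
  rewrite hdotC -[0](scale0r (0 : nat -> R)) -[X in hdot _ X _]addr0.
  have zs : (0 : nat -> R) \in in_hs s by exact: rpred0.
  rewrite hdotDl ?hcoefP// mul0r add0r.
  by have := hdotDl 1 zs zs (hcoefP g); rewrite scaler0 addr0; lra.
have h0 : 0 < hdot s h h by rewrite lt_neqAle eq_sym hn0 hdot_ge0 ?hcoefP.
have gs := hcoefP g; have hs := hcoefP h.
have expand c : hdot s (c *: (h : nat -> R) + g) (c *: (h : nat -> R) + g) =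
    c ^+ 2 * hdot s h h + c * hdot s g h *+ 2 + hdot s g g.
  have us : c *: (h : nat -> R) + g \in in_hs s by exact: in_hsP.
  rewrite hdotDl// ![hdot s _ (_ + _)]hdotC !hdotDl// (hdotC s h g); ring.
have : 0 <= hdot s (- hdot s g h / hdot s h h *: (h : nat -> R) + g)
                   (- hdot s g h / hdot s h h *: (h : nat -> R) + g).
  by apply: hdot_ge0; exact: in_hsP.
rewrite expand => /(mulr_ge0 (ltW h0)) H.
rewrite -subr_ge0; apply: (le_trans H); rewrite le_eqVlt; apply/orP; left.
by apply/eqP; field.
Qed.

Lemma ler_hnormD s (g h : hscale s) :
  hnorm s (g + h) <= hnorm s g + hnorm s h.
Proof.
rewrite -ler_sqr ?nnegrE ?addr_ge0 ?sqrtr_ge0//.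
have gs := hcoefP g; have hs := hcoefP h.
have ghs : (g : nat -> R) + h \in in_hs s.
  by have := in_hsP 1 gs hs; rewrite scale1r.
have E x y z : x \in in_hs s -> y \in in_hs s -> z \in in_hs s ->
    hdot s (x + y) z = hdot s x z + hdot s y z.
  by move=> *; rewrite -[x in x + _]scale1r hdotDl// mul1r.
rewrite sqrrD /hnorm !sqr_sqrtr ?hdot_ge0//.
rewrite E// ![hdot s _ (_ + _)]hdotC !E// (hdotC s h g).
have : hdot s g h <= Num.sqrt (hdot s g g) * Num.sqrt (hdot s h h).
  rewrite -sqrtrM ?hdot_ge0//; apply: (le_trans (ler_norm _)).
  by rewrite -sqrtr_sqr ler_sqrt ?hdot_CS// mulr_ge0 ?hdot_ge0.
lra.
Qed.

Lemma hnormZ s a (h : hscale s) : hnorm s (a *: h) = `|a| * hnorm s h.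
Proof.
have hs := hcoefP h.
have zs : (0 : nat -> R) \in in_hs s by exact: rpred0.
have ahs : a *: (h : nat -> R) \in in_hs s.
  by have := in_hsP a hs zs; rewrite addr0.
have Z g : g \in in_hs s -> hdot s (a *: (h : nat -> R)) g = a * hdot s h g.
  move=> gs; rewrite -[X in hdot _ X _]addr0 hdotDl//.
  by have := hdotDl 1 zs zs gs; rewrite scaler0 addr0; lra.
rewrite /hnorm (_ : hdot _ _ _ = a ^+ 2 * hdot s h h); last first.
  by rewrite Z// hdotC Z// expr2 mulrA.
by rewrite sqrtrM ?sqr_ge0// sqrtr_sqr.
Qed.

Lemma hnorm_eq0 s (h : hscale s) : hnorm s h = 0 -> h = 0.
Proof.
move=> /eqP; rewrite sqrtr_eq0 => le0; apply/val_inj => /=.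
by apply: (hdot_eq0 (hcoefP h)); apply/le_anti; rewrite le0 hdot_ge0 ?hcoefP.
Qed.

HB.instance Definition _ s := Lmodule_isNormed.Build R (hscale s)
  (@ler_hnormD s) (@hnormZ s) (@hnorm_eq0 s).

(* the Borel sigma-algebra of the norm topology *)
HB.instance Definition _ s := @isMeasurable.Build
  (sigma_display (@open (hscale s))) (hscale s)
  <<s @open (hscale s) >> (@sigma_algebra0 _ setT (@open (hscale s)))
  (@sigma_algebraC _ (@open (hscale s)))
  (@sigma_algebra_bigcup _ setT (@open (hscale s))).

(* [hpair b h] is sum_k b_k h_k, the action on H_s of the element b of its dual
   H_{-s} ([hweight 0] is constantly 1). *)
Definition hpair s (b : hscale (- s)) (h : hscale s) : R := hdot 0 b h.

Lemma delta_in_hs s k : (fun j => (j == k)%:R : R) \in in_hs s.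
Proof.
apply/asboolP/cvg_ex; exists (hweight s k).
apply: (@cvg_near_cst _ _ (hweight s k)).
near=> n; rewrite /series/= (bigD1_seq k) ?iota_uniq//=; last first.
  by rewrite mem_index_iota/=; near: n; exact: nbhs_infty_gt.
by rewrite eqxx !mulr1 big1 ?addr0// => j /negbTE ->; rewrite !mulr0.
Unshelve. all: by end_near. Qed.

Definition hbasis s k : hscale s := HScale (delta_in_hs s k).

(* The default 0 is only taken when (a_k h_k) is not in H_s, which does not happen
   for bounded a: see [hdiagE]. *)
Definition hdiag s (a : nat -> R) (h : hscale s) : hscale s :=
  insubd 0 (fun k => a k * h k).

Definition opnorm s (T : hscale s -> hscale s) : R :=
  sup [set `|T h| | h in [set h | `|h| <= 1]].

End coefficient_sequences.

Section diagonal_operators.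
Context {R : realType} (S : spectrum R).

Lemma in_hs_diag s (a : nat -> R) (M : R) (h : nat -> R) :
  (forall k, `|a k| <= M) -> h \in in_hs S s ->
  (fun k => a k * h k) \in in_hs S s /\
  hdot S s (fun k => a k * h k) (fun k => a k * h k) <= M ^+ 2 * hdot S s h h.
Proof.
move=> aM hs; have /asboolP ch := hs.
have c2 := is_cvg_seriesZ (k := M ^+ 2) ch.
have le k : hweight S s k * (a k * h k * (a k * h k)) <=
    M ^+ 2 *: (hweight S s k * (h k * h k)).
  rewrite /GRing.scale/= [leRHS]mulrCA ler_wpM2l ?(ltW (hweight_gt0 _ _ _))//.
  rewrite mulrACA -!expr2 ler_wpM2r ?sqr_ge0// -real_normK ?num_real//.
  by rewrite lerXn2r ?nnegrE// (le_trans _ (aM k)).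
have ge0 g k : 0 <= hweight S s k * (g * g).
  by rewrite mulr_ge0 ?(ltW (hweight_gt0 _ _ _))// -expr2 sqr_ge0.
have as_ : (fun k => a k * h k) \in in_hs S s.
  apply/asboolP; apply: (series_le_cvg _ _ le c2) => k //.
  by rewrite /GRing.scale/= mulr_ge0 ?sqr_ge0.
split=> //; rewrite /hdot -[leRHS](lim_seriesZ (M ^+ 2) ch).
apply: ler_lim => //; first exact: hdot_cvg.
by near=> n; apply: ler_sum => k _; exact: le.
Unshelve. all: by end_near. Qed.

Lemma hdiagE s (a : nat -> R) (M : R) (h : hscale S s) :
  (forall k, `|a k| <= M) -> hdiag a h = (fun k => a k * h k) :> (nat -> R).
Proof.
by move=> aM; rewrite /hdiag insubdK//; apply: (in_hs_diag aM _).1; exact: hcoefP.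
Qed.

Lemma hnorm_basis s k : `|hbasis S s k| = Num.sqrt (hweight S s k).
Proof.
congr Num.sqrt; apply: cvg_lim => //.
apply: (@cvg_near_cst _ _ (hweight S s k)).
near=> n; rewrite /series/= (bigD1_seq k) ?iota_uniq//=; last first.
  by rewrite mem_index_iota/=; near: n; exact: nbhs_infty_gt.
by rewrite eqxx !mulr1 big1 ?addr0// => j /negbTE ->; rewrite !mulr0.
Unshelve. all: by end_near. Qed.

Lemma opnorm_hdiag s (a : nat -> R) (M : R) :
  (forall k, 0 <= a k <= M) -> opnorm (@hdiag _ S s a) = sup (range a).
Proof.
move=> aM.
have norma k : `|a k| <= M by have /andP[? ?] := aM k; rewrite ger0_norm.
have hsup : has_sup (range a).
  by split; [exists (a 0%N), 0%N|exists M => _ [k _ <-]; have /andP[] := aM k].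
have asup k : a k <= sup (range a) by apply: sup_upper_bound => //; exists k.
have norms k : `|a k| <= sup (range a).
  by have /andP[? ?] := aM k; rewrite ger0_norm.
have s0 : 0 <= sup (range a) by apply: le_trans (norms 0%N).
have ub (h : hscale S s) : `|h| <= 1 -> `|hdiag a h| <= sup (range a).
  move=> h1; apply: (@le_trans _ _ (sup (range a) * `|h|)); last first.
    by rewrite -[leRHS]mulr1 ler_wpM2l.
  change (hnorm S s (hdiag a h) <= sup (range a) * hnorm S s h).
  rewrite -ler_sqr ?nnegrE ?mulr_ge0 ?sqrtr_ge0// exprMn.
  rewrite /hnorm !sqr_sqrtr ?hdot_ge0 ?hcoefP// (hdiagE _ norma).
  exact: (in_hs_diag norms (hcoefP h)).2.
apply/le_anti/andP; split.
  apply: ge_sup; first by exists `|hdiag a (0 : hscale S s)|, 0 => //=; rewrite normr0.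
  by move=> _ [h h1 <-]; exact: ub.
apply: ge_sup; first by exists (a 0%N), 0%N.
move=> _ [k _ <-]; apply: ub_le_sup.
  by exists (sup (range a)) => _ [h h1 <-]; exact: ub.
have e0 : 0 < `|hbasis S s k| by rewrite hnorm_basis sqrtr_gt0 hweight_gt0.
exists (`|hbasis S s k|^-1 *: hbasis S s k).
  by rewrite /= normrZ gtr0_norm ?invr_gt0// mulVf// gt_eqF.
have -> : hdiag a (`|hbasis S s k|^-1 *: hbasis S s k) =
    (a k * `|hbasis S s k|^-1) *: hbasis S s k.
  apply/val_inj/funext => j; rewrite /= (hdiagE _ norma)/=.
  change (a j * (`|hbasis S s k|^-1 * (j == k)%:R) =
    a k * `|hbasis S s k|^-1 * (j == k)%:R).
  by have [->|_] := eqVneq j k; rewrite ?mulr0// !mulr1.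
rewrite normrZ normrM ger0_norm; last by have /andP[] := aM k.
by rewrite gtr0_norm ?invr_gt0// -mulrA mulVf ?mulr1// gt_eqF.
Qed.

End diagonal_operators.

(* Taking [hscale S 0] for H_0 loses no generality: any real Hilbert space with
   an orthonormal basis [e] is isometric to it through the coefficients of [e]. *)
Section riesz_fischer.
Context {R : realType} (S : spectrum R) (H : completeNormedModType R)
  (ip : H -> H -> R) (e : nat -> H)
  (ipC : forall x y, ip x y = ip y x)
  (ipl : forall a x y z, ip (a *: x + y) z = a * ip x z + ip y z)
  (ipn : forall x, ip x x = `|x| ^+ 2)
  (orth : forall j k, ip (e j) (e k) = (j == k)%:R)
  (total : forall x, (forall k, ip x (e k) = 0) -> x = 0).

Lemma ip0 z : ip 0 z = 0.
Proof. by have := ipl 1 0 0 z; rewrite scaler0 addr0; lra. Qed.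

Lemma ipB x y z : ip (x - y) z = ip x z - ip y z.
Proof. by rewrite addrC -scaleN1r ipl; lra. Qed.

Lemma ip_sum (c : nat -> R) m n z :
  ip (\sum_(m <= k < n) c k *: e k) z = \sum_(m <= k < n) c k * ip (e k) z.
Proof.
elim: (index_iota m n) => [|k l IH]; first by rewrite !big_nil ip0.
by rewrite !big_cons ipl IH.
Qed.

Lemma norm_sum (c : nat -> R) m n :
  `|\sum_(m <= k < n) c k *: e k| ^+ 2 = \sum_(m <= k < n) c k * c k.
Proof.
rewrite -ipn ip_sum; apply: eq_big_nat => k kmn; congr (_ * _).
rewrite ipC ip_sum (bigD1_seq k) ?iota_uniq ?mem_index_iota//= orth eqxx mulr1.
by rewrite big1 ?addr0// => j /negbTE jk; rewrite orth jk mulr0.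
Qed.

Lemma ip_CS x z : `|ip x z| <= `|x| * `|z|.
Proof.
have [->|z0] := eqVneq z 0; first by rewrite ipC ip0 !normr0 mulr0.
have nz : 0 < `|z| by rewrite normr_gt0.
have : 0 <= `|(- ip x z / `|z| ^+ 2) *: z + x| ^+ 2 by rewrite sqr_ge0.
rewrite -(ipn (_ *: _ + _)) ipl ![ip _ (_ + _)]ipC !ipl (ipC z x) !ipn.
move=> /(mulr_ge0 (ltW (exprn_gt0 2 nz))) Hc.
rewrite -ler_sqr ?nnegrE ?mulr_ge0// real_normK ?num_real// exprMn -subr_ge0.
apply: (le_trans Hc); rewrite le_eqVlt; apply/orP; left; apply/eqP.
by field; rewrite gt_eqF.
Qed.

Lemma hweight0 k : hweight S 0 k = 1.
Proof. by rewrite /hweight mulr0 powRr0. Qed.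

Lemma in_hs0P (c : R ^nat) : reflect (cvgn (series (fun k => c k * c k))) (c \in in_hs S 0).
Proof.
rewrite (_ : (fun k => c k * c k) = (fun k => hweight S 0 k * (c k * c k))).
  exact: asboolP.
by apply/funext => k; rewrite hweight0 mul1r.
Qed.

Lemma series_onb (c : R ^nat) : c \in in_hs S 0 ->
  exists2 y, forall k, ip y (e k) = c k & `|y| ^+ 2 = hdot S 0 c c.
Proof.
move=> /in_hs0P cc.
have cy : cvgn (series (fun k => c k *: e k)).
  apply/cauchy_cvgP/cauchy_seriesP => eps eps0.
  move: (cc) => /cauchy_cvgP/cauchy_seriesP/(_ _ (exprn_gt0 2 eps0)).
  apply: filterS => -[m n] /=; rewrite -norm_sum ger0_norm ?sqr_ge0//.
  by rewrite ltr_sqr ?nnegrE// ltW.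
pose y := limn (series (fun k => c k *: e k)).
exists y => [k|].
  apply/eqP; rewrite -subr_eq0 -normr_le0; apply/ler_addgt0Pl => eps eps0.
  rewrite addr0.
  have nk : `|e k| = 1.
    by apply/eqP; rewrite -(@eqrXn2 _ 2)// -ipn orth eqxx expr1n.
  have : \forall n \near \oo, `|y - series (fun k => c k *: e k) n| <= eps.
    by move/cvgrPdist_le : (cy : _ --> y); exact.
  move=> hn; near \oo => n.
  have := ip_CS (y - series (fun k => c k *: e k) n) (e k).
  rewrite nk mulr1 ipB /series/= ip_sum (bigD1_seq k) ?iota_uniq//=; last first.
    by rewrite mem_index_iota/=; near: n; exact: nbhs_infty_gt.
  rewrite orth eqxx mulr1 big1 ?addr0; last first.
    by move=> j /negbTE jk; rewrite orth jk mulr0.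
  by move=> /le_trans; apply; near: n.
have -> : hdot S 0 c c = limn (series (fun k => c k * c k)).
  by congr (limn (series _)); apply/funext => k; rewrite hweight0 mul1r.
apply/esym/cvg_lim => //.
rewrite (_ : series _ = (fun n => `|series (fun k => c k *: e k) n| ^+ 2)).
  by rewrite expr2; under eq_fun do rewrite expr2; apply: cvgM; exact: cvg_norm.
by apply/funext => n; rewrite /series/= norm_sum.
Unshelve. all: by end_near. Qed.

Lemma coef_in_hs x : (fun k => ip x (e k)) \in in_hs S 0.
Proof.
apply/in_hs0P; apply: nondecreasing_is_cvgn.
  by apply/nondecreasing_seqP => n; rewrite /series/= big_nat_recr//= lerDl -expr2 sqr_ge0.
exists (`|x| ^+ 2) => _ [n _ <-].
rewrite /series/= -norm_sum; set u := \sum_(0 <= k < n) _.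
have xu : ip x u = `|u| ^+ 2.
  rewrite ipC ip_sum norm_sum; apply: eq_bigr => k _; by rewrite (ipC (e k)).
have := sqr_ge0 `|x - u|.
by rewrite -(ipn (_ - _)) ipB ![ip _ (_ - _)]ipC !ipB (ipC u x) xu !ipn; lra.
Qed.

Lemma riesz_fischer : exists Phi : H -> hscale S 0,
  [/\ forall x k, Phi x k = ip x (e k), linear Phi, bijective Phi &
      forall x, `|Phi x| = `|x|].
Proof.
exists (fun x => HScale (coef_in_hs x)); split=> //.
- by move=> a x y; apply/val_inj/funext => k /=; rewrite ipl.
- pose Psi (c : hscale S 0) := projT1 (cid2 (series_onb (hcoefP c))).
  have PsiE c k : ip (Psi c) (e k) = c k by rewrite /Psi; case: cid2.
  exists Psi => [x|c]; last by apply/val_inj/funext => k /=; rewrite PsiE.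
  apply/eqP; rewrite -subr_eq0; apply/eqP/total => k.
  by rewrite ipB PsiE/= subrr.
- move=> x; have [y yE ny] := series_onb (coef_in_hs x).
  have <- : y = x.
    by apply/eqP; rewrite -subr_eq0; apply/eqP/total => k; rewrite ipB yE subrr.
  change (hnorm S 0 (fun k => ip y (e k)) = `|y|).
  rewrite /hnorm; under eq_fun do rewrite yE.
  by rewrite -ny sqrtr_sqr ger0_norm.
Qed.

End riesz_fischer.

Section exponential_family.
Context {R : realType} (S : spectrum R) (p : R).
Context d (X : measurableType d) (mu : {measure set X -> \bar R})
  (bx : X -> hscale S (- p)).
Implicit Types th h : hscale S p.

Definition partition_fun th : \bar R :=
  (\int[mu]_x (expR (hpair (bx x) th))%:E)%E.

Definition log_partition th : R := ln (fine (partition_fun th)).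

Definition expfam_density th (x : X) : R :=
  expR (hpair (bx x) th - log_partition th).

(* mean and variance of g(X_1) when X_1 has mu-density [expfam_density th] *)
Definition expfam_mean th (g : X -> R) : \bar R :=
  (\int[mu]_x (g x * expfam_density th x)%:E)%E.

Definition expfam_var th (g : X -> R) : \bar R :=
  expfam_mean th (fun x => (g x - fine (expfam_mean th g)) ^+ 2).

Definition fisher_info th h : \bar R :=
  expfam_var th (fun x => hpair (bx x) h).

End exponential_family.

Section calculus.
Context {R : realType} (S : spectrum R).

(* [DM th] is the element of H_{-p} representing the continuous linear form
   ['d M th] on H_p; the second derivative ['d DM th] : H_p -> H_{-p} is required
   to be continuous in th for the operator norm. *)
Definition C2_frechet (p : R) (M : hscale S p -> R) : Prop :=
  exists DM : hscale S p -> hscale S (- p),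
  [/\ forall th, differentiable M th,
      forall th h, 'd M th h = hpair (DM th) h,
      forall th, differentiable DM th &
      forall (th : hscale S p) (eps : R), 0 < eps ->
        \forall th' \near th, forall h,
          `|'d DM th' h - 'd DM th h| <= eps * `|h| ].

Definition pderivs (K : nat) (f : 'rV[R]_K -> R) (l : seq 'I_K) :
    'rV[R]_K -> R :=
  foldr (fun i g x => 'D_(delta_mx 0 i) g x) f l.

(* f is smooth iff all its iterated partial derivatives are differentiable; the
   case l = [::] bounds f itself. *)
Definition smooth_bounded (K : nat) (f : 'rV[R]_K -> R) : Prop :=
  forall l : seq 'I_K, (forall x, differentiable (pderivs f l) x) /\
    exists C : R, forall x, `|pderivs f l x| <= C.

Definition hproj (K : nat) (h : nat -> R) : 'rV[R]_K := \row_(k < K) h k.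

Definition cyl (p : R) (K : nat) (f : 'rV[R]_K -> R) (th : hscale S p) : R :=
  f (hproj K th).

Definition cyl_grad (p q : R) (K : nat) (f : 'rV[R]_K -> R)
    (th : hscale S p) : hscale S q :=
  \sum_(k < K) (S k `^ (- (2 * q)) * 'D_(delta_mx 0 k) f (hproj K th)) *:
    hbasis S q k.

End calculus.

Section measures.
Context {R : realType} (S : spectrum R) (p : R).

Definition mutually_independent d (Omega : measurableType d)
    (P : probability Omega R) (t : nat -> Omega -> R) : Prop :=
  forall (J : seq nat) (A : nat -> set R), uniq J ->
    (forall k, measurable (A k)) ->
    P (\bigcap_(k in [set` J]) t k @^-1` A k) =
      (\prod_(k <- J) P (t k @^-1` A k))%E.

(* the law of the random series sum_k lambda_k^(-alpha-d/2) t_k e_k *)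
Definition gaussian_prior (alpha : R) (Pi : probability (hscale S p) R) :=
  exists d (Omega : measurableType d) (P : probability Omega R)
    (t : nat -> {RV P >-> R}) (vth : {RV P >-> hscale S p}),
  [/\ mutually_independent P t,
      forall k A, measurable A -> distribution P (t k) A = normal_prob 0 1 A,
      {ae P, forall w, series (fun k =>
        (S k `^ (- alpha - (sdim S)%:R / 2) * t k w) *: hbasis S p k) @ \oo
          --> vth w} &
      forall A, measurable A -> Pi A = distribution P vth A ].

Definition tilt_weight (n : nat) (tau : hscale S (- p)) (M : hscale S p -> R)
    (th : hscale S p) : R := expR (n%:R * (hpair tau th - M th)).

Definition tilt_const (Pi : probability (hscale S p) R) n tau M : \bar R :=
  (\int[Pi]_th (tilt_weight n tau M th)%:E)%E.

Definition tilted (Pi : probability (hscale S p) R) n tau M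
    (nu : probability (hscale S p) R) : Prop :=
  forall A, measurable A ->
  nu A = ((fine (tilt_const Pi n tau M))^-1%:E *
          \int[Pi]_(th in A) (tilt_weight n tau M th)%:E)%E.

Definition conditioned (nu : probability (hscale S p) R) (B : set (hscale S p))
    (nuB : probability (hscale S p) R) : Prop :=
  forall A, measurable A -> nuB A = (fine (nu (A `&` B)) / fine (nu B))%:E.

Definition hball (th0 : hscale S p) (r : R) : set (hscale S p) :=
  [set th | `|th - th0| <= r].

End measures.

Section prior_operator.
Context {R : realType} (S : spectrum R).

Definition acoef (n : nat) (c0 alpha q : R) (k : nat) : R :=
  S k `^ (2 * q) / (n%:R * c0 + S k `^ (2 * alpha + (sdim S)%:R)).

Definition Aop n c0 alpha q : hscale S q -> hscale S q :=
  hdiag (acoef n c0 alpha q).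

Definition kappa n c0 alpha q : R := opnorm (@Aop n c0 alpha q).

Lemma acoef_bound n (c0 alpha q : R) k : 0 <= c0 ->
  q <= alpha + (sdim S)%:R / 2 ->
  0 <= acoef n c0 alpha q k <=
    S 0%N `^ (2 * q - (2 * alpha + (sdim S)%:R)).
Proof.
move=> c00 qle; have S0 j := eigval_gt0 S j.
have den : 0 < n%:R * c0 + S k `^ (2 * alpha + (sdim S)%:R).
  by rewrite ltr_wpDl ?powR_gt0// mulr_ge0.
rewrite /acoef divr_ge0 ?(ltW den) ?powR_ge0//= ler_pdivrMr//.
set u := 2 * q - _.
apply: (@le_trans _ _ (S k `^ u * S k `^ (2 * alpha + (sdim S)%:R))).
  by rewrite -powRD ?subrK// (gt_eqF (S0 k)) implybT.
apply: ler_pM; rewrite ?powR_ge0//; last by rewrite lerDr mulr_ge0.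
rewrite -[u]opprK !(powRN _ (- u)) lef_pV2 ?posrE ?powR_gt0//.
apply: ge0_ler_powR; rewrite ?nnegrE ?(ltW (S0 _))//; last exact: eigval_nd.
rewrite /u; lra.
Qed.

Lemma AopE n (c0 alpha q : R) (h : hscale S q) : 0 <= c0 ->
  q <= alpha + (sdim S)%:R / 2 ->
  Aop n c0 alpha h = (fun k => acoef n c0 alpha q k * h k) :> (nat -> R).
Proof.
move=> c00 qle; apply: hdiagE => k.
by have /andP[? ?] := acoef_bound n k c00 qle; rewrite ger0_norm//; eassumption.
Qed.

Lemma kappaE n (c0 alpha q : R) : 0 <= c0 ->
  q <= alpha + (sdim S)%:R / 2 ->
  kappa n c0 alpha q = sup (range (acoef n c0 alpha q)).
Proof. by move=> c00 qle; apply: opnorm_hdiag => k; exact: acoef_bound. Qed.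

End prior_operator.

(* Main.v *)
Require Import Defs.
From HB Require Import structures.
From mathcomp Require Import all_boot all_order all_algebra.
From mathcomp Require Import ring lra.
From mathcomp Require Import all_classical all_reals all_analysis.
From mathcomp Require Import measurable_realfun.

Set Implicit Arguments.
Unset Strict Implicit.
Unset Printing Implicit Defensive.

Import Order.TTheory GRing.Theory Num.Theory.
Import numFieldNormedType.Exports.

Local Open Scope classical_set_scope.
Local Open Scope ring_scope.

(** The conditioned measure has density proportional to
    exp (n (tau - M)) on the ball, relative to the Gaussian prior, whose
    precision in the k-th coordinate is lambda_k ^ (2 alpha + d). On the ball of
    radius r0 the log-partition function M satisfies the strong midpoint
    convexity
      M x + M y - 2 M ((x + y) / 2) >= c0 |x - y|_0 ^ 2 / 4,
    because its second differences along lines dominate the Fisher information.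
    The posterior is therefore strongly log-concave with constant precision
    D_k = n c0 + lambda_k ^ (2 alpha + d) in the k-th coordinate. The first
    inequality is the Brascamp-Lieb inequality for this precision, because
    <A_(n,q) grad F, grad F>_(H_q) = sum_k (d_k F) ^ 2 / D_k whatever q is
    ([gradient_energyE]). The second one bounds A_(n,q) by its operator norm.

    Brascamp-Lieb is obtained from the Prekopa-Leindler inequality, in the way
    of Bobkov and Ledoux. On the line, Prekopa-Leindler follows from layer cake
    and the Brunn-Minkowski inequality for midpoints
    ([brunn_minkowski_midpoint], [prekopa_leindler]). Against the standard
    Gaussian it acquires the factor exp ((x - y) ^ 2 / 4), and in this form it
    passes to functions of finitely many independent Gaussian coordinates by
    integrating one coordinate at a time, because resampling one coordinate
    preserves the law of an independent sequence ([resampling],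
    [prekopa_leindler_gaussian_sequence]). Partial sums of the random series
    converge almost surely in H_p, so the inequality holds for continuous
    bounded functions under the prior ([prekopa_leindler_gaussian_prior]).

    Applied to exp G, exp (- H) and 1, all weighted by the posterior density
    times a continuous log-concave cutoff of the ball, it gives
      E exp G * E exp (- H) <= 1
    as soon as G x - H y <= sum_k D_k (x_k - y_k) ^ 2 / 4
    ([conditioned_laplace_duality]). For H = e F a second-order Taylor
    expansion of F shows that G = e F - e ^ 2 (1 + b e) Gamma is admissible,
    where Gamma = sum_k (d_k F) ^ 2 / D_k and b is a constant; comparing the
    terms of order e ^ 2 as e tends to 0 yields Var F <= E Gamma
    ([variance_le_of_laplace_duality]). *)

(** * Image measures and densities *)

Section image_measure.
Context d d' (T1 : measurableType d) (T2 : measurableType d') (R : realType).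
Variables (m : {measure set T1 -> \bar R}) (f : T1 -> T2).
Hypothesis mf : measurable_fun setT f.

(** Measurability of f is part of the definition, so that integrals against
    the image carry no side condition. *)
Definition image_measure : {measure set T2 -> \bar R}.
Proof. refine (pushforward m f : {measure set T2 -> \bar R}); exact: mf. Defined.

Lemma image_measureE A : image_measure A = m (f @^-1` A).
Proof. by []. Qed.

Lemma ge0_integral_image_measure (g : T2 -> \bar R) :
  measurable_fun setT g -> (forall y, (0 <= g y)%E) ->
  (\int[image_measure]_y g y = \int[m]_x g (f x))%E.
Proof.
move=> mg g0; by rewrite (ge0_integral_pushforward mf m measurableT mg)// preimage_setT.
Qed.

End image_measure.

Section density.
Import HBNNSimple.

(** Both sides agree on simple functions; monotone convergence does the rest. *)
Lemma ge0_integral_density d (T : measurableType d) (R : realType)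
  (mu m : {measure set T -> \bar R}) (w : T -> R) :
  measurable_fun setT w -> (forall x, 0 <= w x) ->
  (forall A, measurable A -> m A = (\int[mu]_(x in A) (w x)%:E)%E) ->
  forall g : T -> \bar R, measurable_fun setT g -> (forall x, (0 <= g x)%E) ->
  (\int[m]_x g x = \int[mu]_x (g x * (w x)%:E))%E.
Proof.
move=> mw w0 mE g mg g0.
pose h := nnsfun_approx measurableT mg.
have hg x : (h n x)%:E @[n --> \oo] --> g x by apply: cvg_nnsfun_approx.
have hnd x a b : (a <= b)%N -> h a x <= h b x by move=> ab; exact/lefP/nd_nnsfun_approx.
have mwE : measurable_fun setT (EFin \o w) by exact/measurable_EFinP.
transitivity (limn (fun n => \int[m]_x (h n x)%:E))%E.
  rewrite -monotone_convergence//.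
  - by apply: eq_integral => x _; apply/esym/cvg_lim.
  - by move=> n; exact/measurable_EFinP.
  - by move=> n x _; rewrite lee_fin.
  - by move=> x _ a b ab; rewrite lee_fin hnd.
transitivity (limn (fun n => \int[mu]_x ((h n x)%:E * (w x)%:E)))%E; last first.
  rewrite -monotone_convergence//.
  - apply: eq_integral => x _; apply/cvg_lim => //.
    by apply: cvgeZr => //; exact: hg.
  - by move=> n; apply: emeasurable_funM => //; exact/measurable_EFinP.
  - by move=> n x _; rewrite -EFinM lee_fin mulr_ge0.
  - by move=> x _ a b ab; rewrite -!EFinM lee_fin ler_wpM2r// hnd.
congr (limn _); apply/funext => n.
have mI r : measurable (h n @^-1` [set r]) by [].
have w0E x : (0 <= (w x)%:E)%E by rewrite lee_fin.
under eq_integral do rewrite fimfunE -fsumEFin//.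
rewrite ge0_integral_fsum//; last 2 first.
  - by move=> r; exact/measurable_EFinP/measurable_funM.
  - by move=> r x _; rewrite nnfun_muleindic_ge0.
under [RHS]eq_integral => x _.
  rewrite fimfunE -fsumEFin// ge0_mule_fsuml; last first.
    by move=> r; rewrite nnfun_muleindic_ge0.
  over.
rewrite ge0_integral_fsum//; last 2 first.
  - move=> r; apply: emeasurable_funM => //.
    exact/measurable_EFinP/measurable_funM.
  - by move=> r x _; rewrite mule_ge0// nnfun_muleindic_ge0.
apply: eq_fsbigr => r; rewrite inE => -[x0 _ rE].
have r0 : 0 <= r by rewrite -rE.
under eq_integral do rewrite EFinM.
rewrite ge0_integralZl_EFin//; last by exact/measurable_EFinP.
rewrite integral_indic// setIT.
under [RHS]eq_integral do rewrite EFinM -muleA.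
rewrite ge0_integralZl_EFin//; first last.
- by apply: emeasurable_funM => //; exact/measurable_EFinP.
- by move=> x _; rewrite mule_ge0// lee_fin.
congr (_ * _)%E.
rewrite mE// integral_mkcond; apply: eq_integral => x _.
rewrite patchE indicE; case: ifPn => _; first by rewrite mul1e.
by rewrite mul0e.
Qed.

End density.

(** * The Prekopa-Leindler inequality on the line *)

Section one_dimensional.
Context {R : realType}.
Notation mu := (@lebesgue_measure R).

(** An affine map of slope 2 halves Lebesgue measure: both sides are measures
    agreeing on half-open intervals. *)
Lemma lebesgue_half_affine (c : R) (A : set R) : measurable A ->
  (2%:E * mu ((fun y => 2 * y - c)%R @^-1` A) = mu A)%E.
Proof.
move=> mA.
have mphi : measurable_fun setT (fun y : R => 2 * y - c : R).
  by apply: measurable_funB => //; exact: measurable_funM.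
pose m : {measure set (measurableTypeR R) -> \bar R} :=
  mscale (NngNum (ler0n R 2))
    (@image_measure _ _ (measurableTypeR R) (measurableTypeR R) R mu _ mphi).
have mE : forall X, ocitv X -> mu X = m X; last by rewrite (lebesgue_measure_unique mE mA).
move=> X /ocitvP[->|[[a b] /= ab ->]]; first by rewrite !measure0.
rewrite /m/mscale/= (@image_measureE _ _ (measurableTypeR R) (measurableTypeR R) R mu _ mphi).
rewrite (_ : _ @^-1` _ = `]((a+c)/2), ((b+c)/2)]%classic); last first.
  by apply/seteqP; split=> x /=; rewrite !in_itv/= => /andP[? ?]; apply/andP; split; lra.
have E x y : x < y -> mu `]x, y]%classic = (y - x)%:E.
  by move=> xy; rewrite lebesgue_measure_itv/= lte_fin xy.
rewrite E//; transitivity (2%:E * ((b + c) / 2 - (a + c) / 2)%:E)%E.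
  by rewrite -EFinM; congr EFin; field.
by congr (_ * _)%E; rewrite -E//; lra.
Qed.

Lemma half_affine_measurable (c : R) (A : set R) : measurable A ->
  measurable ((fun y => 2 * y - c)%R @^-1` A).
Proof.
move=> mA.
have mphi : measurable_fun setT (fun y : R => 2 * y - c : R).
  by apply: measurable_funB => //; exact: measurable_funM.
by rewrite -[X in measurable X]setTI; exact: mphi.
Qed.

(** Twice the set C contains the translates A' + b and a + B' of the parts
    A' of A below a and B' of B above b. These translates lie on either side of
    a + b, so they overlap in a null set and their measures add up. *)
Lemma midpoint_glue (A B C : set R) (a b : R) :
  measurable A -> measurable B -> measurable C -> A a -> B b ->
  (forall x y, A x -> B y -> C ((x + y) / 2)) ->
  (mu (A `&` `]-oo, a]) + mu (B `&` `[b, +oo[) <= 2%:E * mu C)%E.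
Proof.
move=> mA mB mC Aa Bb ABC.
have mA' : measurable (A `&` `]-oo, a]) by apply: measurableI.
have mB' : measurable (B `&` `[b, +oo[ `\ b) by apply: measurableD => //; apply: measurableI.
(* Removing the point b makes the two pieces of C below disjoint. *)
have -> : mu (B `&` `[b, +oo[) = mu (B `&` `[b, +oo[ `\ b).
  have bB : [set b] `<=` B `&` `[b, +oo[ by move=> _ ->; split => //=; rewrite in_itv/= lexx.
  have mB0 : measurable (B `&` `[b, +oo[) by apply: measurableI.
  have -> : mu (B `&` `[b, +oo[) = mu ((B `&` `[b, +oo[ `\ b) `|` [set b]).
    by rewrite setUC setDUK.
  rewrite measureU//; last by apply/seteqP; split=> x //= [[_ h] /h].
  have /= -> := lebesgue_measure_set1 b; by rewrite adde0.
rewrite -(lebesgue_half_affine b mA') -(lebesgue_half_affine a mB').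
rewrite -ge0_muleDr// lee_pmul2l//.
rewrite -measureU//=; first last.
- apply/seteqP; split=> // x /=; rewrite !in_itv/= !andbT.
  by move=> [[_ h1] [[_ h2] h3]]; apply: h3; lra.
- exact: half_affine_measurable.
- exact: half_affine_measurable.
apply: le_measure; rewrite ?inE//.
  by apply: measurableU; exact: half_affine_measurable.
move=> x /= [[Ax _]|[[Bx _] _]].
- by have := ABC _ _ Ax Bb; congr C; lra.
- by have := ABC _ _ Aa Bx; congr C; lra.
Qed.

Lemma measure_le_exhaustion (A : set R) (F : (set R)^nat) (y : \bar R) :
  (forall n, measurable (F n)) -> nondecreasing_seq F -> \bigcup_n F n = A ->
  (forall n, (mu (F n) <= y)%E) -> (mu A <= y)%E.
Proof.
move=> mF ndF FA Fy; rewrite -FA.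
have mU : measurable (\bigcup_n F n) by apply: bigcupT_measurable.
have cF := nondecreasing_cvg_mu mF mU ndF (mu := mu).
rewrite -(cvg_lim _ cF)//; apply: lime_le; first by apply/cvg_ex; exists (mu (\bigcup_n F n)).
by apply: nearW => n; exact: Fy.
Qed.

(** The parts of A below its own points increase to A without its supremum,
    and if the supremum belongs to A then one of these parts is A itself. In the
    Brunn-Minkowski inequality this stands in for approximation by compact
    sets. *)
Lemma measure_le_lower_parts (A : set R) (y : \bar R) :
  measurable A -> A !=set0 ->
  (forall a, A a -> (mu (A `&` `]-oo, a]) <= y)%E) -> (mu A <= y)%E.
Proof.
move=> mA A0 Ay.
have exh (c : R^nat) : nondecreasing_seq c -> (forall n, exists2 a, A a & c n <= a) ->
    (forall x, A x -> exists n, x <= c n) -> (mu A <= y)%E.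
  move=> ndc cA Ac; apply: (@measure_le_exhaustion A (fun n => A `&` `]-oo, c n])).
  - by move=> n; apply: measurableI.
  - move=> m n mn; apply/subsetPset => x [Ax]; rewrite /= !in_itv/= => xc; split => //=.
    exact: le_trans xc (ndc _ _ mn).
  - apply/seteqP; split; first by move=> x [n _ []].
    move=> x Ax; have [n xn] := Ac _ Ax; by exists n => //; split=> //; rewrite /= in_itv/=.
  - move=> n; have [a Aa ca] := cA n; apply: le_trans (Ay a Aa).
    apply: le_measure; rewrite ?inE//; [exact: measurableI|exact: measurableI|].
    by move=> x [Ax]; rewrite /= !in_itv/= => xc; split=> //=; exact: le_trans xc ca.
have [hub|nub] := pselect (has_ubound A).
  have hs : has_sup A by split.
  have [As|As] := pselect (A (sup A)).
    apply: le_trans (Ay _ As); rewrite setIidl// => x Ax /=.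
    by rewrite in_itv/= ub_le_sup.
  (* The supremum is finite and not attained: approach it from below. *)
  apply: (exh (fun n => sup A - n.+1%:R^-1)).
  - by move=> m n mn; rewrite lerB// lef_pV2 ?posrE// ler_nat.
  - move=> n; have n0 : 0 < n.+1%:R^-1 :> R by rewrite invr_gt0.
    by have [a Aa sa] := sup_adherent n0 hs; exists a => //; rewrite ltW.
  - move=> x Ax.
    have xs : x < sup A.
      rewrite lt_neqAle ub_le_sup// andbT; apply/eqP => xs; apply: As; by rewrite -xs.
    have [k] := ltr_add_invr xs; move=> xk; exists k; rewrite lerBrDr; exact: ltW.
apply: (exh (fun n => n%:R)).
- by move=> m n mn; rewrite ler_nat.
- move=> n; apply: contrapT => h; apply: nub; exists n%:R => x Ax.
  by rewrite leNgt; apply/negP => nx; apply: h; exists x => //; exact: ltW.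
- by move=> x _; exists (Num.truncn x).+1; rewrite ltW// truncnS_gt.
Qed.

Lemma measure_le_upper_parts (A : set R) (y : \bar R) :
  measurable A -> A !=set0 ->
  (forall a, A a -> (mu (A `&` `[a, +oo[) <= y)%E) -> (mu A <= y)%E.
Proof.
move=> mA A0 Ay.
have exh (c : R^nat) : nonincreasing_seq c -> (forall n, exists2 a, A a & a <= c n) ->
    (forall x, A x -> exists n, c n <= x) -> (mu A <= y)%E.
  move=> ndc cA Ac; apply: (@measure_le_exhaustion A (fun n => A `&` `[c n, +oo[)).
  - by move=> n; apply: measurableI.
  - move=> m n mn; apply/subsetPset => x [Ax]; rewrite /= !in_itv/= !andbT => xc; split => //=.
    by rewrite ?andbT; exact: le_trans (ndc _ _ mn) xc.
  - apply/seteqP; split; first by move=> x [n _ []].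
    move=> x Ax; have [n xn] := Ac _ Ax; by exists n => //; split=> //; rewrite /= in_itv/= andbT.
  - move=> n; have [a Aa ca] := cA n; apply: le_trans (Ay a Aa).
    apply: le_measure; rewrite ?inE//; [exact: measurableI|exact: measurableI|].
    move=> x [Ax]; rewrite /= !in_itv/= !andbT => xc; split=> //=.
    by rewrite ?andbT; exact: le_trans ca xc.
have [hub|nub] := pselect (has_lbound A).
  have hs : has_inf A by split.
  have [As|As] := pselect (A (inf A)).
    apply: le_trans (Ay _ As); rewrite setIidl// => x Ax /=.
    by rewrite in_itv/= andbT ge_inf.
  apply: (exh (fun n => inf A + n.+1%:R^-1)).
  - by move=> m n mn; rewrite lerD2l lef_pV2 ?posrE// ler_nat.
  - move=> n; have n0 : 0 < n.+1%:R^-1 :> R by rewrite invr_gt0.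
    by have [a Aa sa] := inf_adherent n0 hs; exists a => //; rewrite ltW.
  - move=> x Ax.
    have xs : inf A < x.
      rewrite lt_neqAle ge_inf// andbT; apply/eqP => xs; apply: As; by rewrite xs.
    have [k] := ltr_add_invr xs; move=> xk; exists k; exact: ltW.
apply: (exh (fun n => - n%:R)).
- by move=> m n mn; rewrite lerN2 ler_nat.
- move=> n; apply: contrapT => h; apply: nub; exists (- n%:R) => x Ax.
  by rewrite leNgt; apply/negP => nx; apply: h; exists x => //; exact: ltW.
- by move=> x _; exists (Num.truncn (- x)).+1; rewrite lerNl ltW// truncnS_gt.
Qed.

(** Any pair of points of A and B gives a lower bound on C by gluing; letting
    the point of A move up and that of B move down recovers all of A and B. *)
Lemma brunn_minkowski_midpoint (A B C : set R) :
  measurable A -> measurable B -> measurable C -> A !=set0 -> B !=set0 ->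
  (forall x y, A x -> B y -> C ((x + y) / 2)) ->
  (mu A + mu B <= 2%:E * mu C)%E.
Proof.
move=> mA mB mC A0 B0 ABC.
have glue := midpoint_glue mA mB mC _ _ ABC.
have [Coo|Coo] := eqVneq (mu C) +oo%E.
  by rewrite Coo gt0_muley// leey.
have Cfin : (2%:E * mu C)%E \is a fin_num.
  by rewrite fin_numM// ge0_fin_numE ?measure_ge0// ltey.
have BC b : B b -> (mu A + mu (B `&` `[b, +oo[) <= 2%:E * mu C)%E.
  move=> Bb; have [a0 Aa0] := A0.
  have Bfin : mu (B `&` `[b, +oo[) \is a fin_num.
    rewrite ge0_fin_numE ?measure_ge0//; apply: le_lt_trans (_ : 2%:E * mu C < +oo)%E.
      by apply: le_trans (glue _ _ Aa0 Bb); rewrite leeDr// measure_ge0.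
    by rewrite -ge0_fin_numE// mule_ge0// measure_ge0.
  rewrite -leeBrDr//; apply: measure_le_lower_parts => // a Aa.
  by rewrite leeBrDr// glue.
have [b0 Bb0] := B0.
have Afin : mu A \is a fin_num.
  rewrite ge0_fin_numE ?measure_ge0//; apply: le_lt_trans (_ : 2%:E * mu C < +oo)%E.
    by apply: le_trans (BC _ Bb0); rewrite leeDl// measure_ge0.
  by rewrite -ge0_fin_numE// mule_ge0// measure_ge0.
rewrite -leeBrDl//; apply: measure_le_upper_parts => // b Bb.
by rewrite leeBrDl// BC.
Qed.

(** Cut off at 0 so that layer cake is an integral over the whole line. *)
Definition level_measure (f : R -> R) (t : R) : \bar R :=
  if 0 <= t then mu [set x | t < f x] else 0%E.

Lemma level_set_measurable (f : R -> R) (t : R) :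
  measurable_fun setT f -> measurable [set x | t < f x].
Proof.
move=> mf; have : measurable_fun setT (fun x => t < f x) by exact: measurable_fun_ltr.
by move=> /(_ measurableT [set true]); rewrite setTI; exact.
Qed.

(** Tonelli on the region between 0 and the graph of f. *)
Lemma layer_cake (f : R -> R) : measurable_fun setT f -> (forall x, 0 <= f x) ->
  measurable_fun setT (level_measure f) /\
  (\int[mu]_x (f x)%:E = \int[mu]_t level_measure f t)%E.
Proof.
move=> mf f0.
pose GR := measurableTypeR R.
pose F (z : GR * GR) : \bar R := (\1_[set y : GR * GR | (0:R) <= y.2 /\ y.2 < f y.1] z)%:E.
have mF : measurable_fun setT F.
  apply/measurable_EFinP/measurable_indic => /=.
  pose g1 (y : GR * GR) := ((0:R) <= y.2)%R.
  pose g2 (y : GR * GR) := ((y.2:R) < f y.1)%R.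
  rewrite [X in measurable X](_ : _ =
      g1 @^-1` [set true] `&` g2 @^-1` [set true]); last first.
    by apply/seteqP; split => y.
  apply: measurableI.
  - have : measurable_fun setT g1 by exact: measurable_fun_ler.
    by move=> /(_ measurableT [set true]); rewrite setTI; exact.
  - have : measurable_fun setT g2.
      by apply: measurable_fun_ltr => //; exact: measurableT_comp.
    by move=> /(_ measurableT [set true]); rewrite setTI; exact.
have F0 z : (0 <= F z)%E by rewrite lee_fin.
have E2 t : (\int[mu]_x F (x, t) = level_measure f t)%E.
  rewrite /F /level_measure; case: ifPn => t0.
    rewrite (_ : (fun x => _) = (fun x => (\1_[set x | t < f x] x)%:E)).
      by rewrite integral_indic ?setIT//; exact: level_set_measurable.
    apply/funext => x; rewrite !indicE; congr ((_ _)%:R)%:E.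
    by apply/idP/idP; rewrite !inE/= => ?; [tauto|split].
  apply: integral0_eq => x _; rewrite indicE memNset//= => -[t1 _].
  by rewrite t1 in t0.
have E1 x : (\int[mu]_t F (x, t) = (f x)%:E)%E.
  rewrite /F (_ : (fun t => _) = (fun t => (\1_(`[0, f x[%classic) t)%:E)).
    rewrite integral_indic ?setIT//= lebesgue_measure_itv/= lte_fin.
    by case: ltP => [_|h]; [rewrite sube0|congr EFin; apply/le_anti; rewrite f0 h].
  apply/funext => t; rewrite !indicE; congr ((_ _)%:R)%:E.
  by apply/idP/idP; rewrite !inE/= in_itv/= => /andP.
split.
  rewrite (_ : level_measure f = fun t => (\int[mu]_x F (x, t))%E); last first.
    by apply/funext => t; rewrite E2.
  exact: (@measurable_fun_fubini_tonelli_G _ _ GR GR R mu F).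
under eq_integral do rewrite -E1.
rewrite (fubini_tonelli F)//.
by apply: eq_integral => t _; rewrite E2.
Qed.

(** When u and v both have supremum 1, their level sets at a height t in
    [0, 1) are nonempty and their midpoints lie in the level set of w at height
    t, so Brunn-Minkowski applies level by level. *)
Lemma prekopa_leindler_normalized (u v w : R -> R) :
  measurable_fun setT u -> measurable_fun setT v -> measurable_fun setT w ->
  (forall x, 0 <= u x <= 1) -> (forall x, 0 <= v x <= 1) -> (forall x, 0 <= w x) ->
  (forall t, t < 1 -> exists x, t < u x) -> (forall t, t < 1 -> exists x, t < v x) ->
  (forall x y, u x * v y <= w ((x + y) / 2) ^+ 2) ->
  (\int[mu]_x (u x)%:E + \int[mu]_x (v x)%:E <= 2%:E * \int[mu]_x (w x)%:E)%E.
Proof.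
move=> mu_ mv mw u01 v01 w0 supu supv uvw.
have u0 x : 0 <= u x by have /andP[] := u01 x.
have v0 x : 0 <= v x by have /andP[] := v01 x.
have [mlu ->] := layer_cake mu_ u0.
have [mlv ->] := layer_cake mv v0.
have [mlw ->] := layer_cake mw w0.
have l0 f t : (0 <= level_measure f t)%E by rewrite /level_measure; case: ifP.
rewrite -ge0_integralD// -ge0_integralZl//.
apply: ge0_le_integral => //.
- by move=> t _; rewrite adde_ge0.
- exact: emeasurable_funD.
- exact: measurable_funeM.
move=> t _; rewrite /level_measure; case: ifPn => t0; last by rewrite mule0 adde0.
have [t1|t1] := ltP t 1; last first.
  have E (f : R -> R) : (forall x, 0 <= f x <= 1) -> [set x | t < f x] = set0.
    move=> f01; apply/seteqP; split=> x //=; have /andP[_ f1] := f01 x.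
    by move=> /lt_le_trans/(_ f1); rewrite ltNge t1.
  by rewrite (E u)// (E v)// measure0 adde0 mule_ge0.
apply: brunn_minkowski_midpoint; try exact: level_set_measurable.
- exact: supu.
- exact: supv.
move=> x y /= tu tv.
rewrite -(@ltr_pXn2r _ 2)// ?nnegrE//.
apply: lt_le_trans (uvw x y); rewrite expr2.
by apply: ltr_pM.
Qed.

(** Divide u and v by their suprema a and b, and w by the square root of a b;
    the normalized inequality bounds an arithmetic mean, hence the geometric
    mean of the two integrals. *)
Lemma prekopa_leindler (u v w : R -> R) (c : R) :
  measurable_fun setT u -> measurable_fun setT v -> measurable_fun setT w ->
  (forall x, 0 <= u x <= c) -> (forall x, 0 <= v x <= c) -> (forall x, 0 <= w x) ->
  (forall x y, u x * v y <= w ((x + y) / 2) ^+ 2) ->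
  (\int[mu]_x (u x)%:E * \int[mu]_x (v x)%:E <=
   \int[mu]_x (w x)%:E * \int[mu]_x (w x)%:E)%E.
Proof.
move=> mu_ mv mw u01 v01 w0 uvw.
have hsup (f : R -> R) : (forall x, 0 <= f x <= c) -> has_sup (range f).
  move=> f01; split; first by exists (f 0), 0.
  by exists c => _ [x _ <-]; have /andP[] := f01 x.
have I0 (f : R -> R) : (forall x, 0 <= f x) -> (0 <= \int[mu]_x (f x)%:E)%E.
  by move=> f0; apply: integral_ge0 => x _; rewrite lee_fin.
have u0 x : 0 <= u x by have /andP[] := u01 x.
have v0 x : 0 <= v x by have /andP[] := v01 x.
have zero (f : R -> R) : (forall x, 0 <= f x <= c) ->
    sup (range f) <= 0 -> (\int[mu]_x (f x)%:E = 0)%E.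
  move=> f01 s0; apply: integral0_eq => x _; congr EFin; apply/le_anti.
  have /andP[-> _] := f01 x; rewrite andbT; apply: le_trans s0.
  by apply: ub_le_sup; [case: (hsup f f01)|exists x].
have [a0|a0] := leP (sup (range u)) 0; first by rewrite (zero u)// mul0e mule_ge0// I0.
have [b0|b0] := leP (sup (range v)) 0; first by rewrite (zero v)// mule0 mule_ge0// I0.
set a := sup (range u) in a0; set b := sup (range v) in b0.
pose s := Num.sqrt (a * b).
have s0 : 0 < s by rewrite sqrtr_gt0 mulr_gt0.
have s2 : s ^+ 2 = a * b by rewrite sqr_sqrtr// mulr_ge0// ltW.
have Z (f : R -> R) k : measurable_fun setT f -> (forall x, 0 <= f x) -> 0 < k ->
    (\int[mu]_x (k^-1 * f x)%:E = k^-1%:E * \int[mu]_x (f x)%:E)%E.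
  move=> mf f0 k0; under eq_integral do rewrite EFinM.
  rewrite ge0_integralZl_EFin ?invr_ge0 ?(ltW k0)//.
  by move=> x _; rewrite lee_fin.
  exact/measurable_EFinP.
have bnd (f : R -> R) : (forall x, 0 <= f x <= c) -> 0 < sup (range f) ->
    (forall x, 0 <= (sup (range f))^-1 * f x <= 1) /\
    (forall t, t < 1 -> exists x, t < (sup (range f))^-1 * f x).
  move=> f01 sf0; split=> [x|t t1].
    have /andP[fx0 _] := f01 x.
    rewrite mulr_ge0 ?invr_ge0 ?(ltW sf0)//= mulrC ler_pdivrMr// mul1r.
    by apply: ub_le_sup; [case: (hsup f f01)|exists x].
  have e0 : 0 < sup (range f) * (1 - t) by rewrite mulr_gt0// subr_gt0.
  have [_ [x _ <-] fx] := sup_adherent e0 (hsup f f01).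
  exists x; rewrite mulrC ltr_pdivlMr//; move: fx; rewrite -/a; nra.
have [ua supu] := bnd u u01 a0; have [vb supv] := bnd v v01 b0.
have mZ (f : R -> R) k : measurable_fun setT f -> measurable_fun setT (fun x => k * f x).
  by move=> mf; exact: measurable_funM.
have := @prekopa_leindler_normalized (fun x => a^-1 * u x) (fun x => b^-1 * v x)
  (fun x => s^-1 * w x) (mZ _ _ mu_) (mZ _ _ mv) (mZ _ _ mw) ua vb _ supu supv _.
rewrite !Z//; move=> H.
have {H} : (a^-1%:E * \int[mu]_x (u x)%:E + b^-1%:E * \int[mu]_x (v x)%:E <=
    2%:E * (s^-1%:E * \int[mu]_x (w x)%:E))%E.
  apply: H => [x|x y]; first by rewrite mulr_ge0 ?invr_ge0 ?(ltW s0).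
  rewrite exprMn exprVn s2 mulrACA -invfM ler_pM2l ?uvw//.
  by rewrite invr_gt0 mulr_gt0.
move: (I0 _ u0) (I0 _ v0) (I0 _ w0).
case: (\int[mu]_x (w x)%:E)%E => [W||]//; last first.
  by move=> *; rewrite mulyy leey.
have ge0y (k : R) : 0 < k -> (k^-1%:E * +oo = +oo)%E.
  by move=> k0; rewrite gt0_muley// lte_fin invr_gt0.
case: (\int[mu]_x (u x)%:E)%E => [U||]//; case: (\int[mu]_x (v x)%:E)%E => [V||]//;
  rewrite ?ge0y// ?lee_fin => U0 V0 W0.
move=> H.
have H2 : (a^-1 * U + b^-1 * V) ^+ 2 <= (2 * (s^-1 * W)) ^+ 2.
  have H0 : 0 <= a^-1 * U + b^-1 * V by rewrite addr_ge0// mulr_ge0// invr_ge0 ltW.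
  by rewrite ler_pXn2r ?nnegrE// (le_trans H0).
(* The arithmetic-geometric mean inequality for U / a and V / b. *)
have H4 : 4 * ((a * b)^-1 * (U * V)) <= 4 * ((a * b)^-1 * (W * W)).
  apply: (@le_trans _ _ ((a^-1 * U + b^-1 * V) ^+ 2)).
    rewrite invfM; have := sqr_ge0 (a^-1 * U - b^-1 * V); nra.
  apply: le_trans H2 _; rewrite exprMn exprMn exprVn s2 expr2 (expr2 W); nra.
move: H4; rewrite ler_pM2l// ler_pM2l//.
by rewrite invr_gt0 mulr_gt0.
Qed.

End one_dimensional.

(** The Gaussian density phi satisfies
    phi x * phi y = phi ((x + y) / 2) ^ 2 * exp (- (x - y) ^ 2 / 4),
    which is where the factor in the hypothesis comes from. *)
Lemma prekopa_leindler_normal (R : realType) (u v w : R -> R) (c : R) :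
  measurable_fun setT u -> measurable_fun setT v -> measurable_fun setT w ->
  (forall x, 0 <= u x <= c) -> (forall x, 0 <= v x <= c) -> (forall x, 0 <= w x) ->
  (forall x y, u x * v y <= w ((x + y) / 2) ^+ 2 * expR ((x - y) ^+ 2 / 4)) ->
  (\int[normal_prob 0 1]_x (u x)%:E * \int[normal_prob 0 1]_x (v x)%:E <=
   \int[normal_prob 0 1]_x (w x)%:E * \int[normal_prob 0 1]_x (w x)%:E)%E.
Proof.
move=> mu_ mv mw u01 v01 w0 uvw.
pose phi : R -> R := normal_pdf 0 1.
have mphi : measurable_fun setT phi by exact: measurable_normal_pdf.
have phi0 x : 0 <= phi x by exact: normal_pdf_ge0.
have phiE x : phi x = normal_peak 1 * expR (- x ^+ 2 / 2).
  by rewrite /phi normal_pdfE ?oner_neq0// /normal_fun subr0 expr1n.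
have phiub x : phi x <= normal_peak 1 by exact/normal_pdf_ub/oner_neq0.
have dens (f : R -> R) : measurable_fun setT f -> (forall x, 0 <= f x) ->
    (\int[normal_prob 0 1]_x (f x)%:E = \int[lebesgue_measure]_x (f x * phi x)%:E)%E.
  move=> mf f0; under [RHS]eq_integral do rewrite EFinM.
  apply: (@ge0_integral_density _ _ R lebesgue_measure (normal_prob 0 1) phi) => //.
  exact/measurable_EFinP.
have u0 x : 0 <= u x by have /andP[] := u01 x.
have v0 x : 0 <= v x by have /andP[] := v01 x.
have bnd (f : R -> R) : (forall x, 0 <= f x <= c) ->
    forall x, 0 <= f x * phi x <= c * normal_peak 1.
  by move=> f01 x; have /andP[f0 fc] := f01 x; rewrite mulr_ge0//= ler_pM.
rewrite !dens//; apply: (@prekopa_leindler _ _ _ _ (c * normal_peak 1)).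
- exact: measurable_funM.
- exact: measurable_funM.
- exact: measurable_funM.
- exact: bnd.
- exact: bnd.
- by move=> x; rewrite mulr_ge0.
move=> x y; rewrite mulrACA exprMn.
have -> : phi x * phi y = phi ((x + y) / 2) ^+ 2 * expR (- ((x - y) ^+ 2 / 4)).
  rewrite !phiE mulrACA -[normal_peak 1 * normal_peak 1]expr2 exprMn -[in RHS]mulrA; congr (_ * _).
  by rewrite -expRM_natl -!expRD; congr expR; field.
have := ler_wpM2r (mulr_ge0 (sqr_ge0 (phi ((x + y) / 2))) (expR_ge0 (- ((x - y) ^+ 2 / 4)))) (uvw x y).
move=> /le_trans; apply; rewrite le_eqVlt; apply/orP; left; apply/eqP.
by rewrite mulrACA -expRD subrr expR0 mulr1.
Qed.

(** * Resampling a coordinate of an independent sequence *)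

Section gaussian_sequences.
Context {R : realType}.
Implicit Types (s : nat -> R) (A : nat -> set R).

Definition box A : set (nat -> R) := [set s | forall k, A k (s k)].

Definition cylinders : set (set (nat -> R)) :=
  [set C | exists A, [/\ forall k, measurable (A k),
     exists N, forall k, (N <= k)%N -> A k = setT & C = box A]].

(** Sequences with the product sigma-algebra: independence is a statement
    about boxes, which form a generating pi-system. *)
Definition seq_space := g_sigma_algebraType cylinders.

Definition update s k (x : R) : nat -> R := fun j => if j == k then x else s j.

Lemma measurable_coord k : measurable_fun setT (fun s : seq_space => s k).
Proof.
move=> _ B mB; rewrite setTI; apply: sub_sigma_algebra.
exists (fun j => if j == k then B else setT); split.
- by move=> j; case: ifP.
- by exists k.+1 => j kj; rewrite gtn_eqF.
apply/seteqP; split=> s /=; rewrite /box/=.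
  by move=> Bs j; case: eqP => // ->.
by move=> /(_ k); rewrite eqxx.
Qed.

Lemma measurable_to_seq_space d (T : measurableType d) (f : T -> seq_space) :
  (forall k, measurable_fun setT (fun x => f x k)) -> measurable_fun setT f.
Proof.
move=> mf; apply: (@measurability _ _ T seq_space setT f cylinders erefl).
move=> _ [_ [A [mA _ ->]] <-]; rewrite setTI.
rewrite (_ : _ @^-1` _ = \bigcap_k ((fun x => f x k) @^-1` A k)).
  apply: bigcapT_measurable => k; rewrite -[X in measurable X]setTI.
  exact: mf.
by apply/seteqP; split=> x /= h k; [move=> _|]; apply: h.
Qed.

Lemma measurable_update d (T : measurableType d) (f : T -> seq_space) k (g : T -> R) :
  measurable_fun setT f -> measurable_fun setT g ->
  measurable_fun setT (fun x => update (f x) k (g x) : seq_space).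
Proof.
move=> mf mg; apply: measurable_to_seq_space => j; rewrite /update.
case: eqP => // _.
by apply: (measurableT_comp (f := fun s : seq_space => s j)); first exact: measurable_coord.
Qed.

Section law.
Context d (Omega : measurableType d) (P : probability Omega R)
  (t : nat -> {RV P >-> R}).
Hypothesis tind : mutually_independent P t.
Hypothesis tlaw : forall k (A : set R), measurable A ->
  distribution P (t k) A = normal_prob 0 1 A.

Let ts (w : Omega) : seq_space := fun k => t k w.

Lemma measurable_sample : measurable_fun setT ts.
Proof. by apply: measurable_to_seq_space => k; exact: measurable_funP. Qed.

Lemma probability_box A N : (forall k, measurable (A k)) ->
  (forall k, (N <= k)%N -> A k = setT) ->
  P (ts @^-1` box A) = (\prod_(k <- iota 0 N) P (t k @^-1` A k))%E.
Proof.
move=> mA AN; rewrite -tind ?iota_uniq//; congr (P _).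
apply/seteqP; split=> w /= h k; first by move=> _; exact: h.
have [Nk|kN] := leqP N k; first by rewrite AN.
by apply: h => /=; rewrite mem_iota.
Qed.

(** On a box, replacing the k-th coordinate by a fresh Gaussian only splits
    one factor off the product given by independence. *)
Lemma resample_box k C : cylinders C ->
  P (ts @^-1` C) = (P \x normal_prob 0 1)%E
    ((fun z : Omega * R => update (ts z.1) k z.2) @^-1` C).
Proof.
move=> [A [mA [N0 AN0] ->]].
(* The box is described with enough coordinates to include the k-th. *)
pose N := maxn N0 k.+1.
have kN : (k < N)%N by rewrite /N leq_max ltnSn orbT.
have AN j : (N <= j)%N -> A j = setT.
  by move=> Nj; apply: AN0; apply: leq_trans Nj; exact: leq_maxl.
pose A' j := if j == k then setT else A j.
rewrite (_ : _ @^-1` box A = (ts @^-1` box A') `*` A k); last first.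
  apply/seteqP; split=> -[w x] /=; rewrite /box /update/=.
    move=> h; split; last by have := h k; rewrite eqxx.
    by move=> j; rewrite /A'; have := h j; case: eqP.
  by move=> [h Akx] j; have := h j; rewrite /A'; case: eqP => // ->.
have mA' j : measurable (A' j) by rewrite /A'; case: ifP.
have A'N j : (N <= j)%N -> A' j = setT by move=> Nj; rewrite /A' AN//; case: ifP.
rewrite product_measure1E//; first last.
  exact: mA.
  rewrite (_ : _ @^-1` _ = \bigcap_j (ts @^-1` [set s | A' j (s j)])).
    apply: bigcapT_measurable => j.
    by rewrite -[X in measurable X]setTI; exact: measurable_funP.
  by apply/seteqP; split=> w h j => [_|]; apply: h.
transitivity ((\prod_(j <- iota 0 N) P (t j @^-1` A' j)) * normal_prob 0 1 (A k))%E;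
  last by congr (_ * _)%E; exact/esym/probability_box.
rewrite (probability_box mA AN) (bigD1_seq k) ?iota_uniq ?mem_iota//=.
rewrite [in RHS](bigD1_seq k) ?iota_uniq ?mem_iota//=.
rewrite {1}/A' eqxx preimage_setT probability_setT mul1e muleC.
rewrite -(tlaw k)//; congr (_ * _)%E.
by apply: eq_bigr => j /negbTE jk; rewrite /A' jk.
Qed.

(** This plays the role of Fubini for the joint law of the sequence, without
    identifying that law with a product measure. *)
Lemma resampling k (u : seq_space -> \bar R) :
  measurable_fun setT u -> (forall s, (0 <= u s)%E) ->
  (\int[P]_w u (ts w) =
   \int[P]_w \int[normal_prob 0 1]_x u (update (ts w) k x))%E.
Proof.
move=> mu_ u0.
have mt := measurable_sample.
have mup : measurable_fun setT (fun z : Omega * R => update (ts z.1) k z.2 : seq_space).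
  apply: measurable_update; last exact: measurable_snd.
  exact: (measurableT_comp mt measurable_fst).
rewrite -(ge0_integral_image_measure P mt)//.
transitivity (\int[image_measure (P \x normal_prob 0 1)%E mup]_s u s)%E.
  apply: eq_measure_integral => A mA _.
  apply: (@measure_unique _ R seq_space cylinders (fun _ => setT)) => //.
  - move=> _ _ [A1 [mA1 [N1 AN1] ->]] [A2 [mA2 [N2 AN2] ->]].
    exists (fun j => A1 j `&` A2 j); split.
    + by move=> j; exact: measurableI.
    + exists (maxn N1 N2) => j; rewrite geq_max => /andP[h1 h2].
      by rewrite AN1// AN2// setTI.
    + by apply/seteqP; split=> s /=; [move=> [h1 h2] j|move=> h; split=> j; have [] := h j].
  - move=> _; exists (fun _ => setT); split => //; first by exists 0%N.
    by apply/seteqP.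
  - by rewrite bigcup_const.
  - by move=> C CC; exact: resample_box.
  - move=> n; rewrite image_measureE preimage_setT; apply: le_lt_trans (ltry 1).
    exact: probability_le1.
rewrite ge0_integral_image_measure//.

apply: (@fubini_tonelli1 _ _ Omega (measurableTypeR R) R P (normal_prob 0 1)
  (fun z => u (update (ts z.1) k z.2)) (measurableT_comp mu_ mup)) => z; exact: u0.
Qed.

End law.
End gaussian_sequences.

(** * The Prekopa-Leindler inequality for Gaussian sequences *)

Section gaussian_prekopa_leindler.
Context {R : realType}.
Context d (Omega : measurableType d) (P : probability Omega R)
  (t : nat -> {RV P >-> R}).
Hypothesis tind : mutually_independent P t.
Hypothesis tlaw : forall k (A : set R), measurable A ->
  distribution P (t k) A = normal_prob 0 1 A.

Let ts (w : Omega) : @seq_space R := fun k => t k w.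

Definition depends_on_first (T : Type) (N : nat) (u : (nat -> R) -> T) : Prop :=
  forall s s', (forall k, (k < N)%N -> s k = s' k) -> u s = u s'.

Definition mid_seq (s s' : nat -> R) : nat -> R := fun k => (s k + s' k) / 2.

(** Conditional expectation given all coordinates but the N-th. *)
Definition average_coord (N : nat) (u : @seq_space R -> R) (s : @seq_space R) : R :=
  fine (\int[normal_prob 0 1]_x (u (update s N x))%:E)%E.

Lemma average_coordP (N : nat) (u : @seq_space R -> R) (c : R) :
  measurable_fun setT u -> (forall s, 0 <= u s <= c) ->
  [/\ forall s, (\int[normal_prob 0 1]_x (u (update s N x))%:E = (average_coord N u s)%:E)%E,
      measurable_fun setT (average_coord N u),
      forall s, 0 <= average_coord N u s <= c &
      (\int[P]_w (u (ts w))%:E = \int[P]_w (average_coord N u (ts w))%:E)%E].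
Proof.
move=> mu_ u01.
have u0 s : (0 <= (u s)%:E)%E by rewrite lee_fin; have /andP[] := u01 s.
have mup : measurable_fun setT (fun z : @seq_space R * R => (u (update z.1 N z.2))%:E).
  apply/measurable_EFinP; apply: (measurableT_comp mu_).
  by apply: measurable_update; [exact: measurable_fst|exact: measurable_snd].
have mus s : measurable_fun setT (fun x : R => (u (update s N x))%:E).
  apply/measurable_EFinP; apply: (measurableT_comp mu_).
  by apply: measurable_update => //; exact: measurable_cst.
have I0 s : (0 <= \int[normal_prob 0 1]_x (u (update s N x))%:E)%E.
  by apply: integral_ge0 => x _; exact: u0.
have Ic s : (\int[normal_prob 0 1]_x (u (update s N x))%:E <= c%:E)%E.
  have -> : c%:E = (\int[normal_prob (0:R) 1]_x (cst c%:E x))%E.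
    rewrite integral_cst// [X in (_ * X)%E](_ : _ = 1%E) ?mule1//.
    exact: probability_setT.
  apply: ge0_le_integral => //; first exact: mus.
  by move=> x _; rewrite lee_fin; case/andP: (u01 (update s N x)).
have E s : (\int[normal_prob 0 1]_x (u (update s N x))%:E = (average_coord N u s)%:E)%E.
  by rewrite /average_coord fineK// ge0_fin_numE// (le_lt_trans (Ic s))// ltry.
split=> //.
- apply/measurable_EFinP.
  rewrite (_ : EFin \o _ = fun s => (\int[normal_prob 0 1]_x (u (update s N x))%:E)%E); last first.
    by apply/funext => s /=; rewrite E.
  exact: (@measurable_fun_fubini_tonelli_F _ _ (@seq_space R) (measurableTypeR R) R
    (normal_prob 0 1) _ mup).
- by move=> s; rewrite -!lee_fin -E I0 Ic.
rewrite (resampling tind tlaw N (u := fun s => (u s)%:E))//; last exact/measurable_EFinP.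
by apply: eq_integral => w _; rewrite E.
Qed.

Lemma average_coord_depends (N : nat) (u : @seq_space R -> R) :
  depends_on_first N.+1 u -> depends_on_first N (average_coord N u).
Proof.
move=> du s s' ss'; rewrite /average_coord; congr fine.
apply: eq_integral => x _; congr EFin; apply: du => k kN.
rewrite /update; case: eqP => // /eqP kN'; apply: ss'.
by rewrite ltn_neqAle kN' -ltnS.
Qed.

(** Induction on the number of coordinates. Averaging the last one preserves
    the hypothesis, by the one-dimensional inequality with the other coordinates
    frozen, and preserves the three integrals, by resampling. *)
Lemma prekopa_leindler_gaussian_sequence (N : nat) (u v w : @seq_space R -> R) (c : R) :
  measurable_fun setT u -> measurable_fun setT v -> measurable_fun setT w ->
  (forall s, 0 <= u s <= c) -> (forall s, 0 <= v s <= c) -> (forall s, 0 <= w s <= c) ->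
  depends_on_first N u -> depends_on_first N v -> depends_on_first N w ->
  (forall s s', u s * v s' <= w (mid_seq s s') ^+ 2 *
     expR ((\sum_(k < N) (s k - s' k) ^+ 2) / 4)) ->
  (\int[P]_x (u (ts x))%:E * \int[P]_x (v (ts x))%:E <=
   \int[P]_x (w (ts x))%:E * \int[P]_x (w (ts x))%:E)%E.
Proof.
elim: N u v w => [|N IH] u v w mu_ mv mw u01 v01 w01 du dv dw uvw.
  have cstE (f : @seq_space R -> R) : depends_on_first 0 f ->
      (\int[P]_x (f (ts x))%:E = (f (fun=> 0))%:E)%E.
    move=> df; transitivity (\int[P]_x (cst (f (fun=> 0))%:E x))%E.
      by apply: eq_integral => x _; congr EFin; exact: df.
    rewrite integral_cst// [X in (_ * X)%E](_ : _ = 1%E) ?mule1//.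
    exact: probability_setT.
  rewrite !cstE// -!EFinM lee_fin.
  have := uvw (fun=> 0) (fun=> 0); rewrite big_ord0 mul0r expR0 mulr1 expr2.
  by rewrite (dw (mid_seq _ _) (fun=> 0)).
have [Eu mau u'01 ->] := average_coordP N mu_ u01.
have [Ev mav v'01 ->] := average_coordP N mv v01.
have [Ew maw w'01 ->] := average_coordP N mw w01.
apply: IH => //; try exact: average_coord_depends.
move=> s s'.
have ms (f : @seq_space R -> R) r : measurable_fun setT f ->
    measurable_fun setT (fun x : R => f (update r N x)).
  move=> mf; apply: (measurableT_comp mf).
  by apply: measurable_update => //; exact: measurable_cst.
(* The factor of the frozen coordinates; it is squared with w, hence the 8. *)
pose e : R := expR ((\sum_(k < N) (s k - s' k) ^+ 2) / 8).
have e0 : 0 <= e by exact: expR_ge0.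
have e2 : e ^+ 2 = expR ((\sum_(k < N) (s k - s' k) ^+ 2) / 4).
  by rewrite /e -expRM_natl; congr expR; field.
have := @prekopa_leindler_normal R (fun x => u (update s N x)) (fun x => v (update s' N x))
  (fun x => w (update (mid_seq s s') N x) * e) c (ms _ _ mu_) (ms _ _ mv) _
  (fun x => u01 _) (fun x => v01 _) _ _.
rewrite Eu Ev => H.
have -> : average_coord N u s * average_coord N v s' <=
    average_coord N w (mid_seq s s') ^+ 2 * expR ((\sum_(k < N) (s k - s' k) ^+ 2) / 4) =
  ((average_coord N u s)%:E * (average_coord N v s')%:E <=
    (\int[normal_prob 0 1]_x (w (update (mid_seq s s') N x) * e)%:E) *
    (\int[normal_prob 0 1]_x (w (update (mid_seq s s') N x) * e)%:E))%E.
  have -> : (\int[normal_prob 0 1]_x (w (update (mid_seq s s') N x) * e)%:E =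
      (average_coord N w (mid_seq s s') * e)%:E)%E.
    under eq_integral do rewrite EFinM.
    rewrite ge0_integralZr//; first by rewrite Ew -EFinM.
    - by apply/measurable_EFinP; exact: ms.
    - by move=> x _; rewrite lee_fin; case/andP: (w01 (update (mid_seq s s') N x)).
  by rewrite -!EFinM lee_fin -e2; congr (_ <= _); rewrite expr2 (expr2 e) mulrACA.
apply: H.
- by apply: measurable_funM => //; exact: ms.
- by move=> x; rewrite mulr_ge0//; case/andP: (w01 (update (mid_seq s s') N x)).
move=> x y; apply: le_trans (uvw (update s N x) (update s' N y)) _.
have -> : \sum_(k < N.+1) (update s N x k - update s' N y k) ^+ 2 =
    \sum_(k < N) (s k - s' k) ^+ 2 + (x - y) ^+ 2.
  rewrite big_ord_recr/= /update eqxx; congr (_ + _).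
  by apply: eq_bigr => k _; rewrite !ltn_eqF.
rewrite (_ : mid_seq _ _ = update (mid_seq s s') N ((x + y) / 2)); last first.
  by apply/funext => k; rewrite /mid_seq /update; case: eqP.
by rewrite exprMn e2 -[X in _ <= X]mulrA -expRD -mulrDl.
Qed.

End gaussian_prekopa_leindler.

(** * From finitely many coordinates to the prior *)

Lemma bounded_convergence d (T : measurableType d) (R : realType)
  (P : probability T R) (f_ : nat -> T -> R) (f : T -> R) (c : R) :
  (forall n, measurable_fun setT (f_ n)) -> measurable_fun setT f ->
  (forall n x, 0 <= f_ n x <= c) ->
  {ae P, forall x, f_ n x @[n --> \oo] --> f x} ->
  (\int[P]_x (f_ n x)%:E @[n --> \oo] --> \int[P]_x (f x)%:E)%E.
Proof.
move=> mf_ mf f01 cf.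
have [|||||_ _] := @dominated_convergence _ T R P setT measurableT
  (fun n x => (f_ n x)%:E) (fun x => (f x)%:E) (cst c%:E).
- by move=> n; exact/measurable_EFinP.
- exact/measurable_EFinP.
- by apply: filterS cf => x cx _; apply: cvg_EFin => //; exact: nearW.
- exact: finite_measure_integrable_cst.
- apply: aeW => x n _; rewrite lee_fin ger0_norm; last by have /andP[] := f01 n x.
  by have /andP[] := f01 n x.
exact.
Qed.

Lemma probability_integral_fin d (T : measurableType d) (R : realType)
  (P : probability T R) (f : T -> R) (c : R) :
  measurable_fun setT f -> (forall x, 0 <= f x <= c) ->
  (\int[P]_x (f x)%:E)%E \is a fin_num.
Proof.
move=> mf f01.
have f0 x : (0 <= (f x)%:E)%E by rewrite lee_fin; have /andP[] := f01 x.
rewrite ge0_fin_numE ?integral_ge0//.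
have Pc : (\int[P]_x (cst c%:E x) = c%:E)%E.
  by rewrite integral_cst// [X in (_ * X)%E]probability_setT mule1.
apply: (@le_lt_trans _ _ c%:E); last exact: ltry.
rewrite -Pc; apply: ge0_le_integral => //; first exact/measurable_EFinP.
by move=> x _; rewrite lee_fin; have /andP[] := f01 x.
Qed.

Lemma lee_lim_product (R : realType) (u v w : nat -> \bar R) (a b l : \bar R) :
  a \is a fin_num -> b \is a fin_num -> l \is a fin_num ->
  u n @[n --> \oo] --> a -> v n @[n --> \oo] --> b -> w n @[n --> \oo] --> l ->
  (\forall n \near \oo, (u n * v n <= w n * w n)%E) -> (a * b <= l * l)%E.
Proof.
move=> fa fb fl ua vb wl uvw.
have cuv : (u \* v)%E n @[n --> \oo] --> (a * b)%E by apply: cvgeM => //; exact: mule_def_fin.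
have cww : (w \* w)%E n @[n --> \oo] --> (l * l)%E by apply: cvgeM => //; exact: mule_def_fin.
rewrite -(cvg_lim _ cuv)// -(cvg_lim _ cww)//; apply: lee_lim => //.
- by apply/cvg_ex; exists (a * b)%E.
- by apply/cvg_ex; exists (l * l)%E.
Qed.

Section cylindrical_measurability.
Context {R : realType} (S : spectrum R) (p : R).

Lemma continuous_hscale_measurable (u : hscale S p -> R) :
  continuous u -> measurable_fun setT u.
Proof.
move=> /continuousP cu; apply: (measurability _ (RGenOpens.measurableE R)).
move=> _ [_ [a [b ->] <-]]; rewrite setTI; apply: sub_sigma_algebra.
exact/cu/interval_open.
Qed.

(** The preimage of a set is a countable union over the values of h. *)
Lemma measurable_fun_countable_glue d (T : measurableType d) (h : T -> int)
  (F : int -> T -> R) :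
  (forall c, measurable (h @^-1` [set c])) -> (forall c, measurable_fun setT (F c)) ->
  measurable_fun setT (fun x => F (h x) x).
Proof.
move=> mh mF _ B mB; rewrite setTI.
rewrite (_ : _ @^-1` B = \bigcup_c (h @^-1` [set c] `&` F c @^-1` B)).
  apply: countable_bigcupT_measurable; first exact: countableP.
  by move=> c; apply: measurableI => //; rewrite -[X in measurable X]setTI; exact: mF.
by apply/seteqP; split=> [x Bx|x [c _ [<-]]//]; exists (h x).
Qed.

(** The N-th partial sum of the random series whose law is the prior. *)
Definition embed (a : nat -> R) (N : nat) (s : nat -> R) : hscale S p :=
  \sum_(0 <= k < N) (a k * s k) *: hbasis S p k.

Lemma embed_coef a N s j : embed a N s j = if (j < N)%N then a j * s j else 0.
Proof.
rewrite /embed.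
have coefD (g h : hscale S p) : (g + h) j = g j + h j by [].
have coefZ c (g : hscale S p) : (c *: g) j = c * g j by [].
elim: N => [|N IH]; first by rewrite big_geq.
rewrite big_nat_recr// coefD IH coefZ /= ltnS.
by case: (ltngtP j N) => [jN|jN|->]; rewrite ?mulr0 ?addr0 ?add0r ?mulr1.
Qed.

Lemma embed_cvg a N (s_ : nat -> nat -> R) (s : nat -> R) :
  (forall k, s_ m k @[m --> \oo] --> s k) ->
  embed a N (s_ m) @[m --> \oo] --> embed a N s.
Proof.
move=> cs; rewrite /embed; elim: N => [|N IH].
  by rewrite big_geq//; under eq_fun do rewrite big_geq//; exact: cvg_cst.
rewrite big_nat_recr//=; under eq_fun do rewrite big_nat_recr//=.
apply: cvgD => //; apply: cvgZr_tmp.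
by apply: cvgM; [exact: cvg_cst|exact: cs].
Qed.

(** Rounding to a grid of mesh 1 / (m + 1). *)
Definition grid (m : nat) (x : R) : R := (Num.floor (m.+1%:R * x))%:~R / m.+1%:R.

Lemma grid_cvg x : grid m x @[m --> \oo] --> x.
Proof.
apply/cvgrPdist_le => e e0; near=> m.
have m0 : 0 < m.+1%:R :> R by [].
have -> : x - grid m x = (m.+1%:R * x - (Num.floor (m.+1%:R * x))%:~R) / m.+1%:R.
  by rewrite /grid mulrBl mulrAC divff ?gt_eqF// mul1r.
rewrite normrM [`|_^-1|]ger0_norm ?invr_ge0//.
apply: (@le_trans _ _ (m.+1%:R^-1)).
  rewrite ler_piMl ?invr_ge0// ger0_norm ?subr_ge0 ?floor_le//.
  by rewrite lerBlDl ltW// -[1]/(1%:~R) -intrD floorD1_gt.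
rewrite ltW//; near: m; exact: (near_infty_natSinv_lt (PosNum e0)).
Unshelve. all: by end_near. Qed.

Lemma floor_level_measurable m k (c : int) :
  measurable ((fun s : @seq_space R => Num.floor (m.+1%:R * s k)) @^-1` [set c]).
Proof.
have mk : measurable_fun setT (fun s : @seq_space R => m.+1%:R * s k).
  by apply: measurable_funM => //; exact: measurable_coord.
rewrite (_ : _ @^-1` _ = (fun s : @seq_space R => m.+1%:R * s k) @^-1` `[c%:~R, (c + 1)%:~R[%classic).
  by rewrite -[X in measurable X]setTI; exact: mk.
apply/seteqP; split=> s /=; rewrite in_itv/=.
  by move=> <-; rewrite floor_le floorD1_gt.
by move=> h; apply: floor_def.
Qed.

(** On each of the countably many cells of the grid the function is constant,
    whatever u is; the cells are split off one coordinate at a time. *)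
Lemma grid_embed_measurable a N m (u : hscale S p -> R) (th : hscale S p) :
  measurable_fun setT (fun s : @seq_space R => u (th + embed a N (fun k => grid m (s k)))).
Proof.
elim: N th => [|N IH] th.
  rewrite /embed (_ : (fun s => _) = cst (u th)); first exact: measurable_cst.
  by apply/funext => s; rewrite big_geq// addr0.
have := @measurable_fun_countable_glue _ _ (fun s : @seq_space R => Num.floor (m.+1%:R * s N))
  (fun c s => u ((th + (a N * (c%:~R / m.+1%:R)) *: hbasis S p N) +
     embed a N (fun k => grid m (s k)))) (floor_level_measurable m N) (fun c => IH _).
apply: eq_measurable_fun => s _.
by rewrite /embed big_nat_recr//= addrCA addrA addrAC addrC addrA [in LHS]addrAC -/(grid m _).
Qed.

(** A limit of the functions rounded to finer and finer grids. This
    avoids comparing the Borel sigma-algebra of H_p with that of the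
    coordinates. *)
Lemma embed_measurable a N (u : hscale S p -> R) : continuous u ->
  measurable_fun setT (fun s : @seq_space R => u (embed a N s)).
Proof.
move=> cu.
apply: (@measurable_fun_cvg _ (@seq_space R) R setT (fun m s => u (embed a N (fun k => grid m (s k))))).
  move=> m; have := grid_embed_measurable a N m u 0.
  by apply: eq_measurable_fun => s _; rewrite add0r.
move=> s _; apply: cvg_comp; last exact: cu.
by apply: embed_cvg => k; exact: grid_cvg.
Qed.

End cylindrical_measurability.

(** The hypothesis only concerns finitely supported x and y: the inequality
    is proved for the partial sums of the random series, where the quadratic
    form in the coordinates of H_p equals the one in the Gaussian variables,
    and passes to the limit by bounded convergence. *)
Lemma prekopa_leindler_gaussian_prior (R : realType) (S : spectrum R) (p alpha : R)
  (Pi : probability (hscale S p) R) (u v w : hscale S p -> R) (c : R) (N0 : nat) :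
  gaussian_prior alpha Pi ->
  continuous u -> continuous v -> continuous w ->
  (forall x, 0 <= u x <= c) -> (forall x, 0 <= v x <= c) -> (forall x, 0 <= w x <= c) ->
  (forall N (x y : hscale S p), (N0 <= N)%N ->
     (forall k, (N <= k)%N -> x k = 0) -> (forall k, (N <= k)%N -> y k = 0) ->
     u x * v y <= w (2^-1 *: (x + y)) ^+ 2 *
       expR ((\sum_(k < N) S k `^ (2 * alpha + (sdim S)%:R) * (x k - y k) ^+ 2) / 4)) ->
  (\int[Pi]_x (u x)%:E * \int[Pi]_x (v x)%:E <=
   \int[Pi]_x (w x)%:E * \int[Pi]_x (w x)%:E)%E.
Proof.
case=> d0 [W [P [t [vth [tind tlaw tcvg PiE]]]]] cu cv cw u01 v01 w01 uvw.
(* The standard deviations of the coordinates under the prior. *)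
pose a k := S k `^ (- alpha - (sdim S)%:R / 2).
have a2 k : S k `^ (2 * alpha + (sdim S)%:R) * a k ^+ 2 = 1.
  rewrite /a expr2 -!powRD ?(gt_eqF (eigval_gt0 S k)) ?implybT//.
  by rewrite [X in _ `^ X](_ : _ = 0) ?powRr0//; field.
pose ts (x : W) : @seq_space R := fun k => t k x.
have PiI (f : hscale S p -> R) : continuous f -> (forall x, 0 <= f x) ->
    (\int[Pi]_x (f x)%:E = \int[P]_x (f (vth x))%:E)%E.
  move=> cf f0.
  rewrite (eq_measure_integral (distribution P vth)); last by move=> A mA _; exact: PiE.
  rewrite ge0_integral_distribution//.
  by apply/measurable_EFinP; exact: continuous_hscale_measurable.
have mts : measurable_fun setT ts by apply: measurable_to_seq_space => k; exact: measurable_funP.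
have lim (f : hscale S p -> R) : continuous f -> (forall x, 0 <= f x <= c) ->
    (\int[P]_x (f (embed S p a N (ts x)))%:E @[N --> \oo] --> \int[P]_x (f (vth x))%:E)%E.
  move=> cf f01; apply: (bounded_convergence (c := c)).
  - by move=> N; exact: (measurableT_comp (embed_measurable a N cf) mts).
  - apply: (measurableT_comp (continuous_hscale_measurable cf)); exact: measurable_funP.
  - by move=> N x; exact: f01.
  apply: filterS tcvg => x cx; apply: cvg_comp; last exact: cf.
  exact: cx.
have fin (f : hscale S p -> R) : continuous f -> (forall x, 0 <= f x <= c) ->
    (\int[P]_x (f (vth x))%:E)%E \is a fin_num.
  move=> cf f01; apply: (@probability_integral_fin _ _ _ P (fun x => f (vth x)) c) => //.
  apply: (measurableT_comp (continuous_hscale_measurable cf)); exact: measurable_funP.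
have ge0 (f : hscale S p -> R) : (forall x, 0 <= f x <= c) -> forall x, 0 <= f x.
  by move=> f01 x; have /andP[] := f01 x.
rewrite (PiI u cu (ge0 u u01)) (PiI v cv (ge0 v v01)) (PiI w cw (ge0 w w01)).
apply: (lee_lim_product (fin u cu u01) (fin v cv v01) (fin w cw w01)
  (lim u cu u01) (lim v cv v01) (lim w cw w01)).
exists N0 => // N /= N0N.
apply: (@prekopa_leindler_gaussian_sequence R _ _ P t tind tlaw N
  (fun s => u (embed S p a N s)) (fun s => v (embed S p a N s)) (fun s => w (embed S p a N s)) c) => //.
- exact: embed_measurable.
- exact: embed_measurable.
- exact: embed_measurable.
- by move=> s s' ss'; congr u; apply: eq_big_nat => k /andP[_ kN]; rewrite ss'.
- by move=> s s' ss'; congr v; apply: eq_big_nat => k /andP[_ kN]; rewrite ss'.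
- by move=> s s' ss'; congr w; apply: eq_big_nat => k /andP[_ kN]; rewrite ss'.
move=> s s'.
have zero r k : (N <= k)%N -> embed S p a N r k = 0.
  by move=> Nk; rewrite embed_coef ltnNge Nk.
have := uvw N (embed S p a N s) (embed S p a N s') N0N (zero s) (zero s').
have -> : 2^-1 *: (embed S p a N s + embed S p a N s') = embed S p a N (mid_seq s s').
  rewrite /embed -big_split/= scaler_sumr; apply: eq_bigr => k _.
  by rewrite -scalerDl scalerA; congr (_ *: _); rewrite /mid_seq; field.
suff -> : \sum_(k < N) S k `^ (2 * alpha + (sdim S)%:R) *
    (embed S p a N s k - embed S p a N s' k) ^+ 2 = \sum_(k < N) (s k - s' k) ^+ 2 by [].
apply: eq_bigr => k _; rewrite !embed_coef ltn_ord.
by rewrite -mulrBr exprMn mulrA a2 mul1r.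
Qed.

(** * The pairing of H_(-p) and H_p *)

Lemma lipschitz_continuous (R : realType) (V : normedModType R) (f : V -> R) (L : R) :
  0 <= L -> (forall x y, `|f x - f y| <= L * `|x - y|) -> continuous f.
Proof.
move=> L0 fL x; apply/cvgrPdist_le => e e0.
have L1 : 0 < L + 1 by rewrite ltr_wpDl.
near=> y; apply: le_trans (fL x y) _.
apply: (@le_trans _ _ ((L + 1) * (e / (L + 1)))); last first.
  by rewrite mulrC divfK// gt_eqF.
apply: ler_pM => //; first by rewrite lerDl.
near: y; apply/nbhs_normP; exists (e / (L + 1)); first by rewrite /= divr_gt0.
by move=> y /= /ltW.
Unshelve. all: by end_near. Qed.

Section pairing.
Context {R : realType} (S : spectrum R) (p : R).
Implicit Types (b : hscale S (- p)) (h : hscale S p).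

Lemma hweightN s k : hweight S (- s) k * hweight S s k = 1.
Proof.
rewrite /hweight -powRD ?(gt_eqF (eigval_gt0 S k)) ?implybT//.
by rewrite mulrN addNr powRr0.
Qed.

Lemma riesz_sqr (b : nat -> R) k :
  hweight S p k * (hweight S (- p) k * b k * (hweight S (- p) k * b k)) =
  hweight S (- p) k * (b k * b k).
Proof.
transitivity (hweight S (- p) k * hweight S p k * (hweight S (- p) k * (b k * b k))).
  by ring.
by rewrite hweightN mul1r.
Qed.

Lemma riesz_in_hs b : (fun k => hweight S (- p) k * b k) \in in_hs S p.
Proof.
apply/asboolP; have /asboolP := hcoefP b.
rewrite (_ : (fun k => hweight S (- p) k * (b k * b k)) =
  (fun k => hweight S p k * (hweight S (- p) k * b k * (hweight S (- p) k * b k))))//.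
by apply/funext => k; exact/esym/riesz_sqr.
Qed.

(** The representative in H_p of the linear form defined by b, so that the
    pairing inherits the properties of the inner product of H_p. *)
Definition riesz b : hscale S p := HScale (riesz_in_hs b).

Lemma hpairE b h : hpair b h = hdot S p (riesz b) h.
Proof.
congr (limn (series _)); apply/funext => k /=.
rewrite hweight0 mul1r -[LHS]mul1r -(hweightN p k); ring.
Qed.

Lemma hdot_riesz b : hdot S p (riesz b) (riesz b) = hdot S (- p) b b.
Proof.
by congr (limn (series _)); apply/funext => k /=; exact: riesz_sqr.
Qed.

Lemma hpairDr b h g : hpair b (h + g) = hpair b h + hpair b g.
Proof.
rewrite !hpairE hdotC -[X in X + _]scale1r hdotDl ?hcoefP// mul1r.
by rewrite ![hdot _ _ _ (riesz b)]hdotC.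
Qed.

Lemma hpairZr b a h : hpair b (a *: h) = a * hpair b h.
Proof.
have h0 : hpair b (0 : hscale S p) = 0.
  by have := hpairDr b 0 0; rewrite addr0; lra.
rewrite -[a *: h]addr0 hpairE hdotC hdotDl ?hcoefP// ![hdot _ _ _ (riesz b)]hdotC.
by rewrite -!hpairE h0 addr0.
Qed.

Lemma hpairDl b c h : hpair (b + c) h = hpair b h + hpair c h.
Proof.
rewrite !hpairE.
have -> : (riesz (b + c) : nat -> R) = 1 *: (riesz b : nat -> R) + riesz c.
  apply/funext => k; rewrite scale1r /=.
  by change (hweight S (- p) k * (b k + c k) =
    hweight S (- p) k * b k + hweight S (- p) k * c k); rewrite mulrDr.
by rewrite hdotDl ?hcoefP// mul1r.
Qed.

Lemma hpair_bound b h : `|hpair b h| <= `|b| * `|h|.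
Proof.
change (`|hpair b h| <= hnorm S (- p) b * hnorm S p h).
rewrite -ler_sqr ?nnegrE ?mulr_ge0 ?sqrtr_ge0// real_normK ?num_real//.
rewrite exprMn !sqr_sqrtr ?hdot_ge0 ?hcoefP// -hdot_riesz hpairE.
exact: hdot_CS.
Qed.

Lemma hpairNr b h : hpair b (- h) = - hpair b h.
Proof. by rewrite -scaleN1r hpairZr mulN1r. Qed.

Lemma hpairNl b h : hpair (- b) h = - hpair b h.
Proof.
have h0 : hpair (0 : hscale S (- p)) h = 0.
  by have := hpairDl 0 0 h; rewrite addr0; lra.
by have := hpairDl b (- b) h; rewrite subrr h0; lra.
Qed.

Lemma hpair_continuousr b : continuous (hpair b).
Proof.
apply: (@lipschitz_continuous _ _ _ `|b|) => // x y.
by rewrite -hpairNr -hpairDr; exact: hpair_bound.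
Qed.

Lemma hpair_continuousl h : continuous (fun b => hpair b h).
Proof.
apply: (@lipschitz_continuous _ _ _ `|h|) => // x y.
by rewrite -hpairNl -hpairDl mulrC; exact: hpair_bound.
Qed.

End pairing.

(** * Convexity of the log-partition function *)

Section exponential_bounds.
Context {R : realType}.

(** The product of the cubic Taylor polynomial with exp (- y) has derivative
    - y ^ 3 exp (- y) / 6, hence is maximal at 0. *)
Lemma expR_ge_cubic (y : R) : 1 + y + y ^+ 2 / 2 + y ^+ 3 / 6 <= expR y.
Proof.
pose g (x : R) := (1 + x + x ^+ 2 / 2 + x ^+ 3 / 6) * expR (- x).
have dg (x : R) : is_derive x 1 g (- x ^+ 3 / 6 * expR (- x)).
  apply: is_derive_eq.
  by rewrite /GRing.scale/=; field.
suff : g y <= g 0.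
  rewrite /g !expr0n/= !mul0r !addr0 oppr0 expR0 mulr1.
  by rewrite expRN ler_pdivrMr ?expR_gt0// mul1r.
have cg (a b : R) : {within `[a, b], continuous g}.
  apply: continuous_subspaceT => x.
  apply: differentiable_continuous; apply/derivable1_diffP.
  by have := dg x => -[].
have [y0|y0] := leP 0 y.
  have [c /[!in_itv]/= /andP[c0 _]] := MVT_segment y0 (fun x _ => dg x) (cg _ _).
  rewrite -subr_le0 subr0 => ->; rewrite mulr_le0_ge0//.
  rewrite mulr_le0_ge0 ?expR_ge0// mulNr oppr_le0 divr_ge0// exprn_ge0//.
have [c /[!in_itv]/= /andP[_ c0]] := MVT_segment (ltW y0) (fun x _ => dg x) (cg _ _).
rewrite -subr_ge0 sub0r => ->; rewrite mulr_ge0// ?oppr_ge0 ?(ltW y0)//.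
rewrite mulr_ge0 ?expR_ge0// divr_ge0// oppr_ge0.
by rewrite exprS mulr_le0_ge0// sqr_ge0.
Qed.

Lemma cosh_ge_quadratic (y : R) : 2 + y ^+ 2 <= expR y + expR (- y).
Proof.
have := expR_ge_cubic y; have := expR_ge_cubic (- y).
have -> : (- y) ^+ 3 = - (y ^+ 3) by ring.
by rewrite sqrrN; lra.
Qed.

End exponential_bounds.

Section variance_laplace.
Context d (X : measurableType d) (R : realType) (mu : {measure set X -> \bar R}).
Variables (f b : X -> R) (A B : R).
Hypotheses (mf : measurable_fun setT f) (mb : measurable_fun setT b)
  (f0 : forall x, 0 <= f x).
Hypotheses (f1 : (\int[mu]_x (f x)%:E = 1)%E)
  (fA : (\int[mu]_x (expR (b x) * f x)%:E = A%:E)%E)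
  (fB : (\int[mu]_x (expR (- b x) * f x)%:E = B%:E)%E)
  (A0 : 0 < A) (B0 : 0 < B).

(** Shift b by the constant kap for which exp (b - kap) and exp (kap - b) have
    the same mean, namely the square root of A B. Their sum dominates
    2 + (b - kap) ^ 2, and the second moment about kap dominates the
    variance. *)
Lemma variance_le_laplace :
  (\int[mu]_x ((b x - fine (\int[mu]_y (b y * f y)%:E)) ^+ 2 * f x)%:E <=
   (2 * Num.sqrt (A * B) - 2)%:E)%E.
Proof.
pose rA := expR (ln A / 2); pose rB := expR (ln B / 2).
have rA0 : 0 < rA by exact: expR_gt0.
have rB0 : 0 < rB by exact: expR_gt0.
have rA2 : rA ^+ 2 = A.
  by rewrite /rA -expRM_natl mulrC divfK// lnK.
have rB2 : rB ^+ 2 = B.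
  by rewrite /rB -expRM_natl mulrC divfK// lnK.
have -> : Num.sqrt (A * B) = rA * rB.
  by rewrite -rA2 -rB2 -exprMn sqrtr_sqr ger0_norm// mulr_ge0// ltW.
(* The shift that makes the two Laplace transforms equal. *)
pose kap := (ln A - ln B) / 2.
have mE (g : X -> R) : measurable_fun setT g -> measurable_fun setT (EFin \o g).
  by move=> mg; exact/measurable_EFinP.
have mgf (g : X -> R) : measurable_fun setT g -> measurable_fun setT (fun x => g x * f x).
  by move=> mg; exact: measurable_funM.
have mexp (g : X -> R) : measurable_fun setT g -> measurable_fun setT (fun x => expR (g x)).
  by move=> mg; apply: measurableT_comp.
have mN : measurable_fun setT (fun x => - b x) by exact: measurableT_comp.
have mk : measurable_fun setT (fun x => b x - kap) by exact: measurable_funB.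
have mk2 : measurable_fun setT (fun x => (b x - kap) ^+ 2) by exact: measurable_funX.
have plus : (\int[mu]_x (expR (b x - kap) * f x)%:E = (rA * rB)%:E)%E.
  transitivity (\int[mu]_x ((expR (- kap))%:E * (expR (b x) * f x)%:E))%E.
    by apply: eq_integral => x _; rewrite -EFinM expRD mulrCA mulrA.
  rewrite ge0_integralZl_EFin ?expR_ge0//; first last.
  - exact/mE/mgf/mexp.
  - by move=> x _; rewrite lee_fin mulr_ge0// expR_ge0.
  rewrite fA -EFinM; congr EFin.
  by rewrite -[in LHS](lnK A0) -expRD /rA /rB -expRD /kap; congr expR; field.
have minus : (\int[mu]_x (expR (- (b x - kap)) * f x)%:E = (rA * rB)%:E)%E.
  transitivity (\int[mu]_x ((expR kap)%:E * (expR (- b x) * f x)%:E))%E.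
    by apply: eq_integral => x _; rewrite -EFinM opprB addrC expRD mulrCA mulrA.
  rewrite ge0_integralZl_EFin ?expR_ge0//; first last.
  - exact/mE/mgf/mexp.
  - by move=> x _; rewrite lee_fin mulr_ge0// expR_ge0.
  rewrite fB -EFinM; congr EFin.
  by rewrite -[in LHS](lnK B0) -expRD /rA /rB -expRD /kap; congr expR; field.
have IJ : (\int[mu]_x ((b x - kap) ^+ 2 * f x)%:E <= (2 * (rA * rB) - 2)%:E)%E.
  rewrite -(@leeD2rE _ 2%:E)// -EFinD subrK.
  have -> : (2 : R)%:E = (\int[mu]_x (2 * f x)%:E)%E.
    under eq_integral do rewrite EFinM.
    by rewrite ge0_integralZl_EFin// ?f1 ?mule1//; [move=> x _; rewrite lee_fin|exact: mE].
  have -> : (2 * (rA * rB))%:E =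
      (\int[mu]_x ((expR (b x - kap) * f x)%:E + (expR (- (b x - kap)) * f x)%:E))%E.
    rewrite ge0_integralD//.
    - by rewrite plus minus -EFinD; congr EFin; ring.
    - by move=> x _; rewrite lee_fin mulr_ge0// expR_ge0.
    - exact/mE/mgf/mexp.
    - by move=> x _; rewrite lee_fin mulr_ge0// expR_ge0.
    - by apply/mE/mgf/mexp; exact: measurableT_comp.
  rewrite -ge0_integralD//; first last.
  - by apply: mE; exact: measurable_funM.
  - by move=> x _; rewrite lee_fin mulr_ge0.
  - exact/mE/mgf.
  - by move=> x _; rewrite lee_fin mulr_ge0// sqr_ge0.
  apply: ge0_le_integral => //.
  - by move=> x _; rewrite -EFinD lee_fin -mulrDl mulr_ge0// addr_ge0// sqr_ge0.
  - by apply: emeasurable_funD; apply: mE; [exact: mgf|exact: measurable_funM].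
  - apply: emeasurable_funD; apply/mE/mgf/mexp => //; exact: measurableT_comp.
  move=> x _; rewrite -!EFinD lee_fin -!mulrDl ler_wpM2r// addrC.
  exact: cosh_ge_quadratic.
have intf : mu.-integrable setT (EFin \o f).
  apply/integrableP; split; first exact: mE.
  under eq_integral do rewrite /= ger0_norm//.
  by rewrite f1 ltry.
have int2 : mu.-integrable setT (EFin \o (fun x => (b x - kap) ^+ 2 * f x)).
  apply/integrableP; split; first exact/mE/mgf.
  apply: le_lt_trans (ltry (2 * (rA * rB) - 2)); apply: le_trans IJ.
  rewrite le_eqVlt; apply/orP; left; apply/eqP; apply: eq_integral => x _.
  by rewrite /= ger0_norm// mulr_ge0// sqr_ge0.
(* The first moment is finite because |y| <= y ^ 2 + 1. *)
have int1 : mu.-integrable setT (EFin \o (fun x => (b x - kap) * f x)).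
  apply: (@le_integrable _ _ _ mu setT measurableT _
     (fun x => ((b x - kap) ^+ 2 * f x)%:E + (f x)%:E)%E).
  - exact/mE/mgf.
  - move=> x _ /=; rewrite lee_fin normrM (ger0_norm (f0 x)) [X in _ <= X]ger0_norm; last first.
      by rewrite addr_ge0// mulr_ge0// sqr_ge0.
    rewrite -[in X in _ <= _ + X](mul1r (f x)) -mulrDl ler_wpM2r//.
    set y := b x - kap.
    have := sqr_ge0 (y - 2^-1); have := sqr_ge0 (y + 2^-1).
    by rewrite ler_norml !expr2 => h1 h2; apply/andP; split; lra.
  exact: (integrableD measurableT int2 intf).
pose m := fine (\int[mu]_y (b y * f y)%:E)%E.
rewrite -/m.
have Im : (\int[mu]_x ((b x - kap) * f x)%:E = (m - kap)%:E)%E.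
  have fin1 : (\int[mu]_x ((b x - kap) * f x)%:E)%E \is a fin_num by exact: integrable_fin_num.
  have -> : m = fine (\int[mu]_x ((b x - kap) * f x)%:E)%E + kap.
    rewrite /m (_ : (\int[mu]_y (b y * f y)%:E =
      \int[mu]_x ((b x - kap) * f x)%:E + kap%:E)%E); last first.
      have -> : kap%:E = (\int[mu]_x (kap%:E * (f x)%:E))%E.
        by rewrite integralZl// f1 mule1.
      rewrite -integralD//; last exact: integrableZl.
      by apply: eq_integral => x _; rewrite -EFinM -EFinD; congr EFin; ring.
    by rewrite fineD.
  by rewrite addrK fineK.
apply: le_trans IJ.
have -> : (\int[mu]_x ((b x - m) ^+ 2 * f x)%:E =
    \int[mu]_x ((b x - kap) ^+ 2 * f x)%:E + (- (m - kap) ^+ 2)%:E)%E.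
  have -> : (- (m - kap) ^+ 2)%:E =
      (\int[mu]_x ((- 2 * (m - kap))%:E * ((b x - kap) * f x)%:E) +
       \int[mu]_x (((m - kap) ^+ 2)%:E * (f x)%:E))%E.
    rewrite integralZl// integralZl// Im f1 mule1 -EFinM -EFinD; congr EFin; ring.
  have i1 : mu.-integrable setT (fun x => (- 2 * (m - kap))%:E * ((b x - kap) * f x)%:E)%E.
    exact: integrableZl.
  have i2 : mu.-integrable setT (fun x => ((m - kap) ^+ 2)%:E * (f x)%:E)%E.
    exact: integrableZl.
  rewrite -integralD// -integralD//; last exact: integrableD.
  by apply: eq_integral => x _; rewrite -!EFinM -!EFinD; congr EFin; ring.
by rewrite geeDl// lee_fin oppr_le0 sqr_ge0.
Qed.

End variance_laplace.

Section second_differences.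
Context {R : realType}.

(** A sequence whose second differences are at least 2 delta grows at least
    like j ^ 2 delta. *)
Lemma second_difference_telescope (D : nat -> R) (delta : R) (N : nat) :
  D 0%N = 0 -> delta <= D 1%N ->
  (forall j, (j.+1 < N)%N -> delta *+ 2 <= D j.+2 - D j.+1 *+ 2 + D j) ->
  (0 < N)%N -> N%:R ^+ 2 * delta <= D N.
Proof.
move=> D0 D1 D2 N0.
have H j : (j < N)%N -> j%:R ^+ 2 * delta <= D j /\
    (j%:R *+ 2 + 1) * delta <= D j.+1 - D j.
  elim: j => [|j IH] jN; first by rewrite D0 mul0rn expr0n/= mul0r add0r mul1r subr0.
  have [H1 H2] := IH (ltnW jN); have := D2 j jN.
  rewrite -natr1 !mulr2n => H3; split; nra.
have NE : N.-1.+1 = N by rewrite prednK.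
have [|H1 H2] := H N.-1; first by rewrite NE.
rewrite -[in D N]NE -[in N%:R]NE -natr1; nra.
Qed.

Lemma ln_lower_bound (x : R) : 0 <= x -> x / (1 + x) <= ln (1 + x).
Proof.
move=> x0; have x1 : 0 < 1 + x by rewrite ltr_pwDl.
rewrite -ler_expR lnK ?posrE//.
rewrite -[X in _ <= X]invrK -[leLHS]invrK lef_pV2 ?posrE ?invr_gt0 ?expR_gt0//.
rewrite -expRN; apply: le_trans (expR_ge1Dx _).
rewrite le_eqVlt; apply/orP; left; apply/eqP; field; exact: lt0r_neq0.
Qed.

(** Telescoping the second differences at scale 1 / N between - 1 and 1, each
    at least 2 ln (1 + C / (2 N ^ 2)), gives N ^ 2 times that bound, which tends
    to C. *)
Lemma strong_midpoint_convexity (g : R -> R) (C : R) : 0 <= C ->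
  (forall t s, `|t| <= 1 -> ln (1 + s ^+ 2 * C / 2) *+ 2 <= g (t + s) + g (t - s) - g t *+ 2) ->
  C <= g 1 + g (- 1) - g 0 *+ 2.
Proof.
move=> C0 gC; set T := g 1 + _ - _.
have H N : (0 < N)%N -> C / (1 + C / 2 / N%:R ^+ 2) <= T.
  move=> N0; have NR : 0 < N%:R :> R by rewrite ltr0n.
  pose x := C / 2 / N%:R ^+ 2.
  have x0 : 0 <= x by rewrite !divr_ge0// exprn_ge0// ltW.
  have x1 : 0 < 1 + x by rewrite ltr_pwDl.
  apply: (@le_trans _ _ (N%:R ^+ 2 * (ln (1 + x) *+ 2))).
    apply: (@le_trans _ _ (N%:R ^+ 2 * (x / (1 + x) *+ 2))).
      rewrite le_eqVlt; apply/orP; left; apply/eqP.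
      rewrite -/x {1}(_ : C = N%:R ^+ 2 * x *+ 2); last first.
        by rewrite /x; field; exact: lt0r_neq0.
      field; exact: lt0r_neq0.
    rewrite ler_wpM2l ?exprn_ge0 ?(ltW NR)// lerMn2r/=; exact: ln_lower_bound.
  (* The symmetric increments at distance j / N from 0. *)
  pose D (j : nat) := g (j%:R / N%:R) + g (- (j%:R / N%:R)) - g 0 *+ 2.
  have -> : T = D N by rewrite /D divff// lt0r_neq0.
  have step j : (j <= N)%N -> ln (1 + x) *+ 2 <= g (j.+1%:R / N%:R) +
        g ((j%:R - 1) / N%:R) - g (j%:R / N%:R) *+ 2 /\
      ln (1 + x) *+ 2 <= g (- ((j%:R - 1) / N%:R)) +
        g (- (j.+1%:R / N%:R)) - g (- (j%:R / N%:R)) *+ 2.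
    move=> jN.
    have tj : `|j%:R / N%:R| <= 1 :> R.
      by rewrite ger0_norm ?divr_ge0// ler_pdivrMr// mul1r ler_nat.
    have xE : x = N%:R^-1 ^+ 2 * C / 2 by rewrite /x; field; exact: lt0r_neq0.
    have := gC _ N%:R^-1 tj; have := gC (- (j%:R / N%:R)) N%:R^-1; rewrite normrN.
    move=> /(_ tj).
    have e1 : j.+1%:R / N%:R = j%:R / N%:R + N%:R^-1 :> R by rewrite -natr1 mulrDl mul1r.
    have e2 : (j%:R - 1) / N%:R = j%:R / N%:R - N%:R^-1 :> R by rewrite mulrBl mul1r.
    by rewrite -xE e1 e2 (opprD (j%:R / N%:R) N%:R^-1) (opprB (j%:R / N%:R)) [N%:R^-1 - _]addrC.
  apply: second_difference_telescope => //.
  - by rewrite /D mul0r oppr0; ring.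
  - have [] := step 0%N isT; rewrite /D !mul0r sub0r mulN1r mul1r.
    by [].
  move=> j jN; have [h1 h2] := step j.+1 (ltnW jN).
  have e : j.+1%:R - 1 = j%:R :> R by rewrite -natr1 addrK.
  move: h1 h2; rewrite e /D.
  rewrite !mulr2n; lra.
rewrite leNgt; apply/negP => TC.
have T0 : 0 <= T.
  by apply: le_trans (H 1%N isT); rewrite divr_ge0// addr_ge0// !divr_ge0.
(* Large enough for C / (1 + C / (2 N ^ 2)) to exceed T. *)
pose N := (Num.truncn (T * (C / 2) / (C - T))).+1.
have NR : T * (C / 2) / (C - T) < N%:R by exact: truncnS_gt.
have N1 : 1 <= N%:R :> R by rewrite ler1n.
have N0 : 0 < N%:R :> R by rewrite (lt_le_trans ltr01).
have := H N isT.
have y0 : 0 <= C / 2 / N%:R ^+ 2 by rewrite !divr_ge0// exprn_ge0// ltW.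
rewrite ler_pdivrMr; last by rewrite ltr_pwDl.
rewrite mulrDr mulr1 leNgt => /negP; apply.
rewrite -ltrBrDl mulrA ltr_pdivrMr ?exprn_gt0//.
move: NR; rewrite ltr_pdivrMr ?subr_gt0// => NR.
have CT : 0 < C - T by rewrite subr_gt0.
apply: lt_le_trans NR _; rewrite mulrC ler_wpM2l ?(ltW CT)//.
by rewrite expr2 ler_peMl// ltW.
Qed.

End second_differences.

Section midpoints.
Context {R : realType} (V : lmodType R).

Lemma scaler_half_double (x : V) : 2^-1 *: (x + x) = x.
Proof.
rewrite scalerDr -scalerDl; have -> : 2^-1 + 2^-1 = 1 :> R by field.
exact: scale1r.
Qed.

Lemma midpoint_plus (x y : V) : 2^-1 *: (x + y) + 2^-1 *: (x - y) = x.
Proof. by rewrite -scalerDr addrACA subrr addr0 scaler_half_double. Qed.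

Lemma midpoint_minus (x y : V) : 2^-1 *: (x + y) - 2^-1 *: (x - y) = y.
Proof. by rewrite -scalerBr opprB [y - x]addrC addrACA subrr add0r scaler_half_double. Qed.

End midpoints.

Lemma normed_ball_segment (R : realType) (V : normedModType R) (c m h : V) (r t : R) :
  `|t| <= 1 -> `|m + h - c| <= r -> `|m - h - c| <= r -> `|m + t *: h - c| <= r.
Proof.
rewrite ler_norml => /andP[t1 t2] mh1 mh2.
have -> : m + t *: h - c = ((1 + t) / 2) *: (m + h - c) + ((1 - t) / 2) *: (m - h - c).
  have E k : m + k - c = (m - c) + k by rewrite addrAC.
  rewrite !E; move: (m - c) => u.
  rewrite scalerDr scalerBr addrACA -scalerDl -scalerBl.
  have -> : (1 + t) / 2 + (1 - t) / 2 = 1 by field.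
  have -> : (1 + t) / 2 - (1 - t) / 2 = t by field.
  by rewrite scale1r.
have a0 : 0 <= (1 + t) / 2 by lra.
have b0 : 0 <= (1 - t) / 2 by lra.
apply: le_trans (ler_normD _ _) _; rewrite (normrZ _ (m + h - c)) (normrZ _ (m - h - c)).
rewrite (ger0_norm a0) (ger0_norm b0).
have := ler_wpM2l a0 mh1; have := ler_wpM2l b0 mh2; lra.
Qed.

Section log_partition.
Context {R : realType} (S : spectrum R) (p : R).
Context d (X : measurableType d) (mu : {sigma_finite_measure set X -> \bar R})
  (bx : X -> hscale S (- p)).
Hypothesis mbx : measurable_fun setT bx.
Hypothesis hM : forall th, (0 < partition_fun mu bx th < +oo)%E.

Let M := log_partition mu bx.

Lemma measurable_hpair (h : hscale S p) : measurable_fun setT (fun x => hpair (bx x) h).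
Proof.
apply: (measurableT_comp (f := fun b => hpair b h)) => //.
apply: (measurability _ (RGenOpens.measurableE R)).
move=> _ [_ [a [b ->] <-]]; rewrite setTI; apply: sub_sigma_algebra.
by have /continuousP := @hpair_continuousl R S p h; apply; exact: interval_open.
Qed.

Lemma partition_funE th : partition_fun mu bx th = (expR (M th))%:E.
Proof.
have /andP[Z0 Zoo] := hM th.
have Zfin : partition_fun mu bx th \is a fin_num by rewrite ge0_fin_numE// ltW.
by rewrite /M /log_partition lnK ?fineK// posrE -lte_fin fineK.
Qed.

(** Under the density at th, the logarithm of the Laplace transform of the
    statistic is an increment of M. *)
Lemma expfam_density_tilt th h :
  (\int[mu]_x (expR (hpair (bx x) h) * expfam_density mu bx th x)%:E =
   (expR (M (th + h) - M th))%:E)%E.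
Proof.
transitivity (\int[mu]_x ((expR (- M th))%:E * (expR (hpair (bx x) (th + h)))%:E))%E.
  apply: eq_integral => x _; rewrite -EFinM /expfam_density -!expRD hpairDr.
  by rewrite -/M; move: (M th) => c; congr (expR _)%:E; ring.
rewrite ge0_integralZl_EFin ?expR_ge0//; last first.
  by apply/measurable_EFinP; apply: measurableT_comp => //; exact: measurable_hpair.
rewrite -/(partition_fun mu bx (th + h)) partition_funE -EFinM -expRD.
by rewrite addrC.
Qed.

(** The second difference of M is the logarithm of the product of the two
    Laplace transforms at h and - h, so no differentiation under the integral is
    needed. *)
Lemma log_partition_second_difference th h (v : R) : 0 <= v ->
  (v%:E <= fisher_info mu bx th h)%E ->
  ln (1 + v / 2) *+ 2 <= M (th + h) + M (th - h) - M th *+ 2.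
Proof.
move=> v0 vI.
have mb := measurable_hpair h.
have mf : measurable_fun setT (expfam_density mu bx th).
  apply: measurableT_comp => //; apply: measurable_funB => //; exact: measurable_hpair.
have f1 : (\int[mu]_x (expfam_density mu bx th x)%:E = 1)%E.
  have := expfam_density_tilt th 0; rewrite addr0 subrr expR0 => <-.
  apply: eq_integral => x _; rewrite -[X in hpair _ X](scale0r (0 : hscale S p)).
  by rewrite hpairZr mul0r expR0 mul1r.
have fB : (\int[mu]_x (expR (- hpair (bx x) h) * expfam_density mu bx th x)%:E =
    (expR (M (th - h) - M th))%:E)%E.
  rewrite -expfam_density_tilt; apply: eq_integral => x _.
  by rewrite hpairNr.
have := variance_le_laplace mf mb (fun x => expR_ge0 _) f1 (expfam_density_tilt th h) fB
  (expR_gt0 _) (expR_gt0 _).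
move=> /(le_trans vI); rewrite lee_fin -expRD.
set D := M (th + h) - M th + _.
have -> : M (th + h) + M (th - h) - M th *+ 2 = D.
  by rewrite /D; move: (M _) (M _) (M _) => a1 a2 a3; ring.
have -> : expR D = expR (D / 2) ^+ 2 by rewrite -expRM_natl mulrC divfK.
rewrite sqrtr_sqr ger0_norm ?expR_ge0// => vD.
have : ln (1 + v / 2) <= D / 2.
  rewrite -ler_expR lnK ?posrE; last by rewrite ltr_pwDl// divr_ge0.
  lra.
by rewrite -[ln _ *+ 2]mulr_natr ler_pdivlMr.
Qed.

Lemma log_partition_midpoint_convex (x y : hscale S p) :
  M (2^-1 *: (x + y)) *+ 2 <= M x + M y.
Proof.
have I0 : (0%:E <= fisher_info mu bx (2^-1 *: (x + y)) (2^-1 *: (x - y)))%E.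
  by apply: integral_ge0 => z _; rewrite lee_fin mulr_ge0 ?sqr_ge0// expR_ge0.
have := log_partition_second_difference (lexx 0) I0.
rewrite mul0r addr0 ln1 mul0rn subr_ge0.
by rewrite midpoint_plus midpoint_minus.
Qed.

(** For p >= 0 the weights of H_p are bounded below by the first one. *)
Lemma hscale_in_hs0 (h : hscale S p) : 0 <= p -> (h : nat -> R) \in in_hs S 0.
Proof.
move=> p0; apply/in_hs0P; have /asboolP ch := hcoefP h.
have l0 : 0 < hweight S p 0 by exact: hweight_gt0.
have ch' := is_cvg_seriesZ (k := (hweight S p 0)^-1) ch.
apply: (series_le_cvg _ _ _ ch') => k; rewrite /GRing.scale/=.
- by rewrite -expr2 sqr_ge0.
- by rewrite mulr_ge0 ?invr_ge0 ?(ltW l0)// mulr_ge0 ?(ltW (hweight_gt0 _ _ _))// -expr2 sqr_ge0.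
rewrite [leRHS]mulrA ler_peMl -?expr2 ?sqr_ge0// mulrC ler_pdivlMr// mul1r.
rewrite /hweight ge0_ler_powR ?mulr_ge0 ?nnegrE ?(ltW (eigval_gt0 _ _))//.
exact: eigval_nd.
Qed.

(** The lower bound on the Fisher information along the segment from x to y
    is a lower bound on all second differences of M there. *)
Lemma log_partition_strongly_midpoint_convex (th0 : hscale S p) (r0 c0 : R) :
  0 <= p -> 0 <= c0 ->
  (forall h th : hscale S p, hball th0 r0 th ->
    ((c0 * hnorm S 0 h ^+ 2)%:E <= fisher_info mu bx th h)%E) ->
  forall x y, hball th0 r0 x -> hball th0 r0 y ->
  c0 * hnorm S 0 (x - y) ^+ 2 / 4 <= M x + M y - M (2^-1 *: (x + y)) *+ 2.
Proof.
move=> p0 c00 hlower x y bx_ by_.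
pose m := 2^-1 *: (x + y); pose h := 2^-1 *: (x - y).
have xE : m + h = x by exact: midpoint_plus.
have yE : m - h = y by exact: midpoint_minus.
have nZ a (g : hscale S p) : hnorm S 0 (a *: g) = `|a| * hnorm S 0 g.
  exact: (hnormZ a (HScale (hscale_in_hs0 g p0))).
have i2 : `|2^-1| = 2^-1 :> R by rewrite ger0_norm ?invr_ge0.
have := @strong_midpoint_convexity R (fun t => M (m + t *: h)) (c0 * hnorm S 0 h ^+ 2) _ _.
rewrite scale1r scaleN1r scale0r addr0 xE yE.
have -> : c0 * hnorm S 0 h ^+ 2 = c0 * hnorm S 0 (x - y) ^+ 2 / 4.
  by rewrite nZ exprMn i2; field.
apply; first by rewrite divr_ge0// mulr_ge0// sqr_ge0.
move=> t s t1; cbv beta.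
have bmh : hball th0 r0 (m + h) by rewrite xE.
have bmh' : hball th0 r0 (m - h) by rewrite yE.
have bt : hball th0 r0 (m + t *: h) := normed_ball_segment t1 bmh bmh'.
have := hlower (s *: h) _ bt.
have -> : c0 * hnorm S 0 (s *: h) ^+ 2 = s ^+ 2 * (c0 * hnorm S 0 (x - y) ^+ 2 / 4).
  by rewrite !nZ !exprMn i2 (real_normK (num_real s)); field.
have v0 : 0 <= s ^+ 2 * (c0 * hnorm S 0 (x - y) ^+ 2 / 4).
  by rewrite mulr_ge0 ?sqr_ge0// divr_ge0// mulr_ge0// sqr_ge0.
have -> : m + (t + s) *: h = m + t *: h + s *: h by rewrite scalerDl addrA.
have -> : m + (t - s) *: h = m + t *: h - s *: h by rewrite scalerBl addrA.
exact: log_partition_second_difference v0.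
Qed.

End log_partition.

(** W is bounded near th0 by continuity; midpoint convexity compares the
    increment of W at a distant point with that at the point 2 ^ j times closer
    to th0. *)
Lemma midpoint_convex_bounded_below (R : realType) (V : normedModType R)
  (W : V -> R) (th0 : V) (rho : R) :
  continuous W -> (forall x y, W (2^-1 *: (x + y)) *+ 2 <= W x + W y) ->
  exists m, forall th, `|th - th0| <= rho -> m <= W th.
Proof.
move=> cW mW.
have /cvgrPdist_le /(_ 1 ltr01) /nbhs_normP[e /= e0 He] := cW th0.
have step h j : W (th0 + h) - W th0 >= 2 ^+ j * (W (th0 + (2^-1) ^+ j *: h) - W th0).
  elim: j => [|j IH]; first by rewrite !expr0 scale1r mul1r.
  apply: le_trans IH; rewrite exprSr -mulrA ler_wpM2l ?exprn_ge0//.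
  have := mW th0 (th0 + 2^-1 ^+ j *: h).
  have -> : 2^-1 *: (th0 + (th0 + 2^-1 ^+ j *: h)) = th0 + 2^-1 ^+ j.+1 *: h.
    by rewrite addrA scalerDr scaler_half_double exprS scalerA.
  rewrite mulr2n; lra.
(* Then 2 ^ j > rho / e, so 2 ^ (- j) brings the ball within distance e of th0. *)
pose j := (Num.truncn (`|rho| / e)).+1.
exists (W th0 - 2 ^+ j) => th thr.
have := step (th - th0) j; rewrite [th0 + (th - th0)]addrC subrK => H.
have : `|W th0 - W (th0 + 2^-1 ^+ j *: (th - th0))| <= 1.
  apply: He; rewrite /ball_/= opprD addNKr normrN normrZ ger0_norm ?exprn_ge0 ?invr_ge0//.
  rewrite exprVn mulrC ltr_pdivrMr ?exprn_gt0// mulrC -ltr_pdivrMr//.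
  apply: le_lt_trans (_ : `|rho| / e < _).
    by rewrite ler_pM2r ?invr_gt0// (le_trans thr)// ler_norm.
  apply: lt_le_trans (truncnS_gt _) _; rewrite -/j -natrX ler_nat.
  by rewrite ltnW// ltn_expl.
rewrite ler_norml => /andP[_ h2].
have := ler_wpM2l (exprn_ge0 j (ler0n R 2)) h2; lra.
Qed.

(** * The posterior conditioned on a ball *)

Section continuous_real_functions.
Context {R : realType} (T : topologicalType).
Implicit Types f g : T -> R.

Lemma continuous_mul f g : continuous f -> continuous g -> continuous (fun x => f x * g x).
Proof. by move=> cf cg x; apply: cvgM; [exact: cf|exact: cg]. Qed.

Lemma continuous_sub f g : continuous f -> continuous g -> continuous (fun x => f x - g x).
Proof. by move=> cf cg x; apply: (@cvgB _ R^o); [exact: cf|exact: cg]. Qed.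

Lemma continuous_cstM c f : continuous f -> continuous (fun x => c * f x).
Proof. by move=> cf x; apply: cvgM; [exact: cvg_cst|exact: cf]. Qed.

Lemma continuous_opp f : continuous f -> continuous (fun x => - f x).
Proof. by move=> cf x; apply: (@cvgN _ R^o); exact: cf. Qed.

Lemma continuous_after (h : R -> R) f :
  continuous h -> continuous f -> continuous (fun x => h (f x)).
Proof. by move=> ch cf x; apply: continuous_comp; [exact: cf|exact: ch]. Qed.

End continuous_real_functions.

Section cutoff.
Context {R : realType}.

(** Continuous and log-concave in rho; for large k it approximates the
    indicator of rho <= r. *)
Definition cutoff (k r rho : R) : R := Num.max 0 (Num.min 1 (1 - k * (rho - r))).

Lemma cutoff_bounds k r rho : 0 <= cutoff k r rho <= 1.
Proof. by rewrite /cutoff le_max lexx/= ge_max ler01 ge_min lexx. Qed.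

Lemma cutoff_inside k r rho : 0 <= k -> rho <= r -> cutoff k r rho = 1.
Proof.
move=> k0 rr; have h : 1 <= 1 - k * (rho - r).
  by rewrite lerDl oppr_ge0 mulr_ge0_le0// subr_le0.
by rewrite /cutoff min_l// max_r.
Qed.

Lemma cutoff_outside k r rho : 1 <= k * (rho - r) -> cutoff k r rho = 0.
Proof.
by move=> h; rewrite /cutoff max_l// ge_min subr_le0 h orbT.
Qed.

(** The truncated affine function is concave, so at the midpoint it dominates
    the arithmetic mean, hence the geometric mean. *)
Lemma cutoff_midpoint k r a b m : 0 <= k -> m <= (a + b) / 2 ->
  cutoff k r a * cutoff k r b <= cutoff k r m ^+ 2.
Proof.
move=> k0 mab.
pose phi x : R := Num.min 1 (1 - k * (x - r)).
have phim : (phi a + phi b) / 2 <= phi m.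
  have h1 x : phi x <= 1 by rewrite /phi ge_min lexx.
  have h2 x : phi x <= 1 - k * (x - r) by rewrite /phi ge_min lexx orbT.
  have := ler_wpM2l k0 mab.
  have := h1 a; have := h1 b; have := h2 a; have := h2 b.
  have -> : phi m = Num.min 1 (1 - k * (m - r)) by [].
  rewrite le_min; move: (phi a) (phi b) => x y.
  clear phi h1 h2; move=> y1 y2 y3 y4 y5.
  apply/andP; split; lra.
rewrite {1 2}/cutoff -/(phi a) -/(phi b).
have [a0|a0] := leP (phi a) 0; first by rewrite mul0r sqr_ge0.
have [b0|b0] := leP (phi b) 0; first by rewrite mulr0 sqr_ge0.
have m0 : phi m <= cutoff k r m by rewrite /cutoff le_max lexx orbT.
apply: (@le_trans _ _ (((phi a + phi b) / 2) ^+ 2)).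
  have := sqr_ge0 (phi a - phi b); rewrite !expr2; nra.
have mm := le_trans phim m0.
have s0 : 0 <= (phi a + phi b) / 2 by rewrite divr_ge0// addr_ge0// ltW.
by rewrite ler_pXn2r ?nnegrE// (le_trans s0).
Qed.

Lemma cutoff_continuous k r : 0 <= k -> continuous (cutoff k r).
Proof.
move=> k0 x; rewrite /cutoff.
have c1 : {for x, continuous (fun y : R => 1 - k * (y - r))}.
  apply: (@cvgB _ R^o); first exact: cvg_cst.
  apply: cvgM; first exact: cvg_cst.
  by apply: (@cvgB _ R^o); [exact: cvg_id|exact: cvg_cst].
have c2 : {for x, continuous (fun y : R => Num.min 1 (1 - k * (y - r)))}.
  by apply: (@continuous_min _ _ (cst 1)) => //; exact: cvg_cst.
exact: (@continuous_max _ _ (cst 0) (fun y : R => Num.min 1 (1 - k * (y - r))) x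
  (cvg_cst _) c2).
Qed.

Lemma cutoff_cvg c r rho : 0 < c ->
  cutoff (m.+1%:R * c) r rho @[m --> \oo] --> (((rho <= r)%R)%:R : R).
Proof.
move=> c0; have [rr|rr] := leP rho r.
  rewrite (_ : (fun m => _) = cst 1); first exact: cvg_cst.
  by apply/funext => m; rewrite cutoff_inside// mulr_ge0// ltW.
apply: (@cvg_near_cst _ _ 0); near=> m; apply/eqP/eqP/cutoff_outside.
have cr : 0 < c * (rho - r) by rewrite mulr_gt0// subr_gt0.
rewrite -mulrA -ler_pdivrMr// mul1r.
apply: (@le_trans _ _ m%:R); last by rewrite ler_nat.
near: m; exact: nbhs_infty_ger.
Unshelve. all: by end_near. Qed.

End cutoff.

Lemma hnorm0_partial_sum (R : realType) (S : spectrum R) (p : R) (h : hscale S p) N :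
  0 <= p -> \sum_(k < N) h k ^+ 2 <= hnorm S 0 h ^+ 2.
Proof.
move=> p0; have hs := hscale_in_hs0 h p0.
rewrite sqr_sqrtr ?hdot_ge0//.
have -> : \sum_(k < N) h k ^+ 2 = series (fun k => hweight S 0 k * (h k * h k)) N.
  by rewrite /series/= big_mkord; apply: eq_bigr => k _; rewrite hweight0 mul1r expr2.
apply: nondecreasing_cvgn_le; last exact: hdot_cvg.
apply/nondecreasing_seqP => j; rewrite /series/= big_nat_recr//= lerDl.
by rewrite mulr_ge0 ?(ltW (hweight_gt0 _ _ _))// -expr2 sqr_ge0.
Qed.

Lemma regrouped_product_bound (R : realType) (e1 e2 w1 w2 k1 k2 wm km q : R) :
  0 <= e1 -> 0 <= e2 -> 0 <= w1 -> 0 <= w2 -> 0 <= k1 -> 0 <= k2 -> 0 <= q ->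
  (k1 != 0 -> k2 != 0 -> e1 * e2 * (w1 * w2) <= wm ^+ 2 * q) -> k1 * k2 <= km ^+ 2 ->
  e1 * (w1 * k1) * (e2 * (w2 * k2)) <= (wm * km) ^+ 2 * q.
Proof.
move=> e10 e20 w10 w20 k10 k20 q0 h1 h2.
have [x0|x0] := eqVneq k1 0; first by rewrite x0 !mulr0 mul0r mulr_ge0 ?sqr_ge0.
have [y0|y0] := eqVneq k2 0; first by rewrite y0 !mulr0 mulr_ge0 ?sqr_ge0.
rewrite (_ : _ * _ * _ = (e1 * e2 * (w1 * w2)) * (k1 * k2)); last by ring.
rewrite (_ : _ ^+ 2 * q = (wm ^+ 2 * q) * km ^+ 2); last by ring.
by apply: ler_pM (h1 x0 y0) h2; rewrite // !mulr_ge0.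
Qed.

Lemma exponent_balance (R : realType) (nn c0 a1 a2 a3 b1 b2 b3 b4 b5 b6 b7 b8 : R) :
  nn * c0 * a3 <= nn * c0 * a1 ->
  nn * (c0 * a1 / 4) <= nn * (b4 + b5 - b6 *+ 2) ->
  b7 - b8 <= (nn * c0 * a3 + a2) / 4 -> b3 *+ 2 = b1 + b2 ->
  b7 - b8 + (nn * (b1 - b4) + nn * (b2 - b5)) <= 2 * (nn * (b3 - b6)) + a2 / 4.
Proof.
move=> h1 h2 gh hm; have -> : b1 = b3 *+ 2 - b2 by rewrite hm addrK.
lra.
Qed.

Section conditioned_posterior.
Context {R : realType} (S : spectrum R) (p alpha : R) (p0 : 0 <= p).
Variables (Pi : probability (hscale S p) R) (hPi : gaussian_prior alpha Pi).
Variables (M : hscale S p -> R) (th0 : hscale S p) (r r0 c0 : R).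
Hypotheses (cM : continuous M)
  (convM : forall x y, M (2^-1 *: (x + y)) *+ 2 <= M x + M y)
  (strongM : forall x y, hball th0 r0 x -> hball th0 r0 y ->
     c0 * hnorm S 0 (x - y) ^+ 2 / 4 <= M x + M y - M (2^-1 *: (x + y)) *+ 2)
  (c0_ge0 : 0 <= c0) (rr0 : r < r0).
Variables (n : nat) (tau : hscale S (- p)).

Let B : set (hscale S p) := hball th0 r.
Let w : hscale S p -> R := tilt_weight n tau M.
Let dist (th : hscale S p) : R := `|th - th0|.

Lemma dist_continuous : continuous dist.
Proof.
apply: (@lipschitz_continuous _ _ _ 1) => // x y; rewrite mul1r.
apply: le_trans (ler_dist_dist _ _) _.
by rewrite opprB addrA subrK.
Qed.

Lemma dist_midpoint x y : dist (2^-1 *: (x + y)) <= (dist x + dist y) / 2.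
Proof.
rewrite /dist.
have -> : 2^-1 *: (x + y) - th0 = 2^-1 *: ((x - th0) + (y - th0)).
  by rewrite addrACA -opprD scalerBr scaler_half_double.
rewrite normrZ ger0_norm ?invr_ge0// mulrC ler_wpM2r ?invr_ge0//; exact: ler_normD.
Qed.

Lemma hball_measurable : measurable B.
Proof.
rewrite (_ : B = dist @^-1` `]-oo, r]); last first.
  by apply/seteqP; split=> x /=; rewrite in_itv.
rewrite -[X in measurable X]setTI.
exact: (continuous_hscale_measurable dist_continuous).
Qed.

Lemma tilt_weight_continuous : continuous w.
Proof.
apply: continuous_after; first exact: continuous_expR.
by apply: continuous_cstM; apply: continuous_sub => //; exact: hpair_continuousr.
Qed.

(** A ball of infinite dimension is not compact; the bound comes from the
    convexity of M instead. *)
Lemma tilt_weight_bounded : exists C, forall th, dist th <= r0 -> w th <= C.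
Proof.
have cW : continuous (fun th => n%:R * (M th - hpair tau th)).
  by apply: continuous_cstM; apply: continuous_sub => //; exact: hpair_continuousr.
have mW x y : n%:R * (M (2^-1 *: (x + y)) - hpair tau (2^-1 *: (x + y))) *+ 2 <=
    n%:R * (M x - hpair tau x) + n%:R * (M y - hpair tau y).
  rewrite -mulrDr -mulrnAr ler_wpM2l// hpairZr hpairDr.
  have := convM x y; lra.
have [m Hm] := midpoint_convex_bounded_below th0 r0 cW mW.
exists (expR (- m)) => th /Hm mth; rewrite ler_expR; lra.
Qed.

Let slope (m : nat) : R := m.+1%:R * (r0 - r)^-1.
Let chi m (th : hscale S p) : R := cutoff (slope m) r (dist th).

Lemma slope_ge0 m : 0 <= slope m.
Proof. by rewrite mulr_ge0// invr_ge0 subr_ge0 ltW. Qed.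

Lemma chi_support m th : chi m th != 0 -> dist th <= r0.
Proof.
apply: contra_neqT; rewrite -ltNge => rd; apply: cutoff_outside.
have r1 : 0 < r0 - r by rewrite subr_gt0.
rewrite /slope -mulrA mulrC -mulrA mulrC ler_pdivlMr// mul1r.
have : 1 <= m.+1%:R :> R by rewrite ler1n.
have : 0 < dist th - r0 by rewrite subr_gt0.
nra.
Qed.

Lemma chi_continuous m : continuous (chi m).
Proof.
apply: continuous_after; first exact: cutoff_continuous (slope_ge0 m).
exact: dist_continuous.
Qed.

Lemma tilt_cutoff_bounded :
  exists2 C, 0 <= C & forall m x, 0 <= w x * chi m x <= C.
Proof.
have [C HC] := tilt_weight_bounded.
exists `|C| => // m x.
have /andP[chi0 chi1] := cutoff_bounds (slope m) r (dist x).
have w0 : 0 <= w x by exact: expR_ge0.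
rewrite mulr_ge0//=; have [->|x0] := eqVneq (chi m x) 0; first by rewrite mulr0.
apply: le_trans (_ : w x * 1 <= _); first by rewrite ler_wpM2l.
by rewrite mulr1 (le_trans (HC _ (chi_support x0)))// ler_norm.
Qed.

(** The strong convexity of M on the larger ball, where the cutoff is
    supported, supplies the part n c0 of the precision; the prior supplies the
    rest. *)
Lemma posterior_prekopa_leindler (G H : hscale S p -> R) (c : R) (N0 : nat) (m : nat) :
  continuous G -> continuous H ->
  (forall x, G x <= c) -> (forall x, - H x <= c) -> 0 <= c ->
  (forall N (x y : hscale S p), (N0 <= N)%N ->
     G x - H y <= (\sum_(k < N) (n%:R * c0 + S k `^ (2 * alpha + (sdim S)%:R)) *
                     (x k - y k) ^+ 2) / 4) ->
  (\int[Pi]_x (expR (G x) * (w x * chi m x))%:E *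
   \int[Pi]_x (expR (- H x) * (w x * chi m x))%:E <=
   \int[Pi]_x (w x * chi m x)%:E * \int[Pi]_x (w x * chi m x)%:E)%E.
Proof.
move=> cG cH Gc Hc cge0 GH.
have [C C0 wc] := tilt_cutoff_bounded.
have chi0 x : 0 <= chi m x by have /andP[] := cutoff_bounds (slope m) r (dist x).
have w0 x : 0 <= w x by exact: expR_ge0.
have ec : 1 <= expR c by rewrite -expR0 ler_expR.
have bnd (K : hscale S p -> R) : (forall x, K x <= c) ->
    forall x, 0 <= expR (K x) * (w x * chi m x) <= expR c * C.
  move=> Kc x; have /andP[h1 h2] := wc m x.
  by rewrite mulr_ge0 ?expR_ge0//= ler_pM ?expR_ge0// ler_expR.
have cwc : continuous (fun x => w x * chi m x).
  by apply: continuous_mul; [exact: tilt_weight_continuous|exact: chi_continuous].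
have ce (K : hscale S p -> R) : continuous K ->
    continuous (fun x => expR (K x) * (w x * chi m x)).
  move=> cK; apply: continuous_mul => //; apply: continuous_after => //; exact: continuous_expR.
have cNH : continuous (fun x => - H x) by exact: continuous_opp.
apply: (@prekopa_leindler_gaussian_prior R S p alpha Pi
  (fun x => expR (G x) * (w x * chi m x)) (fun x => expR (- H x) * (w x * chi m x))
  (fun x => w x * chi m x) (expR c * C) N0 hPi (ce _ cG) (ce _ cNH) cwc
  (bnd _ Gc) (bnd _ Hc)).
  move=> x; have /andP[h1 h2] := wc m x; rewrite h1/=.
  by apply: le_trans h2 _; rewrite ler_peMl.
move=> N x y N0N _ _; cbv beta.
set mid := 2^-1 *: (x + y); set Q := (X in _ <= _ * expR X).
have chim : chi m x * chi m y <= chi m mid ^+ 2.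
  by apply: cutoff_midpoint; [exact: slope_ge0|exact: dist_midpoint].
refine (@regrouped_product_bound R (expR (G x)) (expR (- H y)) (w x) (w y)
  (chi m x) (chi m y) (w mid) (chi m mid) (expR Q) (expR_ge0 _) (expR_ge0 _) (w0 x) (w0 y)
  (chi0 x) (chi0 y) (expR_ge0 _) _ chim).
move=> x0 y0.
have bx_ := chi_support x0; have by_ := chi_support y0.
rewrite /w /tilt_weight -!expRD -expRM_natl -expRD ler_expR /Q.
have sM := strongM bx_ by_; rewrite -/mid in sM.
have hm : hpair tau mid *+ 2 = hpair tau x + hpair tau y.
  by rewrite /mid hpairZr hpairDr mulr2n; field.
have part : \sum_(k < N) (x k - y k) ^+ 2 <= hnorm S 0 (x - y) ^+ 2.
  exact: (hnorm0_partial_sum (x - y) N p0).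
have gh := GH N x y N0N.
have sumE : \sum_(k < N) (n%:R * c0 + S k `^ (2 * alpha + (sdim S)%:R)) * (x k - y k) ^+ 2 =
    n%:R * c0 * (\sum_(k < N) (x k - y k) ^+ 2) +
    \sum_(k < N) S k `^ (2 * alpha + (sdim S)%:R) * (x k - y k) ^+ 2.
  by rewrite mulr_sumr -big_split/=; apply: eq_bigr => k _; rewrite mulrDl.
rewrite sumE in gh.
have nge0 : 0 <= n%:R :> R by [].
have h1 := ler_wpM2l (mulr_ge0 nge0 c0_ge0) part.
have h2 := ler_wpM2l nge0 sM.
exact: exponent_balance h1 h2 gh hm.
Qed.

Variables (nu nuB : probability (hscale S p) R).
Hypotheses (hnu : tilted Pi n tau M nu) (hnuB : conditioned nu B nuB).

Let wB (th : hscale S p) : R := w th * \1_B th.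

(** That nu and nuB are probabilities forces both normalizing constants to
    be finite and nonzero. *)
Lemma conditioned_density :
  exists2 Z : R, 0 < Z & (Z%:E = \int[Pi]_x (wB x)%:E)%E /\
    forall f : hscale S p -> \bar R, measurable_fun setT f -> (forall x, (0 <= f x)%E) ->
      (\int[nuB]_x f x = Z^-1%:E * \int[Pi]_x (f x * (wB x)%:E))%E.
Proof.
have mB := hball_measurable.
have mw : measurable_fun setT w := continuous_hscale_measurable tilt_weight_continuous.
have w0 x : 0 <= w x by exact: expR_ge0.
have mwB : measurable_fun setT wB by apply: measurable_funM => //; exact: measurable_indic.
have wB0 x : 0 <= wB x by rewrite mulr_ge0.
pose tc := tilt_const Pi n tau M.
have tcE : tc = (\int[Pi]_x (w x)%:E)%E by [].
have tc0 : (0 <= tc)%E by apply: integral_ge0 => x _; rewrite lee_fin.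
have T1 : ((fine tc)^-1%:E * tc = 1)%E.
  have := hnu measurableT; rewrite probability_setT => ->.
  by rewrite /tc /tilt_const.
have Tn0 : fine tc != 0.
  by apply/eqP => T0; move: T1; rewrite T0 invr0 mul0e => /eqP; rewrite eq_sym onee_eq0.
have T0 : 0 < fine tc by rewrite lt_neqAle eq_sym Tn0 fine_ge0.
pose I A := (\int[Pi]_(x in A) (w x)%:E)%E.
have I0 A : (0 <= I A)%E by apply: integral_ge0 => x _; rewrite lee_fin.
have Ifin A : measurable A -> I A \is a fin_num.
  move=> mA; have : nu A \is a fin_num by exact: fin_num_measure.
  rewrite hnu// -/(I A).
  rewrite ge0_fin_numE ?mule_ge0 ?lee_fin ?invr_ge0 ?(ltW T0)// => h.
  rewrite ge0_fin_numE//; move: h; case: (I A) => [s _|h|_] //; first by rewrite ltry.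
  by move: h; rewrite gt0_muley// lte_fin invr_gt0.
have nuE A : measurable A -> fine (nu A) = (fine tc)^-1 * fine (I A).
  by move=> mA; rewrite hnu// -/(I A) fineM//; exact: Ifin.
have IB A : measurable A -> I (A `&` B) = (\int[Pi]_(x in A) (wB x)%:E)%E.
  move=> mA; rewrite /I integral_mkcond [RHS]integral_mkcond.
  apply: eq_integral => x _; rewrite !patchE in_setI /wB indicE.
  by case: (x \in A) => //=; case: (x \in B); rewrite ?mulr1 ?mulr0.
have IBT : I B = (\int[Pi]_x (wB x)%:E)%E by rewrite -IB// setTI.
have Zn0 : fine (I B) != 0.
  apply/eqP => Z0; have := hnuB measurableT; rewrite probability_setT setTI.
  by rewrite nuE// Z0 mulr0 mul0r => /eqP; rewrite onee_eq0.
have Z0 : 0 < fine (I B) by rewrite lt_neqAle eq_sym Zn0 fine_ge0.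
exists (fine (I B)) => //; split; first by rewrite fineK ?Ifin// IBT.
move=> f mf f0.
have mrho : measurable_fun setT (fun x => (fine (I B))^-1 * wB x) by exact: measurable_funM.
rewrite (@ge0_integral_density _ _ R Pi nuB (fun x => (fine (I B))^-1 * wB x))//.
- rewrite -ge0_integralZl_EFin ?invr_ge0 ?ltW//.
  + by apply: eq_integral => x _; rewrite EFinM muleCA.
  + by move=> x _; rewrite mule_ge0// lee_fin.
  + by apply: emeasurable_funM => //; exact/measurable_EFinP.
- by move=> x; rewrite mulr_ge0// invr_ge0 ltW.
move=> A mA; transitivity ((fine (nu (A `&` B)) / fine (nu B))%:E); first exact: hnuB.
rewrite !nuE//; last exact: measurableI.
under eq_integral do rewrite EFinM.
rewrite ge0_integralZl_EFin ?invr_ge0 ?ltW//; last first.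
  by apply/measurable_EFinP; exact: measurable_funTS.
  by move=> x _; rewrite lee_fin.
rewrite -IB// -[in RHS](fineK (Ifin _ (measurableI _ _ mA mB))) -EFinM; congr EFin.
by field; rewrite Zn0 Tn0.
Qed.

(** The cutoffs decrease to the indicator of the ball; the limit of
    [posterior_prekopa_leindler] is homogeneous in the density, so the
    normalizing constant cancels. *)
Lemma conditioned_laplace_duality (G H : hscale S p -> R) (c : R) (N0 : nat) :
  continuous G -> continuous H ->
  (forall x, G x <= c) -> (forall x, - H x <= c) -> 0 <= c ->
  (forall N (x y : hscale S p), (N0 <= N)%N ->
     G x - H y <= (\sum_(k < N) (n%:R * c0 + S k `^ (2 * alpha + (sdim S)%:R)) *
                     (x k - y k) ^+ 2) / 4) ->
  (\int[nuB]_x (expR (G x))%:E * \int[nuB]_x (expR (- H x))%:E <= 1)%E.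
Proof.
move=> cG cH Gc Hc cge0 GH.
have [C C0 wc] := tilt_cutoff_bounded.
have [Z Z0 [ZE nuBE]] := conditioned_density.
have w0 x : 0 <= w x by exact: expR_ge0.
have cw := tilt_weight_continuous.
have r0r : 0 < (r0 - r)^-1 by rewrite invr_gt0 subr_gt0.
have chiB x : chi m x @[m --> \oo] --> (\1_B x : R).
  rewrite indicE (_ : (x \in B) = (dist x <= r)%R); first exact: cutoff_cvg.
  by apply/idP/idP; rewrite inE.
have mwB : measurable_fun setT wB.
  apply: measurable_funM; first exact: continuous_hscale_measurable.
  apply: measurable_indic; exact: hball_measurable.
have ec : 1 <= expR c by rewrite -expR0 ler_expR.
have cvg_ (K : hscale S p -> R) : continuous K -> (forall x, K x <= c) ->
    (\int[Pi]_x (expR (K x) * (w x * chi m x))%:E @[m --> \oo] -->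
     \int[Pi]_x (expR (K x) * wB x)%:E)%E.
  move=> cK Kc.
  have ceK : continuous (fun x => expR (K x)).
    by apply: continuous_after => //; exact: continuous_expR.
  apply: (bounded_convergence (c := expR c * C)).
  - move=> m; apply: continuous_hscale_measurable; apply: continuous_mul => //.
    by apply: continuous_mul => //; exact: chi_continuous.
  - by apply: measurable_funM => //; exact: continuous_hscale_measurable.
  - move=> m x; have /andP[h1 h2] := wc m x.
    by rewrite mulr_ge0 ?expR_ge0//= ler_pM ?expR_ge0// ler_expR.
  apply: aeW => x; apply: cvgM; first exact: cvg_cst.
  by apply: cvgM; [exact: cvg_cst|exact: chiB].
have fin_ (K : hscale S p -> R) : continuous K -> (forall x, K x <= c) ->
    (\int[Pi]_x (expR (K x) * wB x)%:E)%E \is a fin_num.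
  move=> cK Kc; apply: (@probability_integral_fin _ _ _ Pi _ (expR c * C)).
    apply: measurable_funM => //; apply: continuous_hscale_measurable.
    by apply: continuous_after => //; exact: continuous_expR.
  move=> x; rewrite mulr_ge0 ?expR_ge0 ?mulr_ge0//=.
  rewrite ler_pM ?expR_ge0 ?mulr_ge0// ?ler_expR//.
  rewrite /wB indicE; case: (boolP (x \in B)) => xB; last by rewrite mulr0.
  have := wc 0%N x; rewrite /chi cutoff_inside ?slope_ge0//; first by case/andP.
  by move: xB; rewrite inE.
have nuK (K : hscale S p -> R) : continuous K ->
    (\int[nuB]_x (expR (K x))%:E = Z^-1%:E * \int[Pi]_x (expR (K x) * wB x)%:E)%E.
  move=> cK; rewrite nuBE//.
    apply/measurable_EFinP; apply: continuous_hscale_measurable.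
    by apply: continuous_after => //; exact: continuous_expR.
have cz : continuous (fun _ : hscale S p => 0 : R) by exact: cst_continuous.
have cNH : continuous (fun x => - H x) by exact: continuous_opp.
have lim0 := cvg_ _ cz (fun=> cge0).
have E0 (h : hscale S p -> R) : (\int[Pi]_x (expR 0 * h x)%:E = \int[Pi]_x (h x)%:E)%E.
  by apply: eq_integral => x _; rewrite expR0 mul1r.
have key : (\int[Pi]_x (expR (G x) * wB x)%:E * \int[Pi]_x (expR (- H x) * wB x)%:E
    <= Z%:E * Z%:E)%E.
  rewrite ZE -(E0 wB).
  apply: (lee_lim_product (fin_ _ cG Gc) (fin_ _ cNH Hc) (fin_ _ cz (fun=> cge0))
    (cvg_ _ cG Gc) (cvg_ _ cNH Hc) lim0).
  apply: nearW => m; rewrite !E0.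
  exact: (posterior_prekopa_leindler m cG cH Gc Hc cge0 GH).
rewrite (nuK _ cG) (nuK _ cNH).
move: key (fin_ _ cG Gc) (fin_ _ cNH Hc).
case: (\int[Pi]_x (expR (G x) * wB x)%:E)%E => // a.
case: (\int[Pi]_x (expR (- H x) * wB x)%:E)%E => // b.
rewrite -!EFinM !lee_fin => ab _ _.
rewrite mulrACA -invfM mulrC ler_pdivrMr ?mulr_gt0// mul1r.
exact: ab.
Qed.

End conditioned_posterior.

(** * Calculus in finitely many coordinates *)

Section coordinate_calculus.
Context {R : realType} (K : nat).
Implicit Types (f : 'rV[R]_K -> R) (x h : 'rV[R]_K).

Lemma derive_coordinates f x h : differentiable f x ->
  'D_h f x = \sum_(i < K) h 0 i * 'D_(delta_mx 0 i) f x.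
Proof.
move=> df; rewrite deriveE// {1}(row_sum_delta h) linear_sum.
by apply: eq_bigr => i _; rewrite linearZ deriveE.
Qed.

Lemma is_derive_line f x h (t : R) : differentiable f (x + t *: h) ->
  is_derive t 1 (fun s : R => f (x + s *: h)) ('D_h f (x + t *: h)).
Proof.
move=> df; have dh : derivable f (x + t *: h) h by exact: diff_derivable.
have E : (fun e : R => e^-1 *: ((fun s : R => f (x + s *: h)) (e *: (1 : R) + t) - f (x + t *: h))) =
    (fun e : R => e^-1 *: (f (e *: h + (x + t *: h)) - f (x + t *: h))).
  apply/funext => e; congr (_ *: (f _ - _)).
  have -> : e *: (1 : R) = e by exact: mulr1.
  by rewrite scalerDl addrCA.
split; first by rewrite /derivable E.
by rewrite /derive E.
Qed.

Lemma line_mvt f x h (c : R) : (forall z, differentiable f z) -> 0 <= c ->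
  exists2 t, 0 <= t <= c & f (x + c *: h) - f x =
    (\sum_(i < K) h 0 i * 'D_(delta_mx 0 i) f (x + t *: h)) * c.
Proof.
move=> df c0.
have cf : {within `[0, c], continuous (fun s : R => f (x + s *: h))}.
  apply: continuous_subspaceT => s; apply: differentiable_continuous.
  apply/derivable1_diffP; have [] := is_derive_line (df (x + s *: h)).
  by [].
have [t t01 E] := MVT_segment c0 (fun s _ => is_derive_line (df (x + s *: h))) cf.
exists t; first by move: t01; rewrite in_itv.
by move: E; rewrite scale0r addr0 subr0 derive_coordinates.
Qed.

Lemma bounded_partials_lipschitz f (C : R) :
  (forall z, differentiable f z) ->
  (forall i z, `|'D_(delta_mx 0 i) f z| <= C) ->
  forall x y, `|f x - f y| <= C * \sum_(i < K) `|x 0 i - y 0 i|.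
Proof.
move=> df dC x y.
have [t _] := line_mvt y (x - y) df ler01.
rewrite scale1r [y + _]addrC subrK mulr1 => ->.
rewrite mulr_sumr; apply: le_trans (ler_norm_sum _ _ _) _.
apply: ler_sum => i _; rewrite normrM mulrC !mxE.
by rewrite ler_wpM2r.
Qed.

Lemma sqr_sum_le (a : 'I_K -> R) :
  (\sum_(i < K) `|a i|) ^+ 2 <= K%:R * \sum_(i < K) a i ^+ 2.
Proof.
rewrite expr2 mulr_suml.
apply: (@le_trans _ _ (\sum_(i < K) \sum_(j < K) (a i ^+ 2 + a j ^+ 2) / 2)).
  apply: ler_sum => i _; rewrite mulr_sumr; apply: ler_sum => j _.
  have := sqr_ge0 (`|a i| - `|a j|).
  by rewrite -[a i ^+ 2]real_normK ?num_real// -[a j ^+ 2]real_normK ?num_real// !expr2; lra.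
have E1 : \sum_(i < K) \sum_(j < K) a i ^+ 2 = K%:R * \sum_(i < K) a i ^+ 2.
  by rewrite mulr_sumr; apply: eq_bigr => i _; rewrite sumr_const card_ord mulr_natl.
have E2 : \sum_(i < K) \sum_(j < K) a j ^+ 2 = K%:R * \sum_(i < K) a i ^+ 2.
  by rewrite sumr_const card_ord mulr_natl.
have -> : \sum_(i < K) \sum_(j < K) (a i ^+ 2 + a j ^+ 2) / 2 =
    (\sum_(i < K) \sum_(j < K) a i ^+ 2 + \sum_(i < K) \sum_(j < K) a j ^+ 2) / 2.
  rewrite -big_split/= mulr_suml; apply: eq_bigr => i _.
  by rewrite -big_split/= mulr_suml.
rewrite E1 E2; lra.
Qed.

Lemma smooth_bounded_uniform f :
  smooth_bounded f -> exists2 C, 0 <= C &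
    [/\ forall z, `|f z| <= C, forall i z, `|'D_(delta_mx 0 i) f z| <= C &
        forall i j z, `|'D_(delta_mx 0 j) ('D_(delta_mx 0 i) f) z| <= C].
Proof.
move=> sf.
have [_ [C0 H0]] := sf [::].
have /choice[c1 H1] (i : 'I_K) : exists C, forall z, `|'D_(delta_mx 0 i) f z| <= C.
  by have [_] := sf [:: i].
have /choice[c2 H2] (ij : 'I_K * 'I_K) : exists C, forall z,
    `|'D_(delta_mx 0 ij.2) ('D_(delta_mx 0 ij.1) f) z| <= C.
  by have [_] := sf [:: ij.2; ij.1].
have s1 : 0 <= \sum_i `|c1 i| by exact: sumr_ge0.
have s2 : 0 <= \sum_ij `|c2 ij| by exact: sumr_ge0.
exists (`|C0| + \sum_i `|c1 i| + \sum_ij `|c2 ij|); first by rewrite !addr_ge0.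
have n0 : 0 <= `|C0| by [].
split.
- move=> z; apply: le_trans (H0 z) _; apply: le_trans (ler_norm _) _; lra.
- move=> i z; apply: le_trans (H1 i z) _; apply: le_trans (ler_norm _) _.
  apply: (@le_trans _ _ (\sum_i `|c1 i|)); last by lra.
  by rewrite (bigD1 i)//= lerDl sumr_ge0.
- move=> i j z; apply: le_trans (H2 (i, j) z) _; apply: le_trans (ler_norm _) _.
  apply: (@le_trans _ _ (\sum_ij `|c2 ij|)); last by lra.
  by rewrite (bigD1 (i, j))//= lerDl sumr_ge0.
Qed.

(** The derivatives of f are Lipschitz, so the mean value theorem along the
    segment from x to y leaves an error quadratic in y - x. *)
Lemma taylor_lower_bound f : smooth_bounded f ->
  exists2 L, 0 <= L & forall x y,
    f x - f y <= \sum_(i < K) (- ((y 0 i - x 0 i) * 'D_(delta_mx 0 i) f x) +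
                               L * (y 0 i - x 0 i) ^+ 2).
Proof.
move=> sf.
have df z : differentiable f z by have [+ _] := sf [::]; exact.
have ddf i z : differentiable ('D_(delta_mx 0 i) f) z by have [+ _] := sf [:: i]; exact.
have [C C0 [_ _ HC]] := smooth_bounded_uniform sf.
(* The error is C times the square of an l1-norm, hence the factor K. *)
exists (C * K%:R); first by rewrite mulr_ge0.
move=> x y; pose h := y - x.
have [t /andP[t0 t1]] := line_mvt x h df ler01.
have xh : x + h = y by rewrite addrC subrK.
rewrite scale1r xh mulr1 => E.
rewrite -opprB E -sumrN big_split/= -mulr_sumr.
have Q : (\sum_(i < K) `|h 0 i|) ^+ 2 <= K%:R * \sum_(i < K) (y 0 i - x 0 i) ^+ 2.
  apply: le_trans (sqr_sum_le _) _; rewrite ler_wpM2l//.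
  by apply: ler_sum => i _; rewrite !mxE.
have : \sum_(i < K) - (h 0 i * 'D_(delta_mx 0 i) f (x + t *: h)) <=
    \sum_(i < K) - ((y 0 i - x 0 i) * 'D_(delta_mx 0 i) f x) +
    C * (\sum_(i < K) `|h 0 i|) ^+ 2.
  rewrite expr2 mulrA [C * _ * _]mulr_sumr -big_split/=; apply: ler_sum => i _.
  have -> : y 0 i - x 0 i = h 0 i by rewrite !mxE.
  have := bounded_partials_lipschitz (ddf i) (HC i) (x + t *: h) x.
  have -> : \sum_(i0 < K) `|(x + t *: h) 0 i0 - x 0 i0| = t * \sum_(i < K) `|h 0 i|.
    rewrite mulr_sumr; apply: eq_bigr => j _.
    by rewrite mxE [x 0 j + _]addrC addrK mxE normrM ger0_norm.
  set s := \sum_(i0 < K) `|h 0 i0|; set a := 'D_(_) f _; set b := 'D_(_) f _.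
  have s0 : 0 <= s by exact: sumr_ge0.
  move=> ab; have ab' : `|a - b| <= C * s.
    by apply: le_trans ab _; rewrite ler_wpM2l// ler_piMl.
  rewrite -lerBlDl opprK addrC -mulrBr; apply: le_trans (ler_norm _) _.
  by rewrite normrM distrC mulrC ler_wpM2r.
move=> /le_trans; apply; rewrite lerD2l -mulrA ler_wpM2l//.
Qed.

End coordinate_calculus.

Lemma hscale_coord_bound (R : realType) (S : spectrum R) (p : R) (h : hscale S p) k :
  `|h k| <= (Num.sqrt (hweight S p k))^-1 * `|h|.
Proof.
change (`|h k| <= (Num.sqrt (hweight S p k))^-1 * hnorm S p h).
have w0 := hweight_gt0 S p k.
rewrite mulrC ler_pdivlMr ?sqrtr_gt0//.
rewrite -ler_sqr ?nnegrE ?mulr_ge0 ?sqrtr_ge0// exprMn !sqr_sqrtr ?hdot_ge0 ?hcoefP ?(ltW w0)//.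
rewrite real_normK ?num_real//.
apply: (@le_trans _ _ (series (fun k => hweight S p k * (h k * h k)) k.+1)).
  rewrite /series/= big_nat_recr//= -expr2 mulrC lerDr sumr_ge0// => j _.
  by rewrite mulr_ge0 ?(ltW (hweight_gt0 _ _ _))// -expr2 sqr_ge0.
apply: nondecreasing_cvgn_le; last by apply: hdot_cvg; exact: hcoefP.
apply/nondecreasing_seqP => j; rewrite /series/= big_nat_recr//= lerDl.
by rewrite mulr_ge0 ?(ltW (hweight_gt0 _ _ _))// -expr2 sqr_ge0.
Qed.

(** Coordinates are continuous on H_p and f is Lipschitz in them. *)
Lemma cyl_continuous (R : realType) (S : spectrum R) (p : R) (K : nat)
  (f : 'rV[R]_K -> R) (C : R) :
  (forall z, differentiable f z) -> (forall i z, `|'D_(delta_mx 0 i) f z| <= C) ->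
  continuous (cyl f : hscale S p -> R).
Proof.
move=> df dC.
pose W := \sum_(k < K) (Num.sqrt (hweight S p k))^-1.
have W0 : 0 <= W by apply: sumr_ge0 => k _; rewrite invr_ge0 sqrtr_ge0.
apply: (@lipschitz_continuous _ _ _ (`|C| * W)); first exact: mulr_ge0.
move=> x y; have := bounded_partials_lipschitz df dC (hproj K x) (hproj K y).
move=> /le_trans; apply; rewrite -mulrA; 
apply: (@le_trans _ _ (`|C| * \sum_(i < K) `|hproj K x 0 i - hproj K y 0 i|)).
  by rewrite ler_wpM2r ?sumr_ge0// ler_norm.
rewrite ler_wpM2l// mulr_suml; apply: ler_sum => k _; rewrite !mxE.
exact: (hscale_coord_bound (x - y)).
Qed.

(** * From the duality of Laplace transforms to the variance *)

Section small_parameter.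
Context {R : realType}.

Lemma cube_lower_bound (z w : R) : 0 <= w -> - w <= z -> - w ^+ 3 <= z ^+ 3.
Proof.
move=> w0 zw; have [z0|z0] := leP 0 z.
  by apply: (@le_trans _ _ 0); rewrite ?oppr_le0 exprn_ge0.
have h : - z <= w by rewrite lerNl.
have : (- z) ^+ 3 <= w ^+ 3 by rewrite ler_pXn2r// nnegrE// oppr_ge0 ltW.
have -> : (- z) ^+ 3 = - z ^+ 3 by ring.
by rewrite lerNl.
Qed.

Lemma expR_tilted_expansion (e y gam a g b : R) :
  0 < e <= 1 -> `|y| <= a -> 0 <= gam <= g -> 0 <= b -> b * e <= 1 ->
  1 + e * y + e ^+ 2 * (y ^+ 2 / 2 - gam) -
    e ^+ 3 * (b * g + 2 * a * g + (a + 2 * g) ^+ 3 / 6) <=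
  expR (e * y - e ^+ 2 * (1 + b * e) * gam).
Proof.
move=> /andP[e0 e1] ya /andP[gam0 gamg] b0 be.
set z := e * y - _; apply: le_trans (expR_ge_cubic z).
have a0 : 0 <= a by exact: le_trans ya.
have g0 : 0 <= g by exact: le_trans gamg.
have /andP[ya1 ya2] : - a <= y <= a by rewrite -ler_norml.
pose q := 1 + b * e.
have q1 : 1 <= q by rewrite lerDl mulr_ge0// ltW.
have q2 : q <= 2 by rewrite /q; lra.
have e2 : 0 <= e ^+ 2 by exact: sqr_ge0.
have e3 : 0 <= e ^+ 3 by rewrite exprn_ge0// ltW.
have zE : z = e * y - e ^+ 2 * q * gam by [].
have h1 : e * y - e ^+ 2 * gam - e ^+ 3 * (b * g) <= z.
  rewrite zE /q.
  have := ler_wpM2l e3 (ler_wpM2l b0 gamg).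
  have -> : e ^+ 2 * (1 + b * e) * gam = e ^+ 2 * gam + e ^+ 3 * (b * gam) by ring.
  lra.
have h2 : e ^+ 2 * (y ^+ 2 / 2) - e ^+ 3 * (2 * a * g) <= z ^+ 2 / 2.
  have -> : z ^+ 2 / 2 = e ^+ 2 * (y ^+ 2 / 2) - e ^+ 3 * (q * (y * gam)) +
      (e ^+ 2 * q * gam) ^+ 2 / 2 by rewrite zE; field.
  have yg : y * gam <= a * g.
    by apply: (@le_trans _ _ (a * gam)); [rewrite ler_wpM2r|rewrite ler_wpM2l].
  have ag0 : 0 <= a * g by rewrite mulr_ge0.
  have qyg : q * (y * gam) <= 2 * a * g.
    apply: (@le_trans _ _ (q * (a * g))).
      by rewrite ler_wpM2l// (le_trans ler01).
    by rewrite -mulrA ler_wpM2r.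
  have := ler_wpM2l e3 qyg; have := sqr_ge0 (e ^+ 2 * q * gam).
  lra.
have h3 : - (e ^+ 3 * (a + 2 * g) ^+ 3) <= z ^+ 3.
  rewrite -exprMn; apply: cube_lower_bound.
    by rewrite mulr_ge0 ?(ltW e0)// addr_ge0// mulr_ge0.
  rewrite zE.
  have : e ^+ 2 * q * gam <= e * (2 * g).
    rewrite expr2 -!mulrA ler_wpM2l ?(ltW e0)//.
    apply: (@le_trans _ _ (1 * (q * gam))).
      by rewrite ler_wpM2r// mulr_ge0// (le_trans ler01).
    by rewrite mul1r ler_pM// (le_trans ler01).
  have := ler_wpM2l (ltW e0) ya1.
  rewrite mulrN mulrDr; lra.
lra.
Qed.

Lemma expR_opp_expansion (e y a : R) : 0 < e -> `|y| <= a ->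
  1 - e * y + e ^+ 2 * (y ^+ 2 / 2) - e ^+ 3 * (a ^+ 3 / 6) <= expR (- (e * y)).
Proof.
move=> e0 ya; apply: le_trans (expR_ge_cubic _).
have /andP[ya1 ya2] : - a <= y <= a by rewrite -ler_norml.
have a0 : 0 <= a by exact: le_trans ya.
have : - (e * a) ^+ 3 <= (- (e * y)) ^+ 3.
  apply: cube_lower_bound; first by rewrite mulr_ge0// ltW.
  by rewrite lerN2 ler_wpM2l// ltW.
rewrite sqrrN !exprMn; lra.
Qed.

(** Multiplying out, the terms of order e ^ 2 add up to v - V, and everything
    else is of order e ^ 3. *)
Lemma second_order_limit (v V C e0 : R) : 0 < e0 -> 0 <= C -> 0 <= v ->
  (forall e, 0 < e <= e0 -> exists A B,
     [/\ A * B <= 1, 0 <= A, 1 + e ^+ 2 * (v / 2 - V) - e ^+ 3 * C <= A &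
         1 + e ^+ 2 * (v / 2) - e ^+ 3 * C <= B]) ->
  v <= V.
Proof.
move=> e00 C0 v0 H; rewrite leNgt; apply/negP => Vv.
(* If v > V, take e so small that the remainders, at most e C2, stay below
   (v - V) / 2, and that the lower bound on B is nonnegative. *)
pose C2 := 2 * C + (`|v / 2 - V| + C) * (v / 2 + C) + 1.
have C20 : 0 < C2 by rewrite ltr_wpDl// addr_ge0 ?mulr_ge0// ?addr_ge0// mulr_ge0.
pose e := Num.min (Num.min e0 1) (Num.min (C + 1)^-1 ((v - V) / (2 * C2))).
have e_gt0 : 0 < e.
  by rewrite !lt_min e00 ltr01 invr_gt0 ltr_wpDl// divr_gt0 ?subr_gt0// mulr_gt0.
have [ee0 e1 eC eV] : [/\ e <= e0, e <= 1, e <= (C + 1)^-1 & e <= (v - V) / (2 * C2)].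
  by rewrite /e !ge_min !lexx ?orbT.
have [A [B [AB A0 HA HB]]] := H e (ltac:(by rewrite e_gt0 ee0)).
have eC1 : e * C <= 1.
  move: eC; rewrite -[leRHS]mul1r ler_pdivlMr ?ltr_wpDl// mulrDr mulr1 => h.
  by apply: le_trans h; rewrite lerDl ltW.
have e2 : 0 < e ^+ 2 by exact: exprn_gt0.
have e31 : e ^+ 3 * C <= 1.
  have -> : e ^+ 3 * C = e ^+ 2 * (e * C) by ring.
  apply: (@le_trans _ _ (1 * 1)); last by rewrite mulr1.
  apply: ler_pM => //; [exact: ltW|by rewrite mulr_ge0// ltW|].
  by rewrite expr_le1// ltW.
set a := v / 2 - V in HA; set w := v / 2 in HB.
have w0 : 0 <= w by rewrite divr_ge0.
set B1 := 1 + _ - _ in HB; set A1 := 1 + _ - _ in HA.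
have B10 : 0 <= B1.
  have := mulr_ge0 (ltW e2) w0; rewrite /B1; lra.
have AB1 : A1 * B1 <= 1.
  apply: (@le_trans _ _ (A * B1)); first by rewrite ler_wpM2r.
  by apply: le_trans AB; rewrite ler_wpM2l.
have E : A1 * B1 = 1 + e ^+ 2 * ((v - V) - 2 * e * C + e ^+ 2 * ((a - e * C) * (w - e * C))).
  by rewrite /A1 /B1 /a /w; field.
have : (v - V) - 2 * e * C + e ^+ 2 * ((a - e * C) * (w - e * C)) <= 0.
  rewrite -(pmulr_rle0 _ e2); move: AB1; rewrite E; lra.
have eCC : e * C <= C by rewrite ler_piMl.
have eC0 : 0 <= e * C by rewrite mulr_ge0// ltW.
have : `|(a - e * C) * (w - e * C)| <= (`|a| + C) * (w + C).
  rewrite normrM ler_pM//.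
    by apply: le_trans (ler_normB _ _) _; rewrite lerD2l ger0_norm.
  by apply: le_trans (ler_normB _ _) _; rewrite (ger0_norm w0) lerD2l ger0_norm.
set D := (_ - _) * _ => Dn.
have Dn2 : - ((`|a| + C) * (w + C)) <= D by move: Dn; rewrite ler_norml => /andP[].
have ee : e ^+ 2 <= e by rewrite expr2 ler_piMl// ltW.
have P0 : 0 <= (`|a| + C) * (w + C) by rewrite mulr_ge0// addr_ge0.
have h1 : - (e * ((`|a| + C) * (w + C))) <= e ^+ 2 * D.
  apply: (@le_trans _ _ (- (e ^+ 2 * ((`|a| + C) * (w + C))))).
    by rewrite lerN2 ler_wpM2r.
  by rewrite -mulrN ler_wpM2l// ltW.
have h2 : e * C2 <= (v - V) / 2.
  move: eV; rewrite invfM mulrA ler_pdivlMr//; lra.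
have h3 : e * C2 = 2 * e * C + e * ((`|a| + C) * (w + C)) + e by rewrite /C2 /a /w; ring.
move=> h4; lra.
Qed.

End small_parameter.

Section variance_from_laplace.
Context d (T : measurableType d) (R : realType) (P : probability T R).

Lemma bounded_measurable_integrable (f : T -> R) (c : R) :
  measurable_fun setT f -> (forall x, `|f x| <= c) -> P.-integrable setT (EFin \o f).
Proof.
move=> mf fc; apply: measurable_bounded_integrable => //.
  by apply: le_lt_trans (ltry 1); exact: probability_le1.
exists c; split; first by rewrite num_real.
by move=> M cM x _ /=; apply: le_trans (fc x) (ltW cM).
Qed.

Lemma Rintegral_affine (f1 f2 f3 : T -> R) (c k1 k2 k3 : R) :
  P.-integrable setT (EFin \o f1) -> P.-integrable setT (EFin \o f2) ->
  P.-integrable setT (EFin \o f3) ->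
  P.-integrable setT (EFin \o (fun x => c + k1 * f1 x + k2 * f2 x + k3 * f3 x)) /\
  \int[P]_x (c + k1 * f1 x + k2 * f2 x + k3 * f3 x) =
  c + k1 * \int[P]_x f1 x + k2 * \int[P]_x f2 x + k3 * \int[P]_x f3 x.
Proof.
move=> i1 i2 i3.
have iD (f h : T -> R) : P.-integrable setT (EFin \o f) -> P.-integrable setT (EFin \o h) ->
    P.-integrable setT (EFin \o (fun x => f x + h x)) by move=> fi hi; exact: (integrableD measurableT fi hi).
have iZ k (f : T -> R) : P.-integrable setT (EFin \o f) ->
    P.-integrable setT (EFin \o (fun x => k * f x)) by move=> fi; exact: (integrableZl measurableT k fi).
have ic : P.-integrable setT (EFin \o (fun=> c)) by exact: finite_measure_integrable_cst.
have j1 := iD _ _ ic (iZ k1 _ i1); have j2 := iD _ _ j1 (iZ k2 _ i2).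
have j3 := iD _ _ j2 (iZ k3 _ i3); split => //.
rewrite RintegralD//; last exact: iZ.
rewrite RintegralD//; last exact: iZ.
rewrite RintegralD//; last exact: iZ.
rewrite !RintegralZl// Rintegral_cst//.
rewrite [X in c * X](_ : _ = 1) ?mulr1//.
exact: (congr1 fine (probability_setT P)).
Qed.

Variables (Y Gam : T -> R) (a g b e0 : R).
Hypotheses (mY : measurable_fun setT Y) (mGam : measurable_fun setT Gam)
  (Ya : forall x, `|Y x| <= a) (Gamg : forall x, 0 <= Gam x <= g)
  (b0 : 0 <= b) (e0_gt0 : 0 < e0) (Y0 : \int[P]_x Y x = 0)
  (duality : forall e, 0 < e <= e0 ->
    (\int[P]_x (expR (e * Y x - e ^+ 2 * (1 + b * e) * Gam x))%:E *
     \int[P]_x (expR (- (e * Y x)))%:E <= 1)%E).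

(** Both integrands are bounded below by their second-order expansions, whose
    integrals involve only the variance of Y and the mean of Gam as Y is
    centred. *)
Lemma variance_le_of_laplace_duality :
  (\int[P]_x (Y x ^+ 2)%:E <= \int[P]_x (Gam x)%:E)%E.
Proof.
have a0 : 0 <= a by exact: le_trans (Ya point).
have g0 : 0 <= g by have /andP[h1 h2] := Gamg point; exact: le_trans h2.
have mY2 : measurable_fun setT (fun x => Y x ^+ 2) by exact: measurable_funX.
have iY : P.-integrable setT (EFin \o Y) by exact: bounded_measurable_integrable Ya.
have iG : P.-integrable setT (EFin \o Gam).
  by apply: (@bounded_measurable_integrable _ g) => // x; have /andP[? ?] := Gamg x; rewrite ger0_norm.
have iY2 : P.-integrable setT (EFin \o (fun x => Y x ^+ 2)).
  apply: (@bounded_measurable_integrable _ (a ^+ 2)) => // x.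
  by rewrite normrX ler_pXn2r ?nnegrE.
have ic c : P.-integrable setT (EFin \o (fun=> c)) by exact: finite_measure_integrable_cst.
pose v := \int[P]_x (Y x ^+ 2); pose V := \int[P]_x Gam x.
have finE (f : T -> R) : P.-integrable setT (EFin \o f) ->
    (\int[P]_x (f x)%:E = (\int[P]_x f x)%:E)%E.
  by move=> fi; rewrite /Rintegral fineK// integrable_fin_num.
rewrite !finE// lee_fin -/v -/V.
pose C := b * g + 2 * a * g + (a + 2 * g) ^+ 3 / 6.
have C0 : 0 <= C.
  apply: addr_ge0; last by rewrite divr_ge0// exprn_ge0// addr_ge0// mulr_ge0.
  by apply: addr_ge0; [exact: mulr_ge0|apply: mulr_ge0 => //; exact: mulr_ge0].
pose C' := a ^+ 3 / 6.
have C'0 : 0 <= C' by rewrite divr_ge0// exprn_ge0.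
have v0 : 0 <= v by apply: Rintegral_ge0 => x _; exact: sqr_ge0.
(* For e <= e1 both e <= 1 and b e <= 1 hold. *)
pose e1 := Num.min e0 (Num.min 1 (b + 1)^-1).
have e1_gt0 : 0 < e1 by rewrite !lt_min e0_gt0 ltr01 invr_gt0 ltr_wpDl.
apply: (@second_order_limit R v V (C + C') e1) => //; first by rewrite addr_ge0.
move=> e /andP[e_gt0 ee1].
have [ee0 e_le1 eb] : [/\ e <= e0, e <= 1 & e <= (b + 1)^-1].
  by move: ee1; rewrite !le_min => /and3P[].
have be : b * e <= 1.
  move: eb; rewrite -[leRHS]mul1r ler_pdivlMr ?ltr_wpDl// mulrDr mulr1 mulrC => h.
  by apply: le_trans h; rewrite lerDl ltW.
pose f1 x := expR (e * Y x - e ^+ 2 * (1 + b * e) * Gam x).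
pose f2 x := expR (- (e * Y x)).
have eY x : `|e * Y x| <= a.
  rewrite normrM (gtr0_norm e_gt0); apply: le_trans (Ya x).
  by rewrite ler_piMl.
have if1 : P.-integrable setT (EFin \o f1).
  apply: (@bounded_measurable_integrable _ (expR a)).
    apply: measurableT_comp => //; apply: measurable_funB; exact: measurable_funM.
  move=> x; rewrite ger0_norm ?expR_ge0// ler_expR.
  have := eY x; rewrite ler_norml => /andP[_]; apply: le_trans.
  have /andP[G0 _] := Gamg x.
  rewrite gerBl; apply: mulr_ge0 => //; apply: mulr_ge0; first exact: sqr_ge0.
  by rewrite addr_ge0// mulr_ge0// ltW.
have if2 : P.-integrable setT (EFin \o f2).
  apply: (@bounded_measurable_integrable _ (expR a)).
    apply: measurableT_comp => //; apply: measurableT_comp => //; exact: measurable_funM.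
  move=> x; rewrite ger0_norm ?expR_ge0// ler_expR.
  by have := eY x; rewrite ler_norml lerNl => /andP[].
exists (\int[P]_x f1 x), (\int[P]_x f2 x); split.
- have := duality (e := e); rewrite e_gt0 ee0 => /(_ isT).
  by rewrite -/(f1 _) -/(f2 _) !finE// -EFinM lee_fin.
- by apply: Rintegral_ge0 => x _; exact: expR_ge0.
- have [i1 E1] := Rintegral_affine (1 - e ^+ 3 * C) e (e ^+ 2 / 2) (- e ^+ 2) iY iY2 iG.
  apply: (@le_trans _ _ (\int[P]_x (1 - e ^+ 3 * C + e * Y x + e ^+ 2 / 2 * Y x ^+ 2 + - e ^+ 2 * Gam x))).
    rewrite E1 Y0 -/v -/V mulr0 addr0 [e ^+ 3 * (C + C')]mulrDr.
    have : 0 <= e ^+ 3 * C' by rewrite mulr_ge0// exprn_ge0// ltW.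
    move: (e ^+ 3 * C) (e ^+ 3 * C') => z z' z'0; lra.
  apply: le_Rintegral => // x _.
  have := @expR_tilted_expansion R e (Y x) (Gam x) a g b _ (Ya x) (Gamg x) b0 be.
  rewrite e_gt0 e_le1 -/C => /(_ isT); apply: le_trans.
  by rewrite le_eqVlt; apply/orP; left; apply/eqP; field.
- have [i1 E1] := Rintegral_affine (1 - e ^+ 3 * C') (- e) (e ^+ 2 / 2) 0 iY iY2 iG.
  apply: (@le_trans _ _ (\int[P]_x (1 - e ^+ 3 * C' + - e * Y x + e ^+ 2 / 2 * Y x ^+ 2 + 0 * Gam x))).
    rewrite E1 Y0 -/v -/V mulr0 addr0 mul0r addr0.
    have : 0 <= e ^+ 3 * C by rewrite mulr_ge0// exprn_ge0// ltW.
    rewrite [e ^+ 3 * (C + C')]mulrDr.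
    move: (e ^+ 3 * C) (e ^+ 3 * C') => z z' z0; lra.
  apply: le_Rintegral => // x _.
  apply: le_trans (expR_opp_expansion e_gt0 (Ya x)).
  by rewrite -/C' le_eqVlt; apply/orP; left; apply/eqP; field.
Qed.

End variance_from_laplace.

(** * The energy of a cylindrical function *)

Lemma continuous_bigsum (R : realType) (T : topologicalType) (I : Type) (r : seq I)
  (F : I -> T -> R) :
  (forall i, continuous (F i)) -> continuous (fun x => \sum_(i <- r) F i x).
Proof.
move=> cF; elim: r => [|i r IH].
  by under eq_fun do rewrite big_nil; exact: cst_continuous.
under eq_fun do rewrite big_cons.
by move=> x; apply: (@cvgD _ R^o); [exact: cF|exact: IH].
Qed.

(** Completing the square in h: the quadratic D h ^ 2 / 4 absorbs the linear
    term e h z at the cost e ^ 2 z ^ 2 / D, and the Taylor error e L h ^ 2, which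
    is at most a fraction of D h ^ 2, raises this cost by a factor close
    to 1. *)
Lemma quadratic_absorption (R : realType) (e D delta L h z : R) :
  0 < e -> 0 < delta -> delta <= D -> 0 <= L -> 8 * L / delta * e <= 1 ->
  e * (- (h * z) + L * h ^+ 2) - e ^+ 2 * (1 + 8 * L / delta * e) * (z ^+ 2 / D) <=
  D * h ^+ 2 / 4.
Proof.
move=> e0 d0 dD L0 s1; set s := 8 * L / delta * e in s1 *.
have D0 : 0 < D by exact: lt_le_trans dD.
have s0 : 0 <= s by rewrite !mulr_ge0// ?invr_ge0 ltW.
have eL : e * L <= s * D / 8.
  have -> : e * L = s * delta / 8 by rewrite /s; field; exact: lt0r_neq0.
  by rewrite ler_pM2r// ler_wpM2l.
rewrite -subr_ge0 -(pmulr_rge0 _ D0).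
have -> : D * (D * h ^+ 2 / 4 - (e * (- (h * z) + L * h ^+ 2) -
      e ^+ 2 * (1 + s) * (z ^+ 2 / D))) =
    (D * h) ^+ 2 / 4 - e * L * (D * h ^+ 2) + (D * h) * (e * z) + (1 + s) * (e * z) ^+ 2.
  by field; exact: lt0r_neq0.
apply: (@le_trans _ _ ((4^-1 - s / 8) * (D * h) ^+ 2 + (D * h) * (e * z) + (1 + s) * (e * z) ^+ 2)).
  have c0 : 0 < 4^-1 - s / 8 by lra.
  move: (D * h) (e * z) => X Z.
  rewrite -(pmulr_rge0 _ c0).
  have -> : (4^-1 - s / 8) * ((4^-1 - s / 8) * X ^+ 2 + X * Z + (1 + s) * Z ^+ 2) =
    ((4^-1 - s / 8) * X + Z / 2) ^+ 2 + s * (1 - s) / 8 * Z ^+ 2 by field.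
  by rewrite addr_ge0 ?sqr_ge0// mulr_ge0 ?sqr_ge0// divr_ge0// mulr_ge0// subr_ge0.
have h0 : 0 <= D * h ^+ 2 by rewrite mulr_ge0 ?sqr_ge0// ltW.
have := ler_wpM2r h0 eL.
have -> : s * D / 8 * (D * h ^+ 2) = s / 8 * (D * h) ^+ 2 by ring.
lra.
Qed.

Section cylinder_energy.
Context {R : realType} (S : spectrum R).

Lemma hdot_finite_support (q : R) (g h : nat -> R) K :
  (forall j, (K <= j)%N -> h j = 0) ->
  hdot S q g h = \sum_(j < K) hweight S q j * (g j * h j).
Proof.
move=> h0; apply: cvg_lim => //; apply: cvg_near_cst; exists K => // N /= KN.
rewrite /series/= (big_cat_nat _ KN)//= big_mkord [X in _ + X]big_nat_cond.
rewrite [X in _ + X]big1 ?addr0// => j /andP[/andP[Kj _] _].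
by rewrite h0// !mulr0.
Qed.

Variables (p q : R) (K : nat) (f : 'rV[R]_K -> R).
Implicit Types th : hscale S p.

Lemma cyl_grad_coef th j : cyl_grad q f th j =
  \sum_(k < K) S k `^ (- (2 * q)) * 'D_(delta_mx 0 k) f (hproj K th) * (j == k :> nat)%:R.
Proof.
rewrite /cyl_grad.
have coef0 : (0 : hscale S q) j = 0 by [].
have coefD (g h : hscale S q) : (g + h) j = g j + h j by [].
have coefZ c (g : hscale S q) : (c *: g) j = c * g j by [].
rewrite (big_morph (fun h : hscale S q => h j) coefD coef0).
by apply: eq_bigr => k _; rewrite coefZ.
Qed.

Lemma cyl_grad_coef_ord th (k : 'I_K) :
  cyl_grad q f th k = S k `^ (- (2 * q)) * 'D_(delta_mx 0 k) f (hproj K th).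
Proof.
rewrite cyl_grad_coef (bigD1 k)//= eqxx mulr1 big1 ?addr0// => i ik.
by rewrite eq_sym (_ : (_ == _) = false) ?mulr0//; apply/negbTE.
Qed.

Lemma cyl_grad_coef_out th j : (K <= j)%N -> cyl_grad q f th j = 0.
Proof.
move=> Kj; rewrite cyl_grad_coef big1// => k _.
by rewrite gtn_eqF ?mulr0// (leq_trans (ltn_ord k)).
Qed.

Lemma hweight_grad k (z : R) :
  hweight S q k * (S k `^ (- (2 * q)) * z) = z.
Proof.
rewrite /hweight mulrA -powRD ?(gt_eqF (eigval_gt0 S k)) ?implybT//.
by rewrite subrr powRr0 mul1r.
Qed.

Variables (alpha c0 : R) (n : nat).

Definition gradient_energy th : R :=
  \sum_(k < K) ('D_(delta_mx 0 k) f (hproj K th)) ^+ 2 /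
     (n%:R * c0 + S k `^ (2 * alpha + (sdim S)%:R)).

(** The powers of lambda_k from the H_q-gradient, the inner product of H_q and
    the operator cancel, so the energy does not depend on q. *)
Lemma gradient_energyE th : 0 <= c0 -> q <= alpha + (sdim S)%:R / 2 ->
  hdot S q (Aop n c0 alpha (cyl_grad q f th)) (cyl_grad q f th) = gradient_energy th.
Proof.
move=> c00 hq; rewrite (@hdot_finite_support q _ _ K); last exact: cyl_grad_coef_out.
apply: eq_bigr => k _; rewrite (AopE n _ c00 hq) cyl_grad_coef_ord.
set z := 'D_(_) f _; set w := S k `^ (- (2 * q)); rewrite /acoef.
have e := hweight_grad k z; rewrite -/w in e.
rewrite (_ : hweight _ _ _ * _ = (hweight S q k * (w * z)) * (S k `^ (2 * q) * (w * z)) /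
  (n%:R * c0 + S k `^ (2 * alpha + (sdim S)%:R))); last by ring.
by rewrite {1}e -[S k `^ (2 * q)]/(hweight S q k) e expr2.
Qed.

Lemma cyl_grad_normE th :
  `|cyl_grad q f th| ^+ 2 = \sum_(k < K) S k `^ (- (2 * q)) * ('D_(delta_mx 0 k) f (hproj K th)) ^+ 2.
Proof.
change (hnorm S q (cyl_grad q f th) ^+ 2 =
  \sum_(k < K) S k `^ (- (2 * q)) * ('D_(delta_mx 0 k) f (hproj K th)) ^+ 2).
rewrite sqr_sqrtr ?hdot_ge0 ?hcoefP//.
rewrite (@hdot_finite_support q _ _ K); last exact: cyl_grad_coef_out.
apply: eq_bigr => k _; rewrite cyl_grad_coef_ord mulrA hweight_grad.
by rewrite expr2; ring.
Qed.

Lemma gradient_energy_le_kappa th : 0 <= c0 -> q <= alpha + (sdim S)%:R / 2 ->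
  gradient_energy th <= kappa S n c0 alpha q * `|cyl_grad q f th| ^+ 2.
Proof.
move=> c00 hq; rewrite cyl_grad_normE kappaE// mulr_sumr; apply: ler_sum => k _.
have ak : acoef S n c0 alpha q k <= sup (range (acoef S n c0 alpha q)).
  apply: ub_le_sup; last by exists k.
  by exists (S 0%N `^ (2 * q - (2 * alpha + (sdim S)%:R))) => _ [j _ <-];
    have /andP[] := @acoef_bound _ S n c0 alpha q j c00 hq.
set z := 'D_(_) f _; rewrite mulrA.
apply: le_trans (ler_wpM2r (sqr_ge0 z) (ler_wpM2r (powR_ge0 _ _) ak)).
rewrite /acoef [_ / _ * _]mulrAC -powRD ?(gt_eqF (eigval_gt0 S k)) ?implybT//.
by rewrite subrr powRr0 mul1r mulrC.
Qed.

Lemma gradient_energy_ge0 th : 0 <= c0 -> 0 <= gradient_energy th.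
Proof.
move=> c00; apply: sumr_ge0 => k _.
by rewrite divr_ge0 ?sqr_ge0// addr_ge0 ?powR_ge0// mulr_ge0.
Qed.

End cylinder_energy.

(** * The Poincare inequality *)

Lemma conditioned_integral_ball (R : realType) (S : spectrum R) (p : R)
  (nu nuB : probability (hscale S p) R) (B : set (hscale S p)) (f : hscale S p -> R) :
  measurable B -> conditioned nu B nuB -> nuB.-integrable setT (EFin \o f) ->
  (\int[nuB]_(th in B) (f th)%:E = \int[nuB]_th (f th)%:E)%E.
Proof.
move=> mB hnuB fi.
have mC : measurable (~` B) by exact: measurableC.
have C0 : nuB (~` B) = 0%E by rewrite hnuB// setICl measure0 mul0r.
by rewrite (negligible_integral mC measurableT fi C0) setTD setCK.
Qed.

Theorem lemma5p10 (R : realType) (S : spectrum R)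
  (p alpha beta : R) (hp : 0 <= p) (halpha : p < alpha) (hbeta : p < beta)
  (d : measure_display) (X : measurableType d)
  (mu : {sigma_finite_measure set X -> \bar R})
  (bx : X -> hscale S (- p)) (mbx : measurable_fun setT bx)
  (hM : forall th, (0 < partition_fun mu bx th < +oo)%E)
  (th0 : hscale S p) (hth0 : (th0 : nat -> R) \in in_hs S beta)
  (Pi : probability (hscale S p) R) (hPi : gaussian_prior alpha Pi)
  (hZ : forall (n : nat) (tau : hscale S (- p)), (0 < n)%N ->
    (tilt_const Pi n tau (log_partition mu bx) < +oo)%E)
  (r r0 c0 C0 : R) (hr : 0 < r) (hr0 : r < r0) (hc0 : 0 < c0) (hC0 : c0 <= C0)
  (hmean : forall th : hscale S p, hball th0 r0 th ->
    (expfam_mean mu bx th (fun x => `|bx x|%R) < +oo)%E)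
  (hupper : forall h : hscale S p,
    (fisher_info mu bx th0 h <= (C0 * hnorm S 0 h ^+ 2)%:E)%E)
  (hlower : forall h th : hscale S p, hball th0 r0 th ->
    ((c0 * hnorm S 0 h ^+ 2)%:E <= fisher_info mu bx th h)%E)
  (hC2 : C2_frechet (log_partition mu bx))
  (q : R) (hq0 : 0 <= q) (hq : q <= alpha + (sdim S)%:R / 2)
  (n : nat) (hn : (0 < n)%N) (tau : hscale S (- p))
  (nu nuB : probability (hscale S p) R)
  (hnu : tilted Pi n tau (log_partition mu bx) nu)
  (hnuB : conditioned nu (hball th0 r) nuB)
  (K : nat) (hK : (0 < K)%N) (f : 'rV[R]_K -> R) (hf : smooth_bounded f) :
  ('V_nuB[cyl f] <=
     \int[nuB]_(th in hball th0 r)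
       (hdot S q (Aop n c0 alpha (cyl_grad q f th)) (cyl_grad q f th))%:E)%E /\
  (\int[nuB]_(th in hball th0 r)
       (hdot S q (Aop n c0 alpha (cyl_grad q f th)) (cyl_grad q f th))%:E <=
   (kappa S n c0 alpha q)%:E *
     \int[nuB]_(th in hball th0 r)
       (`|cyl_grad q f th| ^+ 2)%:E)%E.
Proof.
pose M := log_partition mu bx.
have cM : continuous M.
  by move=> th; have [DM [dM _ _ _]] := hC2; exact: differentiable_continuous.
have c0_ge0 : 0 <= c0 by exact: ltW.
have convM := log_partition_midpoint_convex mbx hM.
have strongM := log_partition_strongly_midpoint_convex mbx hM hp c0_ge0 hlower.
have mB : measurable (hball th0 r) := hball_measurable th0 r.
have nR : 0 < n%:R :> R by rewrite ltr0n.
have [C C_ge0 [fC f1C f2C]] := smooth_bounded_uniform hf.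
have df z : differentiable f z by have [+ _] := hf [::]; exact.
have ddf i z : differentiable ('D_(delta_mx 0 i) f) z by have [+ _] := hf [:: i]; exact.
pose D k : R := n%:R * c0 + S k `^ (2 * alpha + (sdim S)%:R).
pose delta : R := n%:R * c0.
have delta0 : 0 < delta by exact: mulr_gt0.
have deltaD k : delta <= D k by rewrite lerDl powR_ge0.
have D0 k : 0 < D k by exact: lt_le_trans (deltaD k).
pose F : hscale S p -> R := cyl f.
pose Gam : hscale S p -> R := gradient_energy f alpha c0 n.
have cF : continuous F := cyl_continuous df f1C.
have cdF i : continuous (cyl ('D_(delta_mx 0 i) f) : hscale S p -> R) :=
  cyl_continuous (ddf i) (f2C i).
have cGam : continuous Gam.
  apply: continuous_bigsum => k.
  have := @continuous_cstM R _ (D k)^-1 _ (continuous_mul (cdF k) (cdF k)).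
  by under eq_fun do rewrite mulrC -expr2.
have mF := continuous_hscale_measurable cF.
have mGam := continuous_hscale_measurable cGam.
pose g : R := \sum_(k < K) C ^+ 2 / D k.
have Gam0 th : 0 <= Gam th by exact: gradient_energy_ge0.
have Gamg th : 0 <= Gam th <= g.
  rewrite Gam0/=; apply: ler_sum => k _.
  rewrite -/(D k) ler_wpM2r ?invr_ge0 ?(ltW (D0 k))//.
  have : `|'D_(delta_mx 0 k) f (hproj K th)| ^+ 2 <= C ^+ 2 by rewrite ler_pXn2r ?nnegrE.
  by rewrite real_normK ?num_real.
have iF : nuB.-integrable setT (EFin \o F).
  by apply: (bounded_measurable_integrable _ mF (c := C)) => th; exact: fC.
have iGam : nuB.-integrable setT (EFin \o Gam).
  apply: (bounded_measurable_integrable _ mGam (c := g)) => th.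
  by have /andP[? ?] := Gamg th; rewrite ger0_norm.
have energy th : hdot S q (Aop n c0 alpha (cyl_grad q f th)) (cyl_grad q f th) = Gam th.
  exact: gradient_energyE.
under eq_integral do rewrite energy.
split; last first.
  have kappa0 : 0 <= kappa S n c0 alpha q.
    rewrite kappaE//; have /andP[a0 _] := @acoef_bound _ S n c0 alpha q 0%N c0_ge0 hq.
    apply: le_trans a0 _; apply: ub_le_sup; last by exists 0%N.
    by exists (S 0%N `^ (2 * q - (2 * alpha + (sdim S)%:R))) => _ [j _ <-];
      have /andP[] := @acoef_bound _ S n c0 alpha q j c0_ge0 hq.
  have mN : measurable_fun setT (fun th : hscale S p => `|cyl_grad q f th| ^+ 2).
    under eq_fun do rewrite cyl_grad_normE.
    apply: continuous_hscale_measurable; apply: continuous_bigsum => k.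
    exact: (continuous_cstM (continuous_mul (cdF k) (cdF k))).
  rewrite -ge0_integralZl_EFin//; last first.
    by apply/measurable_EFinP; exact: measurable_funTS.
  apply: ge0_le_integral => //.
  - by move=> th _; rewrite lee_fin.
  - by apply/measurable_EFinP; exact: measurable_funTS.
  - apply/measurable_EFinP; apply: measurable_funTS; exact: measurable_funM.
  move=> th _; rewrite -EFinM lee_fin; exact: gradient_energy_le_kappa.
rewrite (conditioned_integral_ball mB hnuB iGam).
have [L L0 taylor] := taylor_lower_bound hf.
(* The constant of [quadratic_absorption]; it controls the Taylor error. *)
pose b : R := 8 * L / delta.
have b0 : 0 <= b by rewrite divr_ge0 ?mulr_ge0// ltW.
pose m : R := \int[nuB]_th F th.
pose Y th : R := F th - m.
have mY : measurable_fun setT Y by exact: measurable_funB.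
have Ya th : `|Y th| <= C + `|m|.
  by apply: le_trans (ler_normB _ _) _; rewrite lerD2r; exact: fC.
have -> : ('V_nuB[cyl f] = \int[nuB]_th (Y th ^+ 2)%:E)%E.
  rewrite /variance unlock unlock; apply: eq_integral => th _.
  by rewrite expr2.
have Y0 : \int[nuB]_th Y th = 0.
  rewrite RintegralB//; last exact: finite_measure_integrable_cst.
  rewrite Rintegral_cst// (_ : fine _ = 1) ?mulr1 ?subrr//.
  exact: (congr1 fine (probability_setT nuB)).
have e00 : 0 < (b + 1)^-1 by rewrite invr_gt0 ltr_wpDl.
apply: (variance_le_of_laplace_duality mY mGam Ya Gamg b0 e00 Y0).
move=> e /andP[e0 eb].
have be : b * e <= 1.
  move: eb; rewrite -[leRHS]mul1r ler_pdivlMr ?ltr_wpDl// mulrDr mulr1 mulrC => h.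
  by apply: le_trans h; rewrite lerDl ltW.
have cY : continuous Y by apply: continuous_sub => //; exact: cst_continuous.
have a0 : 0 <= C + `|m| by rewrite addr_ge0.
have eYa th : e * Y th <= e * (C + `|m|) /\ - (e * Y th) <= e * (C + `|m|).
  have := Ya th; rewrite ler_norml => /andP[h1 h2].
  by rewrite -mulrN !ler_pM2l// lerNl.
apply: (@conditioned_laplace_duality R S p alpha hp Pi hPi M th0 r r0 c0 cM convM strongM
  c0_ge0 hr0 n tau nu nuB hnu hnuB
  (fun th => e * Y th - e ^+ 2 * (1 + b * e) * Gam th) (fun th => e * Y th)
  (e * (C + `|m|)) K).
- by apply: continuous_sub; exact: continuous_cstM.
- exact: continuous_cstM.
- move=> th; apply: le_trans (proj1 (eYa th)).
  rewrite gerBl; apply: mulr_ge0 => //; apply: mulr_ge0; first exact: sqr_ge0.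
  by rewrite addr_ge0// mulr_ge0// ltW.
- by move=> th; exact: (proj2 (eYa th)).
- by rewrite mulr_ge0// ltW.
move=> N x y KN.
have step : e * Y x - e ^+ 2 * (1 + b * e) * Gam x - e * Y y <=
    \sum_(k < K) D k * (x k - y k) ^+ 2 / 4.
  have -> : e * Y x - e ^+ 2 * (1 + b * e) * Gam x - e * Y y =
      e * (F x - F y) - e ^+ 2 * (1 + b * e) * Gam x by rewrite /Y; ring.
  have tF := taylor (hproj K x) (hproj K y).
  apply: (@le_trans _ _ (e * (\sum_(i < K)
      (- ((y i - x i) * 'D_(delta_mx 0 i) f (hproj K x)) + L * (y i - x i) ^+ 2)) -
      e ^+ 2 * (1 + b * e) * Gam x)).
    rewrite lerD2r ler_pM2l//; apply: le_trans tF _.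
    by rewrite le_eqVlt; apply/orP; left; apply/eqP/eq_bigr => i _; rewrite !mxE.
  rewrite /Gam /gradient_energy !mulr_sumr -sumrB; apply: ler_sum => k _.
  apply: le_trans (quadratic_absorption _ _ e0 delta0 (deltaD k) L0 be) _.
  by rewrite -(sqrrN (x k - y k)) opprB.
apply: le_trans step _; rewrite -mulr_suml ler_wpM2r ?invr_ge0//.
(* The coordinates beyond K only add nonnegative terms. *)
rewrite -[leRHS](big_mkord xpredT (fun k => D k * (x k - y k) ^+ 2)).
rewrite -[leLHS](big_mkord xpredT (fun k => D k * (x k - y k) ^+ 2)).
rewrite (big_cat_nat _ KN)//= lerDl sumr_ge0// => k _.
by rewrite mulr_ge0 ?sqr_ge0// ltW.
Qed.
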